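(* Let $(M,\mathcal H)$ be a uniformly $k$-nondegenerate CR hypersurface of dimension $2n+1$, let $(O^N_{0,-2},O^N_{0,2})$ be a choice of normalization condition, and suppose $\phi$ is a local adapted frame of $\mathbb{C}TM$ around $p$, with Levi kernel part $e_1,\dots,e_{n-s}$, such that the modified symbol $\mathfrak{g}_{\leq0}^{\mathrm{mod}}(\tilde\phi;p)$ at the point $p$ along $\tilde\phi$ is given by matrices $(e^{ih(\tilde\phi)}H(\tilde\phi),\Xi_1(\tilde\phi),\dots,\Xi_{n-s}(\tilde\phi),\Omega_1(\tilde\phi),\dots,\Omega_{n-s}(\tilde\phi))$. Then there are unique classes $B_1,\dots,B_{n-s}\in\mathfrak{csp}(\mathbb{C}\mathfrak{g}_{-1})_{0,0}/\mathfrak{g}_{0,0}(\tilde\phi;p)$ such that $$e_\alpha\left(S^{0,-2}_\beta(\tilde\phi)\right)(p)-\left[B_\alpha,S^{0,-2}_\beta(\tilde\phi(p))\right]=O_{0,-2}^N(\tilde\phi(p))\big(e_\alpha,S^{0,-2}_\beta(\tilde\phi(p))\big)$$ and $$e_\alpha\left(S^{0,2}_\beta(\tilde\phi)\right)(p)-\left[B_\alpha,S^{0,2}_\beta(\tilde\phi(p))\right]=O_{0,2}^N(\tilde\phi(p))\big(e_\alpha,S^{0,2}_\beta(\tilde\phi(p))\big)$$ hold for all $\alpha,\beta$ (as equalities in $\mathfrak{csp}(\mathbb{C}\mathfrak{g}_{-1})_{0,\mp2}/\tilde\phi(\mathfrak g_{0,\mp2}(p))$ respectively). The modified symbol $\mathfrak{g}_{\leq0}^{\mathrm{mod}}(\tilde\phi(p))$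 at $\tilde\phi(p)$ with respect to the normalization condition $(O_{0,-2}^N(\tilde\phi(p)),O_{0,2}^N(\tilde\phi(p)))$ is given by the matrices $$(e^{ih(\tilde\phi)}H(\tilde\phi),\Xi_1(\tilde\phi),\dots,\Xi_{n-s}(\tilde\phi),\Omega_1(\tilde\phi)+B_1,\dots,\Omega_{n-s}(\tilde\phi)+B_{n-s})$$ and is independent of the extension of $\tilde\phi(p)$ to a normalized section.
   Context: CR BASICS. $(M,\mathcal H)$: $M$ real of dimension $2n+1$, $\mathcal H\subset\mathbb CTM$ complex rank $n$, $[\mathcal H,\mathcal H]\subset\mathcal H$, $\mathcal H\cap\overline{\mathcal H}=0$. Put $\mathcal K_1=\mathcal H$ and for $j\ge2$ let $\mathcal K_j$ be the set of $v\in\mathcal K_{j-1}$ with $\frac1{2i}[\ldots[V,\overline{X^{(1)}}],\ldots,\overline{X^{(j-1)}}]_p\in\mathcal H\oplus\overline{\mathcal H}$ for all sections $X^{(i)}$ of $\mathcal H$ ($V$ a section of $\mathcal K_{j-1}$ extending $v$); $\mathcal K_2$ is the Levi kernel. Uniformly $k$-nondegenerate: all $\mathcal K_j$ have constant rank and $\mathcal K_k\ne\mathcal K_{k+1}=0$. $s=\mathrm{rank}(\mathcal H/\mathcal K_2)$. ALGEBRA. $\mathbb C\mathfrak g_-\oplus\mathfrak{csp}(\mathbb C\mathfrak g_{-1})$, with $\mathbb{C}\mathfrak g_-=\mathfrak g_{-2,0}\oplus\mathfrak g_{-1,-1}\oplus\mathfrak g_{-1,1}$ the complex Heisenberg algebra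 of dimension $2s+1$ and $\mathfrak{csp}(\mathbb C\mathfrak g_{-1})=\bigoplus_{j\in\{-2,0,2\}}\mathfrak{csp}(\mathbb C\mathfrak g_{-1})_{0,j}$ its first-grading preserving derivations, is represented by $$\begin{pmatrix} c & 0 & 0 & 0 \\ v_1 & L & S^{0,2} & 0 \\ v_2 & S^{0,-2} & -L^T & 0 \\ u i & v_2^T & -v_1^T & -c \end{pmatrix}$$ with $u$ for $\mathfrak g_{-2,0}$, $v_1\in\mathbb C^s$ for $\mathfrak g_{-1,1}$, $v_2\in\mathbb C^s$ for $\mathfrak g_{-1,-1}$, symmetric $S^{0,\pm2}$ for $\mathfrak{csp}(\mathbb C\mathfrak g_{-1})_{0,\pm2}$, and $c,L$ for $\mathfrak{csp}(\mathbb C\mathfrak g_{-1})_{0,0}$. SYMBOLS. $\mathbb C\mathfrak g_-(p)$ has components $\mathfrak g_{-2,0}(p)=\mathbb CT_pM/(\mathcal H_p\oplus\overline{\mathcal H}_p)$, $\mathfrak g_{-1,1}(p)=\mathcal H_p/(\mathcal K_2)_p$, $\mathfrak g_{-1,-1}(p)=\overline{\mathcal H}_p/(\overline{\mathcal K_2})_p$, with bracket induced by Lie brackets. $\iota:(\mathcal K_2)_p\to\mathfrak{csp}(\mathbb C\mathfrak g_{-1}(p))_{0,2}$: $\iota(v)(w)=0$ for $w\in\mathfrak g_{-1,1}(p)$ and $\iota(v)(w)=[V,W]_p\bmod(\mathcal K_2\oplus\overline{\mathcal H})$ for $w\in\mathfrak g_{-1,-1}(p)$ ($V,W$ sections of $\mathcal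 K_2,\overline{\mathcal H}$ extending $v,w$), extended by $\iota(\overline v)=\overline{\iota(v)}$. $\mathfrak g_{0,2}(p)=\iota(\mathcal K_2)_p$, $\mathfrak g_{0,-2}(p)=\iota(\overline{\mathcal K_2})_p$; $\mathfrak g_{0,0}(p)$ is the set of bigrading preserving elements of $\mathfrak{csp}(\mathbb C\mathfrak g_{-1}(p))$ normalizing $\mathfrak g_{0,\pm2}(p)$. $\mathcal F_p$ is the set of bigraded Lie algebra isomorphisms $\tilde\phi:\mathbb C\mathfrak g_-(p)\to\mathbb C\mathfrak g_-$, extended to derivations by conjugation; $\mathfrak g_{0,0}(\tilde\phi;p):=\tilde\phi(\mathfrak g_{0,0}(p))$. An adapted frame is $\phi=(g,f_1,\dots,f_s,\overline{f_1},\dots,\overline{f_s},e_1,\dots,e_{n-s},\overline{e_1},\dots,\overline{e_{n-s}})$, with $g$, $(f_i)$ representing bases of $\mathfrak g_{-2,0}(p)$, $\mathfrak g_{-1,1}(p)$ and $(e_\alpha)$ a basis of $\mathcal K_2$; the corresponding $\tilde\phi\in\mathcal F_p$ is the one sending $g$ to the element with $u=1$ and $f_i$ to the element with $v_1$ the $i$th standard vector. The pair $(H(\tilde\phi),e^{ih(\tilde\phi)})$, $H(\tilde\phi)$ Hermitian, is the one (unique up to a common sign) with $\tilde\phi(\overline{f_j})$ having $v_2$ equal to $e^{ih(\tilde\phi)}$ times the $j$th column of $H(\tilde\phi)$. The matrices $\Xi_\alpha(\tilde\phi)$ are defined by $\iota(e_\alpha)(\overline{f_k})=\sum_l(\Xi_\alpha(\tilde\phi))_{l,k}f_l$,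 and $$S^{0,2}_\alpha(\tilde\phi):=e^{-ih(\tilde\phi)}\Xi_\alpha(\tilde\phi)H(\tilde\phi)^{-1},\qquad S^{0,-2}_\alpha(\tilde\phi):=e^{ih(\tilde\phi)}H(\tilde\phi)\overline{\Xi_\alpha(\tilde\phi)}$$ represent $\tilde\phi(\iota(e_\alpha))$ and $\tilde\phi(\iota(\overline{e_\alpha}))$. MODIFIED SYMBOL ALONG A SECTION. Let $\pi:M\to N$ be the local quotient by the foliation of $TM\cap(\mathcal K_2\oplus\overline{\mathcal K_2})$, $M_{\pi(p)}$ the leaf through $p$, and $\mathscr I(\tilde\phi)=(\pi_*\circ\tilde\phi^{-1})^{-1}$. For a local section $\tilde\phi:M_{\pi(p)}\to\mathcal F$ let $\iota_{\tilde\phi}:(\mathcal K_2)_p\oplus(\overline{\mathcal K_2})_p\to\mathfrak{csp}(\mathbb C\mathfrak g_{-1})$ be the complex linear extension of $\dot p(0)\mapsto\frac{d}{dt}|_{t=0}\mathscr I(\tilde\phi(p))\circ\mathscr I(\tilde\phi(p(t)))^{-1}$ for curves $p(t)$ in $M_{\pi(p)}$ with $p(0)=p$. The modified symbol at $p$ along $\tilde\phi$ is $\mathfrak g_{\le0}^{\mathrm{mod}}(\tilde\phi;p)=\mathbb C\mathfrak g_-\oplus(\iota_{\tilde\phi}(\mathcal K_2(p)\oplus\overline{\mathcal K_2}(p))+\mathfrak g_{0,0}(\tilde\phi;p))$. It is ''given by the matrices'' $(e^{ih}H,\Xi_\alpha,\Omega_\alpha)$ when, modulo the element with only $c$ nonzero,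 $\iota_{\tilde\phi}(e_\alpha)$ has $L=\Omega_\alpha$, $S^{0,2}=e^{-ih}\Xi_\alpha H^{-1}$ and other blocks zero (equivalently $[e_\alpha,f_k](p)\equiv\sum_l(\Omega_\alpha)_{l,k}f_l\bmod\mathcal K_2\oplus\overline{\mathcal K_2}$); $\iota_{\tilde\phi}(\overline{e_\alpha})$ is then obtained by applying the involution induced by complex conjugation. The $\Omega_\alpha$ matter only modulo $\mathfrak g_{0,0}(\tilde\phi;p)$, and in sums with $\Omega_\alpha$ only the $L$ part of $B_\alpha$ is used. NORMALIZATION. Define bilinear maps $O_{0,\pm2}(\tilde\phi)(p):(\mathcal K_2)_p\otimes\tilde\phi(\mathfrak g_{0,\pm2}(p))\to\mathfrak{csp}(\mathbb C\mathfrak g_{-1})_{0,\pm2}/\tilde\phi(\mathfrak g_{0,\pm2}(p))$ by $(X,S^{0,\pm2}_\alpha)\mapsto X(S^{0,\pm2}_\alpha(\tilde\phi))(p)$. A normalization condition is a choice, depending only on $\tilde\phi(\mathfrak g_{0,\pm2}(p))$ and the class itself, of one pair $(O^N_{0,-2}(\tilde\phi(p)),O^N_{0,2}(\tilde\phi(p)))$ in each class $\{(O_{0,-2}(\tilde\phi')(p),O_{0,2}(\tilde\phi')(p)):\tilde\phi':M_{\pi(p)}\to\mathcal F,\ \tilde\phi'(p)=\tilde\phi(p)\}$ (with $(0,0)$ chosen when it belongs to the class). A section is normalized at $p$ if $O_{0,\pm2}(\tilde\phi)(p)=O^N_{0,\pm2}(\tilde\phi(p))$; for a normalized section, $\mathfrak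 g_{\le0}^{\mathrm{mod}}(\tilde\phi(p)):=\mathfrak g_{\le0}^{\mathrm{mod}}(\tilde\phi;p)$ is called the modified symbol at $\tilde\phi(p)$ with respect to the normalization condition.
   Formalization: In the modified symbol the image of the conjugate Levi kernel is taken as the conjugation involution applied to the image of the Levi kernel, not as the linear extension of the derivative along leaf curves; with the latter, independence of the normalized section fails. *)

(* Defs.v *)
From HB Require Import structures.
From mathcomp Require Import all_boot all_order all_algebra.
From mathcomp Require Import all_classical all_reals all_analysis.
From mathcomp Require Import complex.
Set Implicit Arguments. Unset Strict Implicit. Unset Printing Implicit Defensive.
Import Order.TTheory GRing.Theory Num.Theory.
Import numFieldNormedType.Exports.
Local Open Scope classical_set_scope.
Local Open Scope ring_scope.

(** ** Smooth calculus in coordinates *)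

(* Points of R^(m+1) and complex tangent vectors are row vectors; a complex
   vector field is given by its coefficients in the coordinate frame. *)
Notation rvec R m := 'rV[R]_m.+1.
Notation cvec R m := 'rV[R[i]]_m.+1.
Notation vfield R m := ('rV[R]_m.+1 -> 'rV[R[i]]_m.+1).

Definition partial (R : realType) (m : nat) (j : 'I_m.+1)
    (f : rvec R m -> R) : rvec R m -> R :=
  fun x => 'D_(delta_mx 0 j : rvec R m) f x.

Fixpoint Cn (R : realType) (m k : nat) (U : set (rvec R m))
    (f : rvec R m -> R) : Prop :=
  match k with
  | 0 => forall x, U x -> {for x, continuous f}
  | k'.+1 => (forall x, U x -> differentiable f x) /\
             (forall j, Cn k' U (partial j f))
  end.

Definition smooth (R : realType) (m : nat) (U : set (rvec R m))
  (f : rvec R m -> R) : Prop := forall k, Cn k U f.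

Definition smooth_map (R : realType) (m m' : nat) (U : set (rvec R m))
    (f : rvec R m -> rvec R m') : Prop :=
  forall j, smooth U (fun x => f x 0 j).

Definition smooth_vf (R : realType) (m : nat) (U : set (rvec R m))
    (X : vfield R m) : Prop :=
  forall j, smooth U (fun x => complex.Re (X x 0 j)) /\
            smooth U (fun x => complex.Im (X x 0 j)).

(* C^oo curve defined near 0 *)
Definition smooth_curve (R : realType) (m : nat) (eps : R)
    (gam : R -> rvec R m) : Prop :=
  forall (k : nat) (j : 'I_m.+1) (t : R), `|t| < eps ->
    derivable (derive1n k (fun r => gam r 0 j)) t 1.

Definition conjm (R : realType) (a b : nat) (A : 'M[R[i]]_(a, b)) :
  'M[R[i]]_(a, b) := map_mx (@conjc R) A.

Definition conjvf (R : realType) (m : nat) (X : vfield R m) : vfield R m :=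
  fun x => conjm (X x).

(* v(f)(x) for a complex tangent vector v and a complex valued f *)
Definition cder (R : realType) (m : nat) (v : cvec R m)
    (f : rvec R m -> R[i]) (x : rvec R m) : R[i] :=
  \sum_j v 0 j * Complex (partial j (fun y => complex.Re (f y)) x)
                         (partial j (fun y => complex.Im (f y)) x).

Definition cder_mx (R : realType) (m a b : nat) (v : cvec R m)
    (F : rvec R m -> 'M[R[i]]_(a, b)) (x : rvec R m) : 'M[R[i]]_(a, b) :=
  \matrix_(i, j) cder v (fun y => F y i j) x.

Definition lie (R : realType) (m : nat) (X Y : vfield R m) : vfield R m :=
  fun x => cder_mx (X x) Y x - cder_mx (Y x) X x.

(* complexified differential of a map between coordinate spaces *)
Definition cdiff (R : realType) (m m' : nat) (f : rvec R m -> rvec R m')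
    (x : rvec R m) (v : cvec R m) : cvec R m' :=
  \row_k \sum_j v 0 j * (partial j (fun y => f y 0 k) x)%:C%C.

(** ** Families of complex subspaces *)

Definition conjset (R : realType) (m : nat) (A : set (cvec R m)) :
  set (cvec R m) := [set v | A (conjm v)].

Definition sumset (R : realType) (m : nat) (A B : set (cvec R m)) :
  set (cvec R m) := [set v | exists a b, [/\ A a, B b & v = a + b]].

Definition has_rank (R : realType) (m : nat) (A : set (cvec R m)) (r : nat) :
    Prop :=
  exists B : 'M[R[i]]_(r, m.+1), row_free B /\ forall v, A v <-> (v <= B)%MS.

Definition section_on (R : realType) (m : nat)
    (D : rvec R m -> set (cvec R m)) (V : set (rvec R m)) (X : vfield R m) :
  Prop := smooth_vf V X /\ forall x, V x -> D x (X x).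

Definition subnbhd (R : realType) (m : nat) (U : set (rvec R m))
  (x : rvec R m) (V : set (rvec R m)) : Prop :=
  [/\ open V, V `<=` U & V x].

(** ** Manifolds and CR structures of hypersurface type *)

Record atlas (R : realType) (m : nat) (M : topologicalType) := Atlas {
  idx : Type;
  dom : idx -> set M;
  crd : idx -> M -> rvec R m;
  crdV : idx -> rvec R m -> M;
  _ : hausdorff_space M;
  _ : @second_countable M;
  _ : forall x, exists i, dom i x;
  _ : forall i, open (dom i);
  _ : forall i, open (crd i @` dom i);
  _ : forall i x, dom i x -> crdV i (crd i x) = x;
  _ : forall i x, dom i x -> {for x, continuous (crd i)};
  _ : forall i y, (crd i @` dom i) y -> {for y, continuous (crdV i)};
  _ : forall i j, smooth_map (crd i @` (dom i `&` dom j)) (crd j \o crdV i)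
}.

Definition img (R : realType) (m : nat) (M : topologicalType)
  (A : atlas R m M) (i : idx A) : set (rvec R m) := crd i @` dom i.

(* A bundle of subspaces of CTM is given by its expression in every chart; these
   are the conditions on the expression in one chart with image U. *)
Record local_CR (R : realType) (m n : nat) (U : set (rvec R m))
    (H : rvec R m -> set (cvec R m)) : Prop := LocalCR {
  cr_rank : forall x, U x -> has_rank (H x) n;
  cr_smooth : forall x, U x -> exists V, subnbhd U x V /\
    exists B : 'I_n -> vfield R m, (forall a, section_on H V (B a)) /\
      forall y, V y -> row_free (\matrix_a B a y);
  cr_involutive : forall V X Y, open V -> V `<=` U ->
    section_on H V X -> section_on H V Y -> section_on H V (lie X Y);
  cr_tot_real : forall x, U x -> H x `&` conjset (H x) = [set 0]
}.

Record CR_hypersurface (R : realType) (n : nat) (M : topologicalType)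
    (A : atlas R n.*2 M)
    (H : idx A -> rvec R n.*2 -> set (cvec R n.*2)) : Prop := CRHypersurface {
  cr_local : forall i, local_CR n (@img _ _ _ A i) (H i);
  cr_glue : forall i j x, dom i x -> dom j x -> forall v,
    H i (crd i x) v <->
    H j (crd j x) (cdiff (crd j \o crdV i) (crd i x) v)
}.

(* H (+) conj H *)
Definition Hc (R : realType) (m : nat) (H : rvec R m -> set (cvec R m))
  (x : rvec R m) : set (cvec R m) := sumset (H x) (conjset (H x)).

(* [ ... [V, conj X1], ..., conj Xj] *)
Definition iter_lie (R : realType) (m : nat) (V : vfield R m)
    (Xs : seq (vfield R m)) : vfield R m :=
  foldl (fun Z X => lie Z (conjvf X)) V Xs.

(* The bundles K_j, j >= 1, in a chart (K_0 is a dummy, equal to H). *)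
Fixpoint Kb (R : realType) (m : nat) (U : set (rvec R m))
    (H : rvec R m -> set (cvec R m)) (j : nat) : rvec R m -> set (cvec R m) :=
  match j with
  | 0 => H
  | j'.+1 => if j' == 0%N then H else fun x => [set v | Kb U H j' x v /\
      forall (O : set (rvec R m)) (V : vfield R m) (Xs : 'I_j' -> vfield R m),
        subnbhd U x O -> section_on (Kb U H j') O V -> V x = v ->
        (forall a, section_on H O (Xs a)) ->
        Hc H x ((2 * 'i%C)^-1 *: iter_lie V [seq Xs a | a <- enum 'I_j'] x)]
  end.

(* K_2 (+) conj K_2 *)
Definition Kc (R : realType) (m : nat) (U : set (rvec R m))
    (H : rvec R m -> set (cvec R m)) (x : rvec R m) : set (cvec R m) :=
  sumset (Kb U H 2 x) (conjset (Kb U H 2 x)).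

Definition uniformly_nondegenerate (R : realType) (n k : nat)
    (M : topologicalType) (A : atlas R n.*2 M)
    (H : idx A -> rvec R n.*2 -> set (cvec R n.*2)) : Prop :=
  (0 < k)%N /\ exists r : nat -> nat,
    [/\ forall i j x, (0 < j)%N -> img i x ->
          has_rank (Kb (@img _ _ _ A i) (H i) j x) (r j),
        r k <> 0%N & r k.+1 = 0%N].

(* rank (H / K_2) = s *)
Definition Levi_rank (R : realType) (n s : nat)
    (M : topologicalType) (A : atlas R n.*2 M)
    (H : idx A -> rvec R n.*2 -> set (cvec R n.*2)) : Prop :=
  (s <= n)%N /\ forall i x, img i x ->
    has_rank (Kb (@img _ _ _ A i) (H i) 2 x) (n - s).

(** ** The graded algebra  C g_- (+) csp(C g_{-1})  *)

Notation gmat R s := 'M[R[i]]_(1 + (s + (s + 1))).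

Definition gm (R : realType) (s : nat) (c : R[i]) (v1 v2 : 'cV[R[i]]_s)
    (u : R[i]) (L S T : 'M[R[i]]_s) : gmat R s :=
  block_mx c%:M 0
    (col_mx v1 (col_mx v2 (u * 'i%C)%:M))
    (block_mx L (row_mx S 0)
              (col_mx T v2^T) (block_mx (- L^T) 0 (- v1^T) (- c)%:M)).

Definition br (R : realType) (s : nat) (X Y : gmat R s) : gmat R s :=
  X *m Y - Y *m X.

Definition hel (R : realType) (s : nat) (u : R[i]) (v1 v2 : 'cV[R[i]]_s) :
  gmat R s := gm 0 v1 v2 u 0 0 0.

Definition cel (R : realType) (s : nat) (c : R[i]) (L S T : 'M[R[i]]_s) :
  gmat R s := gm c 0 0 0 L S T.

Definition gminus (R : realType) (s : nat) : set (gmat R s) :=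
  [set X | exists u v1 v2, X = hel u v1 v2].

Definition csp (R : realType) (s : nat) : set (gmat R s) :=
  [set X | exists c L S T, [/\ S^T = S, T^T = T & X = cel c L S T]].

Definition csp00 (R : realType) (s : nat) : set (gmat R s) :=
  [set X | exists c L, X = cel c L 0 0].

(* the block L of an element *)
Definition Lpart (R : realType) (s : nat) (X : gmat R s) : 'M[R[i]]_s :=
  ulsubmx (drsubmx X).

Definition mcoset (R : realType) (s : nat) (X : gmat R s)
  (A : set (gmat R s)) : set (gmat R s) := [set Y | A (Y - X)].

(** ** Symbols and frames (in a chart; U is the image of the chart) *)

(* A linear map out of C g_-(q), given on representatives:  iu  on CT_qM,
   i1  on  H_q  and  i2  on  conj H_q; it has values in the u, v_1 and v_2
   coordinates (only the restrictions of i1 to H_q and of i2 to conj H_q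
   are meaningful). *)
Record symmap (R : realType) (m s : nat) := Symmap {
  iu : 'cV[R[i]]_m.+1;
  i1 : 'M[R[i]]_(m.+1, s);
  i2 : 'M[R[i]]_(m.+1, s)
}.

Definition val_u (R : realType) (m s : nat) (tau : symmap R m s)
  (w : cvec R m) : R[i] := (w *m iu tau) 0 0.
Definition val_1 (R : realType) (m s : nat) (tau : symmap R m s)
  (w : cvec R m) : 'cV[R[i]]_s := (w *m i1 tau)^T.
Definition val_2 (R : realType) (m s : nat) (tau : symmap R m s)
  (w : cvec R m) : 'cV[R[i]]_s := (w *m i2 tau)^T.

(* The set F_q of bigraded Lie algebra isomorphisms C g_-(q) -> C g_-.
   Surjectivity follows from the kernel conditions by counting dimensions, and
   the only nonzero brackets are those of degree (-1,1) with (-1,-1). *)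
Record Fq (R : realType) (m s : nat) (U : set (rvec R m))
    (H : rvec R m -> set (cvec R m)) (q : rvec R m) (tau : symmap R m s) :
    Prop := FqBuild {
  Fq_u : forall v, val_u tau v = 0 <-> Hc H q v;
  Fq_1 : forall v, H q v -> (val_1 tau v = 0 <-> Kb U H 2 q v);
  Fq_2 : forall v, conjset (H q) v ->
    (val_2 tau v = 0 <-> conjset (Kb U H 2 q) v);
  Fq_br : forall O (X Y : vfield R m), subnbhd U q O ->
    section_on H O X -> section_on (fun x => conjset (H x)) O Y ->
    br (hel 0 (val_1 tau (X q)) 0) (hel 0 0 (val_2 tau (Y q))) =
    hel (val_u tau (lie X Y q)) 0 0
}.

Record frame (R : realType) (m s r : nat) := Frame {
  fg : vfield R m;
  ff : 'I_s -> vfield R m;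
  fe : 'I_r -> vfield R m
}.

Record adapted (R : realType) (m s r : nat) (U : set (rvec R m))
    (H : rvec R m -> set (cvec R m)) (O : set (rvec R m))
    (phi : frame R m s r) : Prop := Adapted {
  ad_g : smooth_vf O (fg phi);
  ad_f : forall k, section_on H O (ff phi k);
  ad_e : forall a, section_on (Kb U H 2) O (fe phi a);
  ad_gbasis : forall x, O x -> ~ Hc H x (fg phi x);
  ad_ebasis : forall x, O x ->
    has_rank (Kb U H 2 x) r /\ row_free (\matrix_a fe phi a x);
  ad_fbasis : forall x, O x -> has_rank (H x) (s + r) /\
    row_free (col_mx (\matrix_k ff phi k x) (\matrix_a fe phi a x))
}.

(* tau is (a representative of) the isomorphism defined by phi at q *)
Definition frame_iso (R : realType) (m s r : nat) (U : set (rvec R m))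
    (H : rvec R m -> set (cvec R m)) (phi : frame R m s r) (q : rvec R m)
    (tau : symmap R m s) : Prop :=
  [/\ Fq U H q tau, val_u tau (fg phi q) = 1 &
      forall k, val_1 tau (ff phi k q) = delta_mx k 0].

(* both frames define the same element of F_q *)
Definition same_iso (R : realType) (m s r : nat) (U : set (rvec R m))
    (H : rvec R m -> set (cvec R m)) (q : rvec R m)
    (phi phi' : frame R m s r) : Prop :=
  exists tau, frame_iso U H phi q tau /\ frame_iso U H phi' q tau.

Definition cis (R : realType) (h : R) : R[i] := Complex (cos h) (sin h).

(* (H, h) : the matrix of conj f_j -> v_2 is e^{ih} H with H Hermitian *)
Definition is_hermitian_pair (R : realType) (m s r : nat) (U : set (rvec R m))
    (H : rvec R m -> set (cvec R m)) (phi : frame R m s r) (q : rvec R m)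
    (Hh : 'M[R[i]]_s * R) : Prop :=
  (conjm Hh.1)^T = Hh.1 /\
  exists tau, frame_iso U H phi q tau /\
    forall j, val_2 tau (conjm (ff phi j q)) = cis Hh.2 *: col j Hh.1.

Definition herm_pair (R : realType) (m s r : nat) (U : set (rvec R m))
    (H : rvec R m -> set (cvec R m)) (phi : frame R m s r) (q : rvec R m) :
    'M[R[i]]_s * R :=
  xget (0, 0) [set Hh | is_hermitian_pair U H phi q Hh].

(* iota(v)(w) = u  in  H_q / (K_2)_q, for v in K_2 and w in conj H *)
Definition iota_rel (R : realType) (m : nat) (U : set (rvec R m))
    (H : rvec R m -> set (cvec R m)) (q : rvec R m) (v w u : cvec R m) :
    Prop :=
  H q u /\ forall O (V W : vfield R m), subnbhd U q O ->
    section_on (Kb U H 2) O V -> section_on (fun x => conjset (H x)) O W ->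
    V q = v -> W q = w ->
    sumset (Kb U H 2 q) (conjset (H q)) (lie V W q - u).

Definition is_Xi (R : realType) (m s r : nat) (U : set (rvec R m))
    (H : rvec R m -> set (cvec R m)) (phi : frame R m s r) (q : rvec R m)
    (a : 'I_r) (X : 'M[R[i]]_s) : Prop :=
  forall k, iota_rel U H q (fe phi a q) (conjm (ff phi k q))
                     (\sum_l X l k *: ff phi l q).

Definition Xi (R : realType) (m s r : nat) (U : set (rvec R m))
    (H : rvec R m -> set (cvec R m)) (phi : frame R m s r) (a : 'I_r)
    (q : rvec R m) : 'M[R[i]]_s :=
  xget 0 [set X | is_Xi U H phi q a X].

(* S^{0,2}_a and S^{0,-2}_a, as elements of csp *)
Definition Spos (R : realType) (m s r : nat) (U : set (rvec R m))
    (H : rvec R m -> set (cvec R m)) (phi : frame R m s r) (a : 'I_r)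
    (q : rvec R m) : gmat R s :=
  let Hh := herm_pair U H phi q in
  cel 0 0 (cis (- Hh.2) *: (Xi U H phi a q *m invmx Hh.1)) 0.

Definition Sneg (R : realType) (m s r : nat) (U : set (rvec R m))
    (H : rvec R m -> set (cvec R m)) (phi : frame R m s r) (a : 'I_r)
    (q : rvec R m) : gmat R s :=
  let Hh := herm_pair U H phi q in
  cel 0 0 0 (cis Hh.2 *: (Hh.1 *m conjm (Xi U H phi a q))).

Definition lincomb (R : realType) (s r : nat) (c : 'I_r -> R[i])
  (S : 'I_r -> gmat R s) : gmat R s := \sum_a c a *: S a.

Definition gspan (R : realType) (s r : nat) (S : 'I_r -> gmat R s) :
  set (gmat R s) := [set X | exists c, X = lincomb c S].

(* the images of g_{0,2}(q) = iota(K_2) and g_{0,-2}(q) = iota(conj K_2) *)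
Definition gpos (R : realType) (m s r : nat) (U : set (rvec R m))
    (H : rvec R m -> set (cvec R m)) (phi : frame R m s r) (q : rvec R m) :
  set (gmat R s) := gspan (fun a => Spos U H phi a q).
Definition gneg (R : realType) (m s r : nat) (U : set (rvec R m))
    (H : rvec R m -> set (cvec R m)) (phi : frame R m s r) (q : rvec R m) :
  set (gmat R s) := gspan (fun a => Sneg U H phi a q).

Definition g00 (R : realType) (m s r : nat) (U : set (rvec R m))
    (H : rvec R m -> set (cvec R m)) (phi : frame R m s r) (q : rvec R m) :
  set (gmat R s) :=
  [set X | [/\ csp00 X,
     forall Y, gpos U H phi q Y -> gpos U H phi q (br X Y) &
     forall Y, gneg U H phi q Y -> gneg U H phi q (br X Y)]].

(** ** Modified symbols *)

(* A local quotient of M by the foliation of TM cap (K_2 + conj K_2): a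
   submersion of a neighbourhood W of p onto its image, whose fibres are
   the leaves in W. *)
Record local_quotient (R : realType) (m m' : nat) (U : set (rvec R m))
    (H : rvec R m -> set (cvec R m)) (p : rvec R m) (W : set (rvec R m))
    (prj : rvec R m -> rvec R m') : Prop := LocalQuotient {
  lq_nbhd : subnbhd U p W;
  lq_smooth : smooth_map W prj;
  lq_surj : forall x, W x -> forall w, exists v, cdiff prj x v = w;
  lq_ker : forall x, W x -> forall v, cdiff prj x v = 0 <-> Kc U H x v;
  lq_conn : forall y, connected (W `&` prj @^-1` [set y])
}.

Definition leaf (R : realType) (m m' : nat) (W : set (rvec R m))
    (prj : rvec R m -> rvec R m') (p : rvec R m) : set (rvec R m) :=
  W `&` prj @^-1` [set prj p].

(* X is the image under the element tau of F_q of the class of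
   w2 in C g_{-2}(q), w1 in g_{-1,1}(q), w1' in g_{-1,-1}(q). *)
Definition sym_rel (R : realType) (m s r : nat) (U : set (rvec R m))
    (H : rvec R m -> set (cvec R m)) (phi : frame R m s r) (q : rvec R m)
    (w2 w1 w1' : cvec R m) (X : gmat R s) : Prop :=
  [/\ H q w1, conjset (H q) w1' & exists tau, frame_iso U H phi q tau /\
      X = hel (val_u tau w2) (val_1 tau w1) (val_2 tau w1')].

(* Y = I(phi(p)) o I(phi(q))^{-1} X, for q in the leaf through p: the class of
   w at q and that of z at p have the same image under prj_*, which is taken
   modulo prj_*(H (+) conj H) in first degree -2. *)
Definition transport (R : realType) (m m' s r : nat) (U : set (rvec R m))
    (H : rvec R m -> set (cvec R m)) (prj : rvec R m -> rvec R m')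
    (phi : frame R m s r) (p q : rvec R m) (X Y : gmat R s) : Prop :=
  exists w2 w1 w1' z2 z1 z1',
    [/\ sym_rel U H phi q w2 w1 w1' X, sym_rel U H phi p z2 z1 z1' Y,
        exists2 d, Hc H p d & cdiff prj q w2 = cdiff prj p (z2 + d) &
        cdiff prj q (w1 + w1') = cdiff prj p (z1 + z1')].

Definition is_mderive (R : realType) (a b : nat) (F : R -> 'M[R[i]]_(a, b))
    (D : 'M[R[i]]_(a, b)) : Prop :=
  forall i j,
    is_derive (0 : R) 1 (fun t => complex.Re (F t i j)) (complex.Re (D i j)) /\
    is_derive (0 : R) 1 (fun t => complex.Im (F t i j)) (complex.Im (D i j)).

(* D in csp is the derivative at 0 of I(phi(p)) o I(phi(gam t))^{-1}, for every
   curve gam in the leaf of p with velocity v at p. *)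
Definition iota_real (R : realType) (m m' s r : nat) (U : set (rvec R m))
    (H : rvec R m -> set (cvec R m)) (W : set (rvec R m))
    (prj : rvec R m -> rvec R m') (phi : frame R m s r) (p v : rvec R m)
    (D : gmat R s) : Prop :=
  csp D /\ forall (eps : R) (gam : R -> rvec R m), 0 < eps ->
    smooth_curve eps gam -> gam 0 = p ->
    (forall t, `|t| < eps -> leaf W prj p (gam t)) ->
    (forall j, derive1 (fun t => gam t 0 j) 0 = v 0 j) ->
    forall X, gminus X -> exists Y : R -> gmat R s,
      (\forall t \near (0 : R), transport U H prj phi p (gam t) X (Y t)) /\
      is_mderive Y (br D X).

Definition re_vec (R : realType) (m : nat) (v : cvec R m) : rvec R m :=
  map_mx (@complex.Re R) v.
Definition im_vec (R : realType) (m : nat) (v : cvec R m) : rvec R m :=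
  map_mx (@complex.Im R) v.

(* The complex linear extension of iota_real, evaluated at v in K_2.  (The
   bundle K_2 (+) conj K_2 being invariant under conjugation, the real and
   imaginary parts of v are tangent to the leaf.) *)
Definition iota_sec (R : realType) (m m' s r : nat) (U : set (rvec R m))
    (H : rvec R m -> set (cvec R m)) (W : set (rvec R m))
    (prj : rvec R m -> rvec R m') (phi : frame R m s r) (p : rvec R m)
    (v : cvec R m) (D : gmat R s) : Prop :=
  exists D1 D2, [/\ iota_real U H W prj phi p (re_vec v) D1,
    iota_real U H W prj phi p (im_vec v) D2 & D = D1 + 'i%C *: D2].

(* Y is the image of X under the involution of C g_- that corresponds,
   via phi at p, to complex conjugation of C g_-(p). *)
Definition conj_rel (R : realType) (m s r : nat) (U : set (rvec R m))
    (H : rvec R m -> set (cvec R m)) (phi : frame R m s r) (p : rvec R m)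
    (X Y : gmat R s) : Prop :=
  exists w2 w1 w1', sym_rel U H phi p w2 w1 w1' X /\
    sym_rel U H phi p (conjm w2) (conjm w1') (conjm w1) Y.

(* the induced involution of csp *)
Definition conj_der (R : realType) (m s r : nat) (U : set (rvec R m))
    (H : rvec R m -> set (cvec R m)) (phi : frame R m s r) (p : rvec R m)
    (D D' : gmat R s) : Prop :=
  csp D' /\ forall X Y, conj_rel U H phi p X Y ->
    conj_rel U H phi p (br D X) (br D' Y).

(* The modified symbol at p along phi.  The image of conj K_2 is obtained from
   that of K_2 by the involution; for sections along which the involution is
   not constant this is not the value of the complex linear extension on
   conj K_2. *)
Definition mod_symbol (R : realType) (m m' s r : nat) (U : set (rvec R m))
    (H : rvec R m -> set (cvec R m)) (W : set (rvec R m))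
    (prj : rvec R m -> rvec R m') (phi : frame R m s r) (p : rvec R m) :
    set (gmat R s) :=
  [set X | exists X0 v v' D D' E' Z, [/\ gminus X0,
      Kb U H 2 p v /\ iota_sec U H W prj phi p v D,
      Kb U H 2 p v' /\ iota_sec U H W prj phi p v' D',
      conj_der U H phi p D' E' & g00 U H phi p Z /\ X = X0 + (D + E' + Z)]].

(* The modified symbol at p along phi is given by the matrices
   (G, Xi_a, Omega_a), G = e^{ih} H, with respect to the basis e of K_2(p).
   The images of the conj e_a are determined by this (see mod_symbol), and
   Omega_a is only meaningful modulo g00. *)
Definition given_by (R : realType) (m m' s r : nat) (U : set (rvec R m))
    (H : rvec R m -> set (cvec R m)) (W : set (rvec R m))
    (prj : rvec R m -> rvec R m') (phi : frame R m s r) (p : rvec R m)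
    (e : 'I_r -> cvec R m) (Hm : 'M[R[i]]_s) (h : R)
    (X Om : 'I_r -> 'M[R[i]]_s) : Prop :=
  forall a, exists2 D, iota_sec U H W prj phi p (e a) D &
    g00 U H phi p (D - cel 0 (Om a) (cis (- h) *: (X a *m invmx Hm)) 0).

(** ** Normalization conditions *)

(* A map  K_2(p) (x) g_{0,+-2} -> csp_{0,+-2} / g_{0,+-2}; its values are cosets,
   empty outside of the domain. *)
Notation Omap R m s := (cvec R m -> gmat R s -> set (gmat R s)).

(* The bilinear map (X, S_a) |-> X(S_a) mod g, where g is the span of the
   S_a at p. *)
Definition Oof (R : realType) (m s r : nat) (K : set (cvec R m))
    (S : 'I_r -> rvec R m -> gmat R s) (p : rvec R m) : Omap R m s :=
  fun X T => [set Y | K X /\ exists c : 'I_r -> R[i],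
    T = lincomb c (fun a => S a p) /\
    gspan (fun a => S a p) (Y - lincomb c (fun a => cder_mx X (S a) p))].

Definition Opos (R : realType) (m s r : nat) (U : set (rvec R m))
    (H : rvec R m -> set (cvec R m)) (phi : frame R m s r) (p : rvec R m) :
  Omap R m s := Oof (Kb U H 2 p) (Spos U H phi) p.
Definition Oneg (R : realType) (m s r : nat) (U : set (rvec R m))
    (H : rvec R m -> set (cvec R m)) (phi : frame R m s r) (p : rvec R m) :
  Omap R m s := Oof (Kb U H 2 p) (Sneg U H phi) p.

Definition Ozero (R : realType) (m s : nat) (K : set (cvec R m))
    (g : set (gmat R s)) : Omap R m s :=
  fun X T => [set Y | [/\ K X, g T & g Y]].

(* phi' is a local section of F with the same value as phi at p.  A section
   along the leaf through p is represented by an extension of it to a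
   neighbourhood of p in M; the maps Opos and Oneg (where X is tangent to the
   leaf) and iota_sec only depend on its restriction to the leaf. *)
Definition extension (R : realType) (m s r : nat) (U : set (rvec R m))
    (H : rvec R m -> set (cvec R m)) (phi : frame R m s r) (p : rvec R m)
    (phi' : frame R m s r) : Prop :=
  (exists2 O, subnbhd U p O & adapted U H O phi') /\ same_iso U H p phi phi'.

Definition Oclass (R : realType) (m s r : nat) (U : set (rvec R m))
    (H : rvec R m -> set (cvec R m)) (phi : frame R m s r) (p : rvec R m) :
    set (Omap R m s * Omap R m s) :=
  [set O | exists2 phi', extension U H phi p phi' &
     O = (Oneg U H phi' p, Opos U H phi' p)].

(* A choice depending only on g_{0,-2}, g_{0,2} and the class; pairs are
   ordered as (O_{0,-2}, O_{0,2}). *)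
Notation normalization R m s :=
  (set (gmat R s) -> set (gmat R s) -> set (Omap R m s * Omap R m s) ->
   Omap R m s * Omap R m s).

Definition ON (R : realType) (m s r : nat) (N : normalization R m s)
    (U : set (rvec R m)) (H : rvec R m -> set (cvec R m))
    (phi : frame R m s r) (p : rvec R m) : Omap R m s * Omap R m s :=
  N (gneg U H phi p) (gpos U H phi p) (Oclass U H phi p).

Definition normalization_condition (R : realType) (m s r : nat)
    (N : normalization R m s) (U : set (rvec R m))
    (H : rvec R m -> set (cvec R m)) : Prop :=
  forall q O (phi : frame R m s r), subnbhd U q O -> adapted U H O phi ->
    Oclass U H phi q (ON N U H phi q) /\
    let zero := (Ozero (Kb U H 2 q) (gneg U H phi q),
                 Ozero (Kb U H 2 q) (gpos U H phi q)) in
    (Oclass U H phi q zero -> ON N U H phi q = zero).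

Definition normalized (R : realType) (m s r : nat)
    (N : normalization R m s) (U : set (rvec R m))
    (H : rvec R m -> set (cvec R m)) (phi : frame R m s r) (p : rvec R m) :
    Prop :=
  (Oneg U H phi p, Opos U H phi p) = ON N U H phi p.

(* Main.v *)
Require Import Defs.
From mathcomp Require Import all_boot all_order all_algebra.
From mathcomp Require Import all_classical all_reals all_analysis.
From mathcomp Require Import complex ring lra.
Set Implicit Arguments. Unset Strict Implicit. Unset Printing Implicit Defensive.
Import Order.TTheory GRing.Theory Num.Theory.
Import numFieldNormedType.Exports.
Local Open Scope classical_set_scope.
Local Open Scope ring_scope.

(** Fix the value at [p] of a section of the bundle of symbol isomorphisms. The theorem
   follows from a computation of how the bilinear maps O and the maps iota depend on the
   first derivative of the section at [p]: both change by the same element C(v) of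
   csp_{0,0}, in the direction v.

   Let [phi'] be an adapted frame that defines the same isomorphism as [phi] at [p]. On
   H/K_2, on CTM/(H + conj H) and on K_2 the two frames differ by matrices [chA], [chr]
   and [chE], where [chA] and [chr] are the identity at [p]. The Levi form and iota are
   tensors ([levi_tensor], [iota_tensor]), hence the matrices S^{0,2} and S^{0,-2} of the
   two frames are related by a congruence with [chA], the factor [chr] and a change of
   basis by [chE] ([spos_change], [sneg_change]). Differentiating at [p] in the direction
   v gives

     O(phi')(v, S_b) = v(S_b) - [C(v), S_b]   modulo the span of the S_b

   with C(v) = [cgen phi phi' p v] ([Opos_change], [Oneg_change]). This presupposes that
   O is well defined: if a combination of the S_b vanishes at [p], its derivative must be
   in the span. Such a combination is an element of the kernel of iota on K_2, which is
   K_3 ([K3_iota]) and has constant rank; the derivative of a family of matrices of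
   constant rank maps the left kernel into the row space ([constant_rank_derivative]).

   Transport of symbols along a leaf is affected by [chA] and [chr] alone, so that
   iota_{phi'}(v) = iota_{phi}(v) + C(v) ([iota_real_change], [iota_sec_change]).

   Now let [phi'] be a section with the pair of maps that is chosen by the normalization
   condition. Then B_a = C(e_a) solves the equations. Two solutions differ by elements
   whose brackets preserve g_{0,2} and g_{0,-2}, that is, by elements of g_{0,0}
   ([solution_unique]); in particular the C(e_a) of every normalized section agree with
   the B_a modulo g_{0,0}, and adding them to iota_{phi} gives the matrices
   Omega_a + B_a. For two normalized sections C takes values in g_{0,0}. The images of
   conj K_2 then change by the images of C(v) under the involution, which preserves
   g_{0,0} ([g00_conj_der]), so that the modified symbol is the same
   ([mod_symbol_sub]). *)

(** * Differential calculus of complex valued functions *)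

Section ComplexCalculus.
Variables (R : realType) (m : nat).
Implicit Types (f g : rvec R m -> R[i]) (x : rvec R m) (v w : cvec R m).

Definition Cdiff f x := differentiable (fun y => complex.Re (f y)) x /\
                      differentiable (fun y => complex.Im (f y)) x.

Definition pd (j : 'I_m.+1) f x : R[i] :=
  Complex (partial j (fun y => complex.Re (f y)) x)
          (partial j (fun y => complex.Im (f y)) x).

Lemma cderE v f x : cder v f x = \sum_j v 0 j * pd j f x.
Proof. by []. Qed.

Lemma Re_pd j f x : complex.Re (pd j f x) = partial j (fun y => complex.Re (f y)) x.
Proof. by []. Qed.

Lemma Im_pd j f x : complex.Im (pd j f x) = partial j (fun y => complex.Im (f y)) x.
Proof. by []. Qed.

Lemma partialD (a b : rvec R m -> R) j x :
  differentiable a x -> differentiable b x ->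
  partial j (fun y => a y + b y) x = partial j a x + partial j b x.
Proof. by move=> da db; rewrite /partial deriveD //; exact: diff_derivable. Qed.

Lemma partialN (a : rvec R m -> R) j x :
  differentiable a x -> partial j (fun y => - a y) x = - partial j a x.
Proof. by move=> da; rewrite /partial deriveN //; exact: diff_derivable. Qed.

Lemma partialM (a b : rvec R m -> R) j x :
  differentiable a x -> differentiable b x ->
  partial j (fun y => a y * b y) x = a x * partial j b x + b x * partial j a x.
Proof. by move=> da db; rewrite /partial deriveM //; exact: diff_derivable. Qed.

Lemma partial_ext (a b : rvec R m -> R) j x :
  (forall y, a y = b y) -> partial j a x = partial j b x.
Proof. by move=> /funext ->. Qed.

Lemma partial_cst (a : R) j x : partial j (fun=> a) x = 0.
Proof. by rewrite /partial derive_cst. Qed.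

Lemma cReD (a b : R[i]) : complex.Re (a + b) = complex.Re a + complex.Re b.
Proof. by case: a b => [? ?] []. Qed.
Lemma cImD (a b : R[i]) : complex.Im (a + b) = complex.Im a + complex.Im b.
Proof. by case: a b => [? ?] []. Qed.
Lemma cReM (a b : R[i]) : complex.Re (a * b) =
  complex.Re a * complex.Re b - complex.Im a * complex.Im b.
Proof. by case: a b => [? ?] []. Qed.
Lemma cImM (a b : R[i]) : complex.Im (a * b) =
  complex.Re a * complex.Im b + complex.Im a * complex.Re b.
Proof. by case: a b => [? ?] []. Qed.
Lemma cRe_conj (a : R[i]) : complex.Re (conjc a) = complex.Re a.
Proof. by case: a. Qed.
Lemma cIm_conj (a : R[i]) : complex.Im (conjc a) = - complex.Im a.
Proof. by case: a. Qed.

Lemma complex_eq (a b : R[i]) :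
  complex.Re a = complex.Re b -> complex.Im a = complex.Im b -> a = b.
Proof. by case: a b => [? ?] [? ?] /= -> ->. Qed.

Lemma Cdiff_cst (a : R[i]) x : Cdiff (fun=> a) x.
Proof. by split; exact: differentiable_cst. Qed.

Lemma CdiffD f g x : Cdiff f x -> Cdiff g x -> Cdiff (fun y => f y + g y) x.
Proof.
move=> [f1 f2] [g1 g2]; split.
  rewrite (_ : (fun _ => _) = (fun y => complex.Re (f y)) \+ (fun y => complex.Re (g y))).
    exact: differentiableD.
  by apply/funext => y; rewrite cReD.
rewrite (_ : (fun _ => _) = (fun y => complex.Im (f y)) \+ (fun y => complex.Im (g y))).
  exact: differentiableD.
by apply/funext => y; rewrite cImD.
Qed.

Lemma CdiffM f g x : Cdiff f x -> Cdiff g x -> Cdiff (fun y => f y * g y) x.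
Proof.
move=> [f1 f2] [g1 g2]; split.
  rewrite (_ : (fun _ => _) = (fun y => complex.Re (f y) * complex.Re (g y))
                     - (fun y => complex.Im (f y) * complex.Im (g y))).
    by apply: differentiableB; exact: differentiableM.
  by apply/funext => y; rewrite cReM.
rewrite (_ : (fun _ => _) = (fun y => complex.Re (f y) * complex.Im (g y))
                     + (fun y => complex.Im (f y) * complex.Re (g y))).
  by apply: differentiableD; exact: differentiableM.
by apply/funext => y; rewrite cImM.
Qed.

Lemma Cdiff_conj f x : Cdiff f x -> Cdiff (fun y => conjc (f y)) x.
Proof.
move=> [f1 f2]; split.
  by rewrite (_ : (fun _ => _) = (fun y => complex.Re (f y))) //; apply/funext => y; rewrite cRe_conj.
rewrite (_ : (fun _ => _) = - (fun y => complex.Im (f y))); first exact: differentiableN.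
by apply/funext => y; rewrite cIm_conj.
Qed.

Lemma Cdiff_sum (I : Type) (r : seq I) (P : pred I) (F : I -> rvec R m -> R[i]) x :
  (forall i, Cdiff (F i) x) -> Cdiff (fun y => \sum_(i <- r | P i) F i y) x.
Proof.
move=> dF; elim: r => [|i r IH].
  by under eq_fun do rewrite big_nil; exact: Cdiff_cst.
under eq_fun do rewrite big_cons; case: (P i) => //.
exact: CdiffD.
Qed.

Lemma Cdiff_prod (I : Type) (r : seq I) (P : pred I) (F : I -> rvec R m -> R[i]) x :
  (forall i, Cdiff (F i) x) -> Cdiff (fun y => \prod_(i <- r | P i) F i y) x.
Proof.
move=> dF; elim: r => [|i r IH].
  by under eq_fun do rewrite big_nil; exact: Cdiff_cst.
under eq_fun do rewrite big_cons; case: (P i) => //.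
exact: CdiffM.
Qed.

Lemma CdiffN f x : Cdiff f x -> Cdiff (fun y => - f y) x.
Proof.
move=> df; under eq_fun do rewrite -mulN1r.
exact: CdiffM (Cdiff_cst _ _) df.
Qed.

Lemma CdiffV f x : f x != 0 -> Cdiff f x -> Cdiff (fun y => (f y)^-1) x.
Proof.
move=> f0 [f1 f2].
pose N y := complex.Re (f y) * complex.Re (f y) + complex.Im (f y) * complex.Im (f y).
have N0 : N x != 0.
  move: f0; rewrite /N; case: (f x) => a b /=; apply: contraNneq => /eqP.
  rewrite -!expr2 paddr_eq0 ?sqr_ge0 // !sqrf_eq0 => /andP[/eqP -> /eqP ->].
  by [].
have dN : differentiable N x.
  by apply: differentiableD; exact: differentiableM.
have dNV : differentiable (fun y => (N y)^-1) x by exact: differentiableV.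
split.
  rewrite (_ : (fun _ => _) = (fun y => complex.Re (f y) * (N y)^-1)).
    exact: differentiableM.
  by apply/funext => y; rewrite /N; case: (f y) => a b /=; rewrite !expr2.
rewrite (_ : (fun _ => _) = (fun y => - (complex.Im (f y) * (N y)^-1))).
  exact/differentiableN/differentiableM.
by apply/funext => y; rewrite /N; case: (f y) => a b /=; rewrite !expr2.
Qed.

Lemma pdD j f g x : Cdiff f x -> Cdiff g x ->
  pd j (fun y => f y + g y) x = pd j f x + pd j g x.
Proof.
move=> [f1 f2] [g1 g2]; apply: complex_eq; rewrite /pd ?cReD ?cImD /=;
 by rewrite -partialD //; apply: partial_ext => y; rewrite ?cReD ?cImD.
Qed.

Lemma pdM j f g x : Cdiff f x -> Cdiff g x ->
  pd j (fun y => f y * g y) x = pd j f x * g x + f x * pd j g x.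
Proof.
move=> [f1 f2] [g1 g2]; apply: complex_eq; rewrite /pd ?(cReD, cReM, cImD, cImM) /=.
  transitivity (partial j (fun y => complex.Re (f y) * complex.Re (g y)
                 + - (complex.Im (f y) * complex.Im (g y))) x).
    by apply: partial_ext => y; rewrite cReM.
  rewrite partialD ?partialN ?partialM //; first by ring.
  - exact: differentiableM.
  - exact: differentiableM.
  - exact/differentiableN/differentiableM.
transitivity (partial j (fun y => complex.Re (f y) * complex.Im (g y)
                 + complex.Im (f y) * complex.Re (g y)) x).
  by apply: partial_ext => y; rewrite cImM.
rewrite partialD ?partialM //; first by ring.
- exact: differentiableM.
- exact: differentiableM.
Qed.

Lemma pd_cst j (a : R[i]) x : pd j (fun=> a) x = 0.
Proof. by rewrite /pd !partial_cst. Qed.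

Lemma pd_conj j f x : Cdiff f x -> pd j (fun y => conjc (f y)) x = conjc (pd j f x).
Proof.
move=> [f1 f2]; apply: complex_eq; rewrite /pd ?(cRe_conj, cIm_conj) /=.
  by apply: partial_ext => y; rewrite cRe_conj.
by rewrite -partialN //; apply: partial_ext => y; rewrite cIm_conj.
Qed.

Lemma pd_near j f g x : (\forall y \near x, f y = g y) -> pd j f x = pd j g x.
Proof.
move=> fg; rewrite /pd /partial; congr Complex; apply: near_eq_derive;
 by near=> y; rewrite (near fg y).
Unshelve. all: by end_near. Qed.

Lemma cder_ext v f g x : (forall y, f y = g y) -> cder v f x = cder v g x.
Proof. by move=> /funext ->. Qed.

Lemma cderD v f g x : Cdiff f x -> Cdiff g x ->
  cder v (fun y => f y + g y) x = cder v f x + cder v g x.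
Proof.
move=> df dg; rewrite !cderE -big_split /=; apply: eq_bigr => j _.
by rewrite pdD // mulrDr.
Qed.

Lemma cderM v f g x : Cdiff f x -> Cdiff g x ->
  cder v (fun y => f y * g y) x = cder v f x * g x + f x * cder v g x.
Proof.
move=> df dg; rewrite !cderE mulr_suml mulr_sumr -big_split /=.
by apply: eq_bigr => j _; rewrite pdM //; ring.
Qed.

Lemma cder_cst v (a : R[i]) x : cder v (fun=> a) x = 0.
Proof. by rewrite cderE big1 // => j _; rewrite pd_cst mulr0. Qed.

Lemma cderZ v (a : R[i]) f x : Cdiff f x ->
  cder v (fun y => a * f y) x = a * cder v f x.
Proof. by move=> df; rewrite cderM ?cder_cst ?mul0r ?add0r //; exact: Cdiff_cst. Qed.

Lemma cder_sum v (I : Type) (r : seq I) (P : pred I) (F : I -> rvec R m -> R[i]) x :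
  (forall i, Cdiff (F i) x) ->
  cder v (fun y => \sum_(i <- r | P i) F i y) x = \sum_(i <- r | P i) cder v (F i) x.
Proof.
move=> dF; elim: r => [|i r IH].
  by under eq_fun do rewrite big_nil; rewrite cder_cst big_nil.
under eq_fun do rewrite big_cons; rewrite big_cons; case: (P i) => //.
by rewrite cderD ?IH //; exact: Cdiff_sum.
Qed.

Lemma cder_near v f g x : (\forall y \near x, f y = g y) -> cder v f x = cder v g x.
Proof. by move=> fg; rewrite !cderE; apply: eq_bigr => j _; rewrite (pd_near j fg). Qed.

Lemma cder_conj v f x : Cdiff f x ->
  cder v (fun y => conjc (f y)) x = conjc (cder (conjm v) f x).
Proof.
move=> df; rewrite !cderE rmorph_sum /=; apply: eq_bigr => j _.
by rewrite pd_conj // rmorphM /= mxE conjcK.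
Qed.

Lemma cder_linear a v w f x : cder (a *: v + w) f x = a * cder v f x + cder w f x.
Proof.
rewrite !cderE mulr_sumr -big_split /=; apply: eq_bigr => j _.
by rewrite !mxE; ring.
Qed.

Lemma cderBl v w f x : cder (v - w) f x = cder v f x - cder w f x.
Proof. by rewrite addrC -scaleN1r cder_linear mulN1r addrC. Qed.

Lemma pd_real j (f : rvec R m -> R) x :
  pd j (fun y => Complex (f y) 0) x = Complex (partial j f x) 0.
Proof. by rewrite /pd /= partial_cst. Qed.

End ComplexCalculus.

Opaque pd cder.

Section MatrixCalculus.
Variables (R : realType) (m : nat).
Implicit Types (f g : rvec R m -> R[i]) (x : rvec R m) (v w : cvec R m).

Definition mdf (a b : nat) (F : rvec R m -> 'M[R[i]]_(a, b)) x :=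
  forall i j, Cdiff (fun y => F y i j) x.

Lemma mdf_cst (a b : nat) (A : 'M[R[i]]_(a, b)) x : mdf (fun=> A) x.
Proof. by move=> i j; exact: Cdiff_cst. Qed.

Lemma mdfD (a b : nat) (F G : rvec R m -> 'M[R[i]]_(a, b)) x :
  mdf F x -> mdf G x -> mdf (fun y => F y + G y) x.
Proof. by move=> dF dG i j; under eq_fun do rewrite mxE; exact: CdiffD. Qed.

Lemma mdfN (a b : nat) (F : rvec R m -> 'M[R[i]]_(a, b)) x :
  mdf F x -> mdf (fun y => - F y) x.
Proof. by move=> dF i j; under eq_fun do rewrite mxE; exact: CdiffN. Qed.

Lemma mdfZ (a b : nat) f (F : rvec R m -> 'M[R[i]]_(a, b)) x :
  Cdiff f x -> mdf F x -> mdf (fun y => f y *: F y) x.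
Proof. by move=> df dF i j; under eq_fun do rewrite mxE; exact: CdiffM. Qed.

Lemma mdf_mul (a b c : nat) (F : rvec R m -> 'M[R[i]]_(a, b))
    (G : rvec R m -> 'M[R[i]]_(b, c)) x :
  mdf F x -> mdf G x -> mdf (fun y => F y *m G y) x.
Proof.
move=> dF dG i j; under eq_fun do rewrite mxE.
by apply: Cdiff_sum => k; exact: CdiffM.
Qed.

Lemma mdf_tr (a b : nat) (F : rvec R m -> 'M[R[i]]_(a, b)) x :
  mdf F x -> mdf (fun y => (F y)^T) x.
Proof. by move=> dF i j; under eq_fun do rewrite mxE; exact: dF. Qed.

Lemma mdf_conj (a b : nat) (F : rvec R m -> 'M[R[i]]_(a, b)) x :
  mdf F x -> mdf (fun y => conjm (F y)) x.
Proof. by move=> dF i j; under eq_fun do rewrite mxE; exact: Cdiff_conj. Qed.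

Lemma mdf_sum (a b : nat) (I : Type) (r : seq I) (P : pred I)
    (F : I -> rvec R m -> 'M[R[i]]_(a, b)) x :
  (forall i, mdf (F i) x) -> mdf (fun y => \sum_(i <- r | P i) F i y) x.
Proof. by move=> dF i j; under eq_fun do rewrite summxE; apply: Cdiff_sum => k; exact: dF. Qed.

Lemma Cdiff_det (a : nat) (F : rvec R m -> 'M[R[i]]_a) x :
  mdf F x -> Cdiff (fun y => \det (F y)) x.
Proof.
move=> dF; rewrite /determinant; apply: Cdiff_sum => s.
by apply: CdiffM; [exact: Cdiff_cst|apply: Cdiff_prod => i; exact: dF].
Qed.

Lemma mdf_adj (a : nat) (F : rvec R m -> 'M[R[i]]_a) x :
  mdf F x -> mdf (fun y => \adj (F y)) x.
Proof.
move=> dF i j; under eq_fun do rewrite mxE /cofactor.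
apply: CdiffM; first exact: Cdiff_cst.
by apply: Cdiff_det => k l; under eq_fun do rewrite !mxE; exact: dF.
Qed.

Lemma mdf_inv (a : nat) (F : rvec R m -> 'M[R[i]]_a) x :
  F x \in unitmx -> mdf F x -> mdf (fun y => (\det (F y))^-1 *: \adj (F y)) x.
Proof.
move=> Fu dF; apply: mdfZ; last exact: mdf_adj.
by apply: CdiffV; [rewrite -unitfE -unitmxE|exact: Cdiff_det].
Qed.

Lemma cder_mxij (a b : nat) v (F : rvec R m -> 'M[R[i]]_(a, b)) x i j :
  cder_mx v F x i j = cder v (fun y => F y i j) x.
Proof. by rewrite mxE. Qed.

Lemma cder_mxD (a b : nat) v (F G : rvec R m -> 'M[R[i]]_(a, b)) x :
  mdf F x -> mdf G x ->
  cder_mx v (fun y => F y + G y) x = cder_mx v F x + cder_mx v G x.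
Proof.
move=> dF dG; apply/matrixP => i j; rewrite [RHS]mxE !cder_mxij.
rewrite -(cderD v (dF i j) (dG i j)).
by apply: cder_ext => y; rewrite mxE.
Qed.

Lemma cder_mxZ (a b : nat) v f (F : rvec R m -> 'M[R[i]]_(a, b)) x :
  Cdiff f x -> mdf F x ->
  cder_mx v (fun y => f y *: F y) x = cder v f x *: F x + f x *: cder_mx v F x.
Proof.
move=> df dF; apply/matrixP => i j.
rewrite [RHS]mxE [X in _ = X + _]mxE [X in _ = _ + X]mxE !cder_mxij.
rewrite -(cderM v df (dF i j)).
by apply: cder_ext => y; rewrite mxE.
Qed.

Lemma cder_mxM (a b c : nat) v (F : rvec R m -> 'M[R[i]]_(a, b))
    (G : rvec R m -> 'M[R[i]]_(b, c)) x : mdf F x -> mdf G x ->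
  cder_mx v (fun y => F y *m G y) x = cder_mx v F x *m G x + F x *m cder_mx v G x.
Proof.
move=> dF dG; apply/matrixP => i j.
rewrite [RHS]mxE [X in _ = X + _]mxE [X in _ = _ + X]mxE cder_mxij -big_split.
rewrite (cder_ext _ _ (g := fun y => \sum_k F y i k * G y k j)); last first.
  by move=> y; rewrite mxE.
rewrite (cder_sum v _ _ (F := fun k y => F y i k * G y k j)); last first.
  by move=> k; exact: CdiffM.
by apply: eq_bigr => k _; rewrite (cderM v (dF i k) (dG k j)) !cder_mxij.
Qed.

Lemma cder_mx_cst (a b : nat) v (A : 'M[R[i]]_(a, b)) x : cder_mx v (fun=> A) x = 0.
Proof. by apply/matrixP => i j; rewrite cder_mxij [RHS]mxE cder_cst. Qed.

Lemma cder_mx_near (a b : nat) v (F G : rvec R m -> 'M[R[i]]_(a, b)) x :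
  (\forall y \near x, F y = G y) -> cder_mx v F x = cder_mx v G x.
Proof.
move=> FG; apply/matrixP => i j; rewrite !cder_mxij; apply: cder_near.
by near=> y; rewrite (near FG y).
Unshelve. all: by end_near. Qed.

Lemma cder_mx_tr (a b : nat) v (F : rvec R m -> 'M[R[i]]_(a, b)) x :
  cder_mx v (fun y => (F y)^T) x = (cder_mx v F x)^T.
Proof.
apply/matrixP => i j; rewrite [RHS]mxE !cder_mxij.
by apply: cder_ext => y; rewrite mxE.
Qed.

Lemma cder_mx_conj (a b : nat) v (F : rvec R m -> 'M[R[i]]_(a, b)) x :
  mdf F x -> cder_mx v (fun y => conjm (F y)) x = conjm (cder_mx (conjm v) F x).
Proof.
move=> dF; apply/matrixP => i j; rewrite [RHS]mxE !cder_mxij -cder_conj //.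
by apply: cder_ext => y; rewrite mxE.
Qed.

Lemma cder_mx_sum (a b : nat) v (I : Type) (r : seq I) (P : pred I)
    (F : I -> rvec R m -> 'M[R[i]]_(a, b)) x : (forall i, mdf (F i) x) ->
  cder_mx v (fun y => \sum_(i <- r | P i) F i y) x =
  \sum_(i <- r | P i) cder_mx v (F i) x.
Proof.
move=> dF; apply/matrixP => i j; rewrite summxE cder_mxij.
rewrite (cder_ext _ _ (g := fun y => \sum_(k <- r | P k) F k y i j)); last first.
  by move=> y; rewrite summxE.
rewrite (cder_sum v _ _ (F := fun k y => F k y i j)); last by move=> k; exact: dF.
by apply: eq_bigr => k _; rewrite cder_mxij.
Qed.

Lemma cder_mx_linear (a b : nat) c v w (F : rvec R m -> 'M[R[i]]_(a, b)) x :
  cder_mx (c *: v + w) F x = c *: cder_mx v F x + cder_mx w F x.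
Proof.
apply/matrixP => i j.
by rewrite [RHS]mxE [X in _ = X + _]mxE !cder_mxij cder_linear.
Qed.

End MatrixCalculus.

(** * Smooth vector fields and their brackets *)

Section Smooth.
Variables (R : realType) (m : nat).
Implicit Types (x : rvec R m).

Lemma smooth_diff (U : set (rvec R m)) (f : rvec R m -> R) x :
  smooth U f -> U x -> differentiable f x.
Proof. by move=> /(_ 1%N) [df _] /df. Qed.

Lemma smooth_partial (U : set (rvec R m)) (f : rvec R m -> R) j :
  smooth U f -> smooth U (partial j f).
Proof. by move=> sf k; have [_] := sf k.+1; exact. Qed.

Lemma differentiable_ext (f g : rvec R m -> R) x :
  (\forall y \near x, f y = g y) -> differentiable f x -> differentiable g x.
Proof.
move=> fg df.
have bound (e : {posnum R}) : \forall h \near (0 : rvec R m),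
    `|g (h + x) - (g x + 'd f x h)| <= e%:num * `|h|.
  have /eqaddoP /(_ e%:num) /(_ [gt0 of e%:num]) := diff_locally df.
  have fg0 : \forall h \near (0 : rvec R m), f (h + x) = g (h + x).
    by move: fg; rewrite (near_shift 0) subr0.
  apply: filterS2 fg0 => h fgh.
  by rewrite /= -![(_ + _ : _ -> _) _]/(_ + _) -![(- _ : _ -> _) _]/(- _) /= fgh (nbhs_singleton fg).
have D : 'd g x = 'd f x :> (rvec R m -> R).
  apply: diff_unique; first exact: diff_continuous.
  by apply/eqaddoP => _/posnumP[e]; exact: bound.
apply/diff_locallyP; rewrite D; split.
  exact: (diff_continuous df).
by apply/eqaddoP => _/posnumP[e]; exact: bound.
Qed.

Lemma near_open (U : set (rvec R m)) (P : rvec R m -> Prop) x :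
  open U -> U x -> (forall y, U y -> P y) -> \forall y \near x, P y.
Proof. by move=> oU Ux UP; apply: filterS (open_nbhs_nbhs (conj oU Ux)). Qed.

Lemma Cn_ext k (U : set (rvec R m)) (f g : rvec R m -> R) : open U ->
  (forall x, U x -> f x = g x) -> Cn k U f -> Cn k U g.
Proof.
move=> oU; elim: k f g => [|k IH] f g fg.
  have nfg x : U x -> \forall y \near x, f y = g y.
    by move=> Ux; apply: near_open Ux fg.
  move=> /= cf x Ux; have := cf x Ux; rewrite /prop_for /continuous_at -(fg _ Ux) => cfx.
  exact: cvg_trans (near_eq_cvg (F := nbhs x) (nfg x Ux)) cfx.
have nfg x : U x -> \forall y \near x, f y = g y by move=> Ux; apply: near_open Ux fg.
move=> [df pf]; split => [x Ux|j].
  exact: differentiable_ext (nfg _ Ux) (df x Ux).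
apply: IH (pf j) => x Ux; rewrite /partial; exact: near_eq_derive (nfg _ Ux).
Qed.

Lemma smoothD (U : set (rvec R m)) (f g : rvec R m -> R) : open U ->
  smooth U f -> smooth U g -> smooth U (fun y => f y + g y).
Proof.
move=> oU sf sg k; move: f g sf sg; elim: k => [|k IH] f g sf sg /=.
  by move=> x Ux; apply: continuousD; [exact: (sf 0%N)|exact: (sg 0%N)].
split=> [x Ux|j].
  by apply: differentiableD; [exact: smooth_diff sf Ux|exact: smooth_diff sg Ux].
apply: (Cn_ext oU) (IH _ _ (smooth_partial j sf) (smooth_partial j sg)) => x Ux.
by rewrite partialD //; [exact: smooth_diff sf Ux|exact: smooth_diff sg Ux].
Qed.

Lemma smoothZ (U : set (rvec R m)) (a : R) (f : rvec R m -> R) : open U ->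
  smooth U f -> smooth U (fun y => a * f y).
Proof.
move=> oU sf k; move: f sf; elim: k => [|k IH] f sf /=.
  by move=> x Ux; exact: differentiable_continuous (differentiableZ a (smooth_diff sf Ux)).
split=> [x Ux|j].
  exact: (differentiableZ a (smooth_diff sf Ux)).
apply: (Cn_ext oU) (IH _ (smooth_partial j sf)) => x Ux.
rewrite partialM; [|exact: differentiable_cst|exact: smooth_diff sf Ux].
by rewrite partial_cst mulr0 addr0.
Qed.

Lemma smooth_cst (U : set (rvec R m)) (a : R) : open U -> smooth U (fun=> a).
Proof.
move=> oU k; elim: k a => [|k IH] a /=; first by move=> x _; exact: cst_continuous.
split=> [x _|j]; first exact: differentiable_cst.
by apply: (Cn_ext oU) (IH 0) => x _; rewrite partial_cst.
Qed.

Lemma smoothS (U V : set (rvec R m)) (f : rvec R m -> R) :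
  V `<=` U -> smooth U f -> smooth V f.
Proof.
move=> VU sf k; have := sf k; elim: k f {sf} => [|k IH] f /=.
  by move=> cf x /VU; exact: cf.
by move=> [df pf]; split=> [x /VU|j]; [exact: df|exact: IH].
Qed.

Lemma smooth_vfS (U V : set (rvec R m)) (X : vfield R m) :
  V `<=` U -> smooth_vf U X -> smooth_vf V X.
Proof. by move=> VU sX j; have [? ?] := sX j; split; exact: smoothS VU _. Qed.

Lemma smooth_vf_mdf (U : set (rvec R m)) (X : vfield R m) x :
  smooth_vf U X -> U x -> mdf X x.
Proof.
by move=> sX Ux i j; rewrite ord1; have [? ?] := sX j; split; exact: smooth_diff Ux.
Qed.

Lemma conjmE (a b : nat) (A : 'M[R[i]]_(a, b)) i j : conjm A i j = conjc (A i j).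
Proof. by rewrite /conjm mxE. Qed.

Lemma conjmK (a b : nat) (A : 'M[R[i]]_(a, b)) : conjm (conjm A) = A.
Proof. by apply/matrixP => i j; rewrite !conjmE conjcK. Qed.

Lemma conjm0 (a b : nat) : conjm (0 : 'M[R[i]]_(a, b)) = 0.
Proof. exact: map_mx0. Qed.

Lemma conjm1 (a : nat) : conjm (1%:M : 'M[R[i]]_a) = 1%:M.
Proof. exact: map_mx1. Qed.

Lemma conjmD (a b : nat) (A B : 'M[R[i]]_(a, b)) : conjm (A + B) = conjm A + conjm B.
Proof. exact: map_mxD. Qed.

Lemma conjmB (a b : nat) (A B : 'M[R[i]]_(a, b)) : conjm (A - B) = conjm A - conjm B.
Proof. exact: map_mxB. Qed.

Lemma conjmZ (a b : nat) c (A : 'M[R[i]]_(a, b)) : conjm (c *: A) = conjc c *: conjm A.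
Proof. exact: map_mxZ. Qed.

Lemma conjmM (a b c : nat) (A : 'M[R[i]]_(a, b)) (B : 'M[R[i]]_(b, c)) :
  conjm (A *m B) = conjm A *m conjm B.
Proof. exact: map_mxM. Qed.

Lemma conjm_tr (a b : nat) (A : 'M[R[i]]_(a, b)) : conjm A^T = (conjm A)^T.
Proof. by apply/matrixP => i j; rewrite !(conjmE, mxE). Qed.

Lemma conjm_sum (a b : nat) (I : Type) (r : seq I) (P : pred I) (F : I -> 'M[R[i]]_(a, b)) :
  conjm (\sum_(i <- r | P i) F i) = \sum_(i <- r | P i) conjm (F i).
Proof. exact: (big_morph _ (@conjmD a b) (@conjm0 a b)). Qed.

Lemma conjm_unit (a : nat) (A : 'M[R[i]]_a) : (conjm A \in unitmx) = (A \in unitmx).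
Proof. exact: map_unitmx. Qed.

Lemma conjvfE (X : vfield R m) x i j : conjvf X x i j = conjc (X x i j).
Proof. exact: conjmE. Qed.

Lemma smooth_vf_conj (U : set (rvec R m)) (X : vfield R m) : open U ->
  smooth_vf U X -> smooth_vf U (conjvf X).
Proof.
move=> oU sX j; have [s1 s2] := sX j; split.
  rewrite (_ : (fun _ => _) = (fun y => complex.Re (X y 0 j))) //.
  by apply/funext => y; rewrite conjvfE cRe_conj.
rewrite (_ : (fun _ => _) = (fun y => -1 * complex.Im (X y 0 j))).
  exact: smoothZ.
by apply/funext => y; rewrite conjvfE cIm_conj mulN1r.
Qed.

Lemma smooth_vfD (U : set (rvec R m)) (X Y : vfield R m) : open U ->
  smooth_vf U X -> smooth_vf U Y -> smooth_vf U (fun x => X x + Y x).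
Proof.
move=> oU sX sY j; have [s1 s2] := sX j; have [t1 t2] := sY j; split.
  rewrite (_ : (fun _ => _) = (fun y => complex.Re (X y 0 j) + complex.Re (Y y 0 j))).
    exact: smoothD.
  by apply/funext => y; rewrite mxE cReD.
rewrite (_ : (fun _ => _) = (fun y => complex.Im (X y 0 j) + complex.Im (Y y 0 j))).
  exact: smoothD.
by apply/funext => y; rewrite mxE cImD.
Qed.

Lemma smooth_vfZ (U : set (rvec R m)) (c : R[i]) (X : vfield R m) : open U ->
  smooth_vf U X -> smooth_vf U (fun x => c *: X x).
Proof.
move=> oU sX j; have [s1 s2] := sX j; split.
  rewrite (_ : (fun _ => _) = (fun y => complex.Re c * complex.Re (X y 0 j)
                          + - complex.Im c * complex.Im (X y 0 j))).
    by apply: smoothD => //; exact: smoothZ.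
  by apply/funext => y; rewrite mxE cReM mulNr.
rewrite (_ : (fun _ => _) = (fun y => complex.Re c * complex.Im (X y 0 j)
                          + complex.Im c * complex.Re (X y 0 j))).
  by apply: smoothD => //; exact: smoothZ.
by apply/funext => y; rewrite mxE cImM.
Qed.

Lemma smooth_vf0 (U : set (rvec R m)) : open U -> smooth_vf U (fun=> 0).
Proof.
by move=> oU j; split; under eq_fun do rewrite mxE; exact: smooth_cst.
Qed.

Lemma smooth_vf_comb (U : set (rvec R m)) (k : nat) (c : 'rV[R[i]]_k)
    (X : 'I_k -> vfield R m) : open U -> (forall a, smooth_vf U (X a)) ->
  smooth_vf U (fun x => c *m \matrix_a X a x).
Proof.
move=> oU sX.
have -> : (fun x => c *m \matrix_a X a x) = (fun x => \sum_a c 0 a *: X a x).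
  by apply/funext => x; rewrite mulmx_sum_row; apply: eq_bigr => a _; rewrite rowK.
elim: (index_enum _) => [|a l IH].
  by under eq_fun do rewrite big_nil; exact: smooth_vf0.
by under eq_fun do rewrite big_cons; apply: smooth_vfD => //; exact: smooth_vfZ.
Qed.

Lemma mdf_cder (a b : nat) (U : set (rvec R m)) (X : vfield R m)
    (F : rvec R m -> 'M[R[i]]_(a, b)) x :
  mdf X x -> (forall i j, smooth U (fun y => complex.Re (F y i j)) /\
                          smooth U (fun y => complex.Im (F y i j))) -> U x ->
  mdf (fun y => cder_mx (X y) F y) x.
Proof.
move=> dX sF Ux i j; under eq_fun do rewrite mxE cderE.
apply: Cdiff_sum => k; apply: CdiffM; first exact: dX.
have [s1 s2] := sF i j; split.
  by under eq_fun do rewrite Re_pd; exact: smooth_diff (smooth_partial k s1) Ux.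
by under eq_fun do rewrite Im_pd; exact: smooth_diff (smooth_partial k s2) Ux.
Qed.

Lemma mdf_lie (U : set (rvec R m)) (X Y : vfield R m) x :
  smooth_vf U X -> smooth_vf U Y -> U x -> mdf (lie X Y) x.
Proof.
move=> sX sY Ux; apply: mdfD; last apply: mdfN.
  by apply: mdf_cder (smooth_vf_mdf sX Ux) _ Ux => i j; rewrite ord1; exact: sY.
by apply: mdf_cder (smooth_vf_mdf sY Ux) _ Ux => i j; rewrite ord1; exact: sX.
Qed.

Lemma lieN (X Y : vfield R m) x : lie X Y x = - lie Y X x.
Proof. by rewrite /lie opprB. Qed.

Lemma lie_conj (X Y : vfield R m) x : mdf X x -> mdf Y x ->
  lie (conjvf X) (conjvf Y) x = conjm (lie X Y x).
Proof.
move=> dX dY; rewrite /lie /conjvf.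
by rewrite !cder_mx_conj // !conjmK conjmB.
Qed.

Lemma cder_mxN (a b : nat) v (F : rvec R m -> 'M[R[i]]_(a, b)) x : mdf F x ->
  cder_mx v (fun y => - F y) x = - cder_mx v F x.
Proof.
move=> dF; apply/matrixP => i j; rewrite [RHS]mxE !cder_mxij -mulN1r.
by rewrite -cderZ //; apply: cder_ext => y; rewrite mxE mulN1r.
Qed.

Lemma cder_mxBl (a b : nat) (v w : cvec R m) (F : rvec R m -> 'M[R[i]]_(a, b)) x :
  cder_mx (v - w) F x = cder_mx v F x - cder_mx w F x.
Proof. by rewrite addrC -scaleN1r cder_mx_linear scaleN1r addrC. Qed.

Lemma cder_mxB (a b : nat) v (F G : rvec R m -> 'M[R[i]]_(a, b)) x :
  mdf F x -> mdf G x ->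
  cder_mx v (fun y => F y - G y) x = cder_mx v F x - cder_mx v G x.
Proof. by move=> dF dG; rewrite (cder_mxD v dF (mdfN dG)) (cder_mxN v dG). Qed.

Lemma subrACA (V : zmodType) (a b c d : V) : a - b - (c - d) = a - c - (b - d).
Proof. by rewrite !opprB !addrA [LHS]addrAC [RHS]addrAC [a - b - c]addrAC. Qed.

Lemma lieBl (X X' Y : vfield R m) x : mdf X x -> mdf X' x ->
  lie (fun y => X y - X' y) Y x = lie X Y x - lie X' Y x.
Proof. by move=> dX dX'; rewrite /lie (cder_mxB _ dX dX') cder_mxBl subrACA. Qed.

Lemma cder_mx0l (a b : nat) (F : rvec R m -> 'M[R[i]]_(a, b)) x : cder_mx 0 F x = 0.
Proof.
have := cder_mx_linear (-1) (0 : cvec R m) 0 F x.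
by rewrite scaler0 addr0 scaleN1r addNr.
Qed.

Lemma cder_mx_suml (a b k : nat) (c : 'rV[R[i]]_k) (u : 'I_k -> cvec R m)
    (F : rvec R m -> 'M[R[i]]_(a, b)) x :
  cder_mx (\sum_l c 0 l *: u l) F x = \sum_l c 0 l *: cder_mx (u l) F x.
Proof.
elim: (index_enum _) => [|l r IH]; first by rewrite !big_nil cder_mx0l.
by rewrite !big_cons cder_mx_linear IH.
Qed.

Lemma comb_sum (k : nat) (c : 'rV[R[i]]_k) (u : 'I_k -> cvec R m) :
  c *m (\matrix_l u l) = \sum_l c 0 l *: u l.
Proof. by rewrite mulmx_sum_row; apply: eq_bigr => l _; rewrite rowK. Qed.

Lemma lie_comb (k : nat) (c : 'rV[R[i]]_k) (X : 'I_k -> vfield R m) (Y : vfield R m) x :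
  (forall l, mdf (X l) x) ->
  lie (fun y => c *m \matrix_l X l y) Y x = c *m \matrix_l lie (X l) Y x.
Proof.
move=> dX; rewrite (comb_sum c (fun l => lie (X l) Y x)).
have -> : (fun y => c *m \matrix_l X l y) = (fun y => \sum_l c 0 l *: X l y).
  by apply/funext => y; exact: comb_sum.
rewrite [LHS]/lie cder_mx_suml.
rewrite (cder_mx_sum _ _ _ (F := fun l y => c 0 l *: X l y)); last first.
  by move=> l; apply: mdfZ (dX l); exact: Cdiff_cst.
rewrite -sumrB; apply: eq_bigr => l _; rewrite scalerBr; congr (_ - _).
rewrite (cder_mxZ _ (Cdiff_cst (c 0 l) x) (dX l)) cder_cst.
by rewrite scale0r add0r.
Qed.

End Smooth.

(** * Differentiation along lines and curves, symmetry of second derivatives *)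

Section Curves.
Variables (R : realType) (m : nat).
Implicit Types (x : rvec R m).

Lemma is_derive_line (f : rvec R m -> R) x (v : rvec R m) (s : R) :
  differentiable f (x + s *: v) ->
  is_derive s 1 (fun r : R => f (x + r *: v)) ('D_v f (x + s *: v)).
Proof.
move=> df0; have df : derivable f (x + s *: v) v by exact: diff_derivable.
have E : (fun h : R => h^-1 *: (((fun r : R => f (x + r *: v)) \o shift s) (h *: (1 : R))
                     - f (x + s *: v)))
       = (fun h : R => h^-1 *: ((f \o shift (x + s *: v)) (h *: v) - f (x + s *: v))).
  apply/funext => h /=; congr (_ *: (f _ - _)).
  by rewrite [_ *: 1]mulr1 scalerDl addrCA.
by split; rewrite /derivable /derive E.
Qed.

Lemma chain_curve (f : rvec R m -> R) (g : R -> rvec R m) (t : R) (v : rvec R m) :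
  differentiable f (g t) ->
  (forall j, is_derive t 1 (fun s => g s 0 j) (v 0 j)) ->
  is_derive t 1 (fun s => f (g s)) (\sum_j v 0 j * partial j f (g t)).
Proof.
move=> df dg.
have dgt : derivable g t 1.
  by apply/derivable_mxP => i j; rewrite ord1; apply: (@ex_derive _ _ _ _ _ _ _ (dg j)).
have Dg : 'D_1 g t = v.
  rewrite derive_mx //; apply/matrixP => i j; rewrite mxE ord1.
  exact: (@derive_val _ _ _ _ _ _ _ (dg j)).
have dgd : differentiable g t by exact/derivable1_diffP.
have dfg : differentiable (f \o g) t by exact: differentiable_comp.
have -> : \sum_j v 0 j * partial j f (g t) = 'D_1 (f \o g) t.
  rewrite deriveE // diff_comp //= -(deriveE _ dgd) Dg.
  rewrite [in RHS](row_sum_delta v) linear_sum /=; apply: eq_bigr => j _.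
  by rewrite linearZ /= -(deriveE _ df).
apply: DeriveDef => //; exact: diff_derivable.
Qed.

(** Two applications of the mean value theorem: first to the difference in direction [j]
   as a function of the first variable, then to the resulting partial derivative. *)
Lemma second_difference (f : rvec R m -> R) (i j : 'I_m.+1) x (h : R) : 0 < h ->
  (forall s t : R, 0 <= s <= h -> 0 <= t <= h ->
     differentiable f (x + s *: delta_mx 0 i + t *: delta_mx 0 j) /\
     differentiable (partial i f) (x + s *: delta_mx 0 i + t *: delta_mx 0 j)) ->
  exists s t : R, [/\ 0 <= s <= h, 0 <= t <= h &
   f (x + h *: delta_mx 0 i + h *: delta_mx 0 j) - f (x + h *: delta_mx 0 j)
   - (f (x + h *: delta_mx 0 i) - f x)
   = partial j (partial i f) (x + s *: delta_mx 0 i + t *: delta_mx 0 j) * h * h].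
Proof.
move=> h0 dfh; set ei := delta_mx 0 i; set ej := delta_mx 0 j.
have h0h : 0 <= h <= h by rewrite lexx ltW.
have h00 : 0 <= (0 : R) <= h by rewrite lexx ltW.
pose phi (s : R) := f (x + h *: ej + s *: ei) - f (x + s *: ei).
have dphi s : 0 <= s <= h -> is_derive s 1 phi
    (partial i f (x + h *: ej + s *: ei) - partial i f (x + s *: ei)).
  move=> sh; apply: is_deriveB; apply: is_derive_line.
    by rewrite addrAC; have [] := dfh s h sh h0h.
  by have [+ _] := dfh s 0 sh h00; rewrite scale0r addr0.
have cont (p dp : R -> R) : (forall s, 0 <= s <= h -> is_derive s 1 p (dp s)) ->
    {within `[0, h], continuous p}.
  move=> dp0; apply: derivable_within_continuous => s.
  by rewrite in_itv /= => sh; apply: (@ex_derive _ _ _ _ _ _ _ (dp0 s sh)).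
have idphi s : s \in `]0, h[ -> is_derive s 1 phi (partial i f (x + h *: ej + s *: ei) - partial i f (x + s *: ei)).
  by rewrite in_itv /= => /andP[s1 s2]; apply: dphi; rewrite !ltW.
have [s sh Es] := MVT h0 idphi (cont _ _ dphi).
have {}sh : 0 <= s <= h by move: sh; rewrite in_itv /= => /andP[? ?]; rewrite !ltW.
pose psi (t : R) := partial i f (x + s *: ei + t *: ej).
have dpsi t : 0 <= t <= h -> is_derive t 1 psi (partial j (partial i f) (x + s *: ei + t *: ej)).
  by move=> th; apply: is_derive_line; have [] := dfh s t sh th.
have idpsi t : t \in `]0, h[ -> is_derive t 1 psi (partial j (partial i f) (x + s *: ei + t *: ej)).
  by rewrite in_itv /= => /andP[t1 t2]; apply: dpsi; rewrite !ltW.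
have [t th Et] := MVT h0 idpsi (cont _ _ dpsi).
have {}th : 0 <= t <= h by move: th; rewrite in_itv /= => /andP[? ?]; rewrite !ltW.
exists s, t; split=> //; rewrite subr0 in Es Et.
rewrite -Et /psi scale0r addr0 [x + s *: ei + _]addrAC -Es /phi !scale0r !addr0.
by rewrite [x + h *: ej + _]addrAC; exact: subrACA.
Qed.

Lemma norm_delta_le (i j : 'I_m.+1) (s t h : R) : 0 <= s <= h -> 0 <= t <= h ->
  `|s *: (delta_mx 0 i : rvec R m) + t *: delta_mx 0 j| <= h + h.
Proof.
move=> /andP[s0 sh] /andP[t0 th].
have nd (k : 'I_m.+1) : `|delta_mx 0 k : rvec R m| <= 1.
  rewrite /Num.Def.normr /= mx_normrE; apply: bigmax_le => // -[a b] _.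
  by rewrite mxE; case: (_ && _); rewrite ?normr0 ?normr1.
apply: (le_trans (ler_normD _ _)); rewrite !normrZ !ger0_norm //.
by apply: lerD; [apply: le_trans sh|apply: le_trans th]; rewrite ler_piMr.
Qed.

(** The second difference is symmetric in the two directions; divided by [h ^+ 2] it
   tends to either mixed derivative, by continuity of the latter. *)
Lemma partialC (U : set (rvec R m)) (f : rvec R m -> R) (i j : 'I_m.+1) x :
  open U -> smooth U f -> U x ->
  partial i (partial j f) x = partial j (partial i f) x.
Proof.
move=> oU sf Ux.
have cij : {for x, continuous (partial i (partial j f))}.
  by apply: differentiable_continuous; apply: (smooth_diff _ Ux); do 2 apply: smooth_partial.
have cji : {for x, continuous (partial j (partial i f))}.
  by apply: differentiable_continuous; apply: (smooth_diff _ Ux); do 2 apply: smooth_partial.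
apply/eqP; rewrite -subr_eq0 -normr_le0; apply/ler_addgt0Pr => _ /posnumP[e]; rewrite add0r.
have nU : nbhs x U by exact: open_nbhs_nbhs.
have e2 : 0 < e%:num / 2 :> R by [].
pose A := [set y | `|partial i (partial j f) x - partial i (partial j f) y| < e%:num / 2].
pose B := [set y | `|partial j (partial i f) x - partial j (partial i f) y| < e%:num / 2].
have nA : nbhs x A by move/cvgrPdist_lt: cij => /(_ _ e2).
have nB : nbhs x B by move/cvgrPdist_lt: cji => /(_ _ e2).
have nUAB : nbhs x (U `&` (A `&` B)) by apply: filterI => //; exact: filterI.
move/nbhs_ballP: nUAB => [r /= r0 Hr].
pose h := r / 4.
have h0 : 0 < h by rewrite divr_gt0.
have inb (a b : 'I_m.+1) s t : 0 <= s <= h -> 0 <= t <= h ->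
    ball x r (x + s *: delta_mx 0 a + t *: delta_mx 0 b).
  move=> sh th; rewrite -ball_normE /ball_ /= -addrA opprD addNKr normrN.
  apply: le_lt_trans (norm_delta_le a b sh th) _.
  by rewrite /h; lra.
have [|s [t [sh th E1]]] := @second_difference f j i x h h0.
  move=> s t sh th; have [Uy _] := Hr _ (inb j i s t sh th).
  by split; [exact: smooth_diff sf Uy|exact: smooth_diff (smooth_partial j sf) Uy].
have [|s' [t' [sh' th' E2]]] := @second_difference f i j x h h0.
  move=> s' t' sh' th'; have [Uy _] := Hr _ (inb i j s' t' sh' th').
  by split; [exact: smooth_diff sf Uy|exact: smooth_diff (smooth_partial i sf) Uy].
have [_ [A1 _]] := Hr _ (inb j i s t sh th).
have [_ [_ A2]] := Hr _ (inb i j s' t' sh' th').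
have h2 : h * h != 0 by rewrite mulf_neq0 // gt_eqF.
have E : partial i (partial j f) (x + s *: delta_mx 0 j + t *: delta_mx 0 i) =
         partial j (partial i f) (x + s' *: delta_mx 0 i + t' *: delta_mx 0 j).
  have Ex : x + h *: delta_mx 0 j + h *: delta_mx 0 i =
            x + h *: delta_mx 0 i + h *: (delta_mx 0 j : rvec R m) by rewrite addrAC.
  apply: (mulIf h2); rewrite [LHS]mulrA [RHS]mulrA.
  by apply: (etrans (esym E1)); apply: etrans E2; rewrite Ex; exact: subrACA.
move: A1 A2; rewrite /A /B /= E => A1 A2.
rewrite [leRHS]splitr; apply: le_trans (ltW (ltrD A1 A2)).
apply: le_trans (ler_normB _ _); rewrite le_eqVlt; apply/orP; left; apply/eqP.
by rewrite opprB addrA subrK.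
Qed.

Definition csmooth (U : set (rvec R m)) (F : rvec R m -> R[i]) :=
  smooth U (fun y => complex.Re (F y)) /\ smooth U (fun y => complex.Im (F y)).

Implicit Types (U : set (rvec R m)) (F : rvec R m -> R[i]).

Lemma csmooth_Cdiff U F x : csmooth U F -> U x -> Cdiff F x.
Proof. by move=> [s1 s2] Ux; split; exact: smooth_diff Ux. Qed.

Lemma csmooth_pd U F j : csmooth U F -> csmooth U (pd j F).
Proof.
move=> [s1 s2]; split.
  by under eq_fun do rewrite Re_pd; exact: smooth_partial.
by under eq_fun do rewrite Im_pd; exact: smooth_partial.
Qed.

Transparent pd.
Lemma pdC U F i j x : open U -> csmooth U F -> U x ->
  pd i (pd j F) x = pd j (pd i F) x.
Proof.
move=> oU [s1 s2] Ux; apply: complex_eq.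
  exact: (partialC i j oU s1 Ux).
exact: (partialC i j oU s2 Ux).
Qed.

Opaque pd.
Lemma sum_symmetric (T : comPzRingType) (k : nat) (a b : 'I_k -> T) (c : 'I_k -> 'I_k -> T) :
  (forall i j, c i j = c j i) ->
  \sum_j \sum_i a j * (b i * c i j) = \sum_j \sum_i b j * (a i * c i j).
Proof.
move=> cC; rewrite exchange_big; apply: eq_bigr => j _; apply: eq_bigr => i _.
by rewrite mulrCA cC.
Qed.

(** The terms with second derivatives of [F] cancel by symmetry of these. *)
Lemma lie_commutator U F (X Y : vfield R m) x : open U -> csmooth U F ->
  smooth_vf U X -> smooth_vf U Y -> U x ->
  cder (lie X Y x) F x = cder (X x) (fun y => cder (Y y) F y) x
                       - cder (Y x) (fun y => cder (X y) F y) x.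
Proof.
move=> oU sF sX sY Ux.
have expand (V Z : vfield R m) : smooth_vf U Z ->
    cder (V x) (fun y => cder (Z y) F y) x =
    cder (cder_mx (V x) Z x) F x
    + \sum_j \sum_k Z x 0 j * (V x 0 k * pd k (pd j F) x).
  move=> sZ; rewrite (cder_ext _ _ (g := fun y => \sum_j Z y 0 j * pd j F y)); last first.
    by move=> y; rewrite cderE.
  have dZ j := smooth_vf_mdf sZ Ux 0 j.
  have dF j := csmooth_Cdiff (csmooth_pd j sF) Ux.
  rewrite (cder_sum _ _ _ (F := fun j y => Z y 0 j * pd j F y)); last first.
    by move=> j; exact: CdiffM (dZ j) (dF j).
  rewrite cderE -big_split; apply: eq_bigr => j _.
  by rewrite (cderM _ (dZ j) (dF j)) cder_mxij (cderE (V x)) mulr_sumr.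
have S := @sum_symmetric _ _ (fun j => Y x 0 j) (fun j => X x 0 j)
  (fun k j => pd k (pd j F) x) (fun k j => pdC k j oU sF Ux).
rewrite (expand X Y sY) (expand Y X sX) S.
by rewrite opprD addrACA subrr addr0; exact: cderBl.
Qed.

Lemma cdiffE m' (prj : rvec R m -> rvec R m') x (v : cvec R m) k :
  cdiff prj x v 0 k = cder v (fun y => Complex (prj y 0 k) 0) x.
Proof.
rewrite mxE cderE; apply: eq_bigr => j _; by rewrite pd_real.
Qed.

(** Along the fields the components of [prj] have zero derivative, so that the
   commutator of derivations also kills them. This makes the tangent bundle of a
   foliation involutive once the foliation is given by a submersion. *)
Lemma lie_kernel m' (U : set (rvec R m)) (prj : rvec R m -> rvec R m')
    (X Y : vfield R m) x : open U -> smooth_map U prj ->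
  smooth_vf U X -> smooth_vf U Y ->
  (forall y, U y -> cdiff prj y (X y) = 0) ->
  (forall y, U y -> cdiff prj y (Y y) = 0) ->
  U x -> cdiff prj x (lie X Y x) = 0.
Proof.
move=> oU sp sX sY kX kY Ux; apply/rowP => k; rewrite [RHS]mxE cdiffE.
have sF : csmooth U (fun y => Complex (prj y 0 k) 0).
  by split; [exact: sp|exact: smooth_cst].
have zero (Z V : vfield R m) : (forall y, U y -> cdiff prj y (Z y) = 0) ->
    cder (V x) (fun y => cder (Z y) (fun y0 => Complex (prj y0 0 k) 0) y) x = 0.
  move=> kZ; rewrite -[RHS](cder_cst (V x) 0 x); apply: cder_near.
  by apply: near_open oU Ux _ => y Uy; rewrite -cdiffE kZ // mxE.
by rewrite (lie_commutator oU sF sX sY Ux) (zero Y X kY) (zero X Y kX) subrr.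
Qed.

End Curves.

(** * The matrix algebra *)

Section GradedAlgebra.
Variables (R : realType) (s : nat).
Implicit Types (c u : R[i]) (v w : 'cV[R[i]]_s) (L S T : 'M[R[i]]_s).

Lemma cel0E c L : cel c L 0 0 =
  block_mx c%:M 0 0 (block_mx L 0 0 (block_mx (- L^T) 0 0 (- c)%:M)).
Proof.
by rewrite /cel /gm mul0r (raddf0 (@scalar_mx _ 1)) !trmx0 oppr0 row_mx0 !col_mx0.
Qed.

Lemma cposE S : cel 0 0 S 0 = block_mx 0 0 0 (block_mx 0 (row_mx S 0) 0 0).
Proof.
by rewrite /cel /gm mul0r !oppr0 !(raddf0 (@scalar_mx _ 1)) !trmx0 !oppr0 !col_mx0 block_mx0.
Qed.

Lemma cnegE T : cel 0 0 0 T = block_mx 0 0 0 (block_mx 0 0 (col_mx T 0) 0).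
Proof.
by rewrite /cel /gm mul0r !oppr0 !(raddf0 (@scalar_mx _ 1)) !trmx0 !oppr0 !col_mx0 row_mx0 block_mx0.
Qed.

Lemma helE u v w : hel u v w =
  block_mx 0 0 (col_mx v (col_mx w (u * 'i%C)%:M))
    (block_mx 0 0 (col_mx 0 w^T) (block_mx 0 0 (- v^T) 0)).
Proof.
by rewrite /hel /gm oppr0 !(raddf0 (@scalar_mx _ 1)) !trmx0 oppr0 row_mx0.
Qed.

Definition blkE := (mulmx_block, mul_block_col, mul_row_block, mul_row_col,
  mul_mx_row, mul_col_mx, mul0mx, mulmx0, add_block_mx, add_row_mx, add_col_mx,
  opp_block_mx, opp_row_mx, opp_col_mx, row_mx0, col_mx0, oppr0, add0r, addr0).

(** The scalar [c] acts with weights -2 and -1, in addition to the natural action of [L]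
   on [v] and its dual action on [w]. *)
Lemma br_cel_hel c L u v w :
  br (cel c L 0 0) (hel u v w) =
  hel (- (2 * c * u)) (L *m v - c *: v) (- (L^T *m w) - c *: w).
Proof.
rewrite /br cel0E !helE !blkE !mulNmx !mulmxN !mul_mx_scalar !mul_scalar_mx.
congr block_mx; first congr (col_mx _ (col_mx _ _)).
  rewrite !scale_scalar_mx -(raddfB (@scalar_mx R[i] 1)); congr _%:M; ring.
congr block_mx; first congr col_mx.
  by rewrite linearB linearN /= trmx_mul trmxK linearZ /= scaleNr addrC.
by congr block_mx; rewrite scaleNr !opprK linearB /= linearZ /= trmx_mul opprB.
Qed.

Lemma mul_ii : 'i%C * 'i%C = -1 :> R[i].
Proof. by rewrite -expr2 sqr_i. Qed.

Lemma br_hel v w : br (hel 0 v 0) (hel 0 0 w) = hel (2 * 'i%C * (v^T *m w) 0 0) 0 0.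
Proof.
rewrite /br !helE !trmx0 mul0r !(raddf0 (@scalar_mx _ 1)) !blkE.
suff -> : - v^T *m w - w^T *m v = (2 * 'i%C * (v^T *m w) 0 0 * 'i%C)%:M by [].
have -> : w^T *m v = (v^T *m w)^T by rewrite trmx_mul trmxK.
rewrite mulNmx [v^T *m w]mx11_scalar tr_scalar_mx [in RHS]mxE eqxx mulr1n.
rewrite -(raddfN (@scalar_mx R[i] 1)) -(raddfD (@scalar_mx R[i] 1)); congr _%:M.
move: (_ 0 0) => a; have -> : 2 * 'i%C * a * 'i%C = 2 * a * ('i%C * 'i%C) by ring.
by rewrite mul_ii; ring.
Qed.

Lemma br_pos c L S : br (cel c L 0 0) (cel 0 0 S 0) = cel 0 0 (L *m S + S *m L^T) 0.
Proof.
by rewrite /br cel0E !cposE !blkE mulmxN opprK.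
Qed.

Lemma br_neg c L T : br (cel c L 0 0) (cel 0 0 0 T) = cel 0 0 0 (- (L^T *m T) - T *m L).
Proof.
by rewrite /br cel0E !cnegE !blkE mulNmx.
Qed.

Lemma gm_linear a c v w u L S T c' v' w' u' L' S' T' :
  a *: gm c v w u L S T + gm c' v' w' u' L' S' T' =
  gm (a * c + c') (a *: v + v') (a *: w + w') (a * u + u')
     (a *: L + L') (a *: S + S') (a *: T + T').
Proof.
rewrite /gm !scale_block_mx !scale_col_mx !scale_row_mx !scaler0 !add_block_mx.
rewrite !add_col_mx !add_row_mx !addr0 !scale_scalar_mx !linearD /= !linearZ /=.
rewrite -!(raddfD (@scalar_mx R[i] 1)) mulrDl mulrA.
by [].
Qed.

Lemma hel_linear a u v w u' v' w' :
  a *: hel u v w + hel u' v' w' = hel (a * u + u') (a *: v + v') (a *: w + w').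
Proof. by rewrite /hel gm_linear mulr0 addr0 scaler0 addr0. Qed.

Lemma cel_linear a c L S T c' L' S' T' :
  a *: cel c L S T + cel c' L' S' T' =
  cel (a * c + c') (a *: L + L') (a *: S + S') (a *: T + T').
Proof. by rewrite /cel gm_linear mulr0 addr0 scaler0 addr0. Qed.

Lemma gm_inj c v w u L S T c' v' w' u' L' S' T' :
  gm c v w u L S T = gm c' v' w' u' L' S' T' ->
  [/\ v = v', w = w', u = u', L = L' & (S = S') * (T = T')].
Proof.
move=> /eq_block_mx[_ _ /eq_col_mx[-> /eq_col_mx[-> Eu]]].
move=> /eq_block_mx[-> /eq_row_mx[-> _] /eq_col_mx[-> _] _].
split=> //; move/matrixP: Eu => /(_ 0 0); rewrite !mxE eqxx !mulr1n; apply: mulIf.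
by apply/eqP => /(congr1 (fun z : R[i] => z * z)) /eqP; rewrite mul_ii mulr0 oppr_eq0 oner_eq0.
Qed.

Lemma Lpart_cel c L S T : Lpart (cel c L S T) = L.
Proof. by rewrite /Lpart /cel /gm block_mxKdr block_mxKul. Qed.

Lemma br_linearr a (X Y Z : gmat R s) : br X (a *: Y + Z) = a *: br X Y + br X Z.
Proof. by rewrite /br mulmxDr mulmxDl -scalemxAr -scalemxAl scalerBr addrACA opprD. Qed.

Lemma br_linearl a (X Y Z : gmat R s) : br (a *: X + Y) Z = a *: br X Z + br Y Z.
Proof. by rewrite /br mulmxDr mulmxDl -scalemxAr -scalemxAl scalerBr addrACA opprD. Qed.

End GradedAlgebra.

(** * Adapted frames and their coordinates *)

(** What the proof uses of the CR structure near a point. The bundle [Kc] is closed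
   under brackets because it is the kernel of the differential of a local quotient; the
   constancy of the rank of the third kernel, a consequence of uniform nondegeneracy,
   is what makes the maps O well defined. *)
Record CR_nbhd (R : realType) (m s r : nat) (U : set (rvec R m))
    (H : rvec R m -> set (cvec R m)) (O : set (rvec R m)) : Prop := CRNbhd {
  nb_open : open O;
  nb_sub : O `<=` U;
  nb_dim : m.+1 = ((s + r) + (s + r) + 1)%N;
  nb_inv : forall V X Y, open V -> V `<=` O -> section_on H V X ->
    section_on H V Y -> section_on H V (lie X Y);
  nb_tot : forall x v, O x -> H x v -> conjset (H x) v -> v = 0;
  nb_kc : forall V X Y, open V -> V `<=` O -> section_on (Kc U H) V X ->
    section_on (Kc U H) V Y -> forall q, V q -> Kc U H q (lie X Y q);
  nb_K3 : exists t, forall x, O x -> has_rank (Kb U H 3 x) t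
}.

Lemma has_rank_basis (R : realType) (m k : nat) (D : set (cvec R m))
    (B : 'M[R[i]]_(k, m.+1)) : has_rank D k -> row_free B ->
  (forall j, D (row j B)) -> forall v, D v <-> (v <= B)%MS.
Proof.
move=> [B' [fB' DB']] fB DB.
have sBB' : (B <= B')%MS by apply/row_subP => j; apply/DB'; exact: DB.
have eBB' : (B' <= B)%MS.
  rewrite -(geq_leqif (mxrank_leqif_sup sBB')).
  by move: fB fB'; rewrite /row_free => /eqP -> /eqP ->.
by move=> v; split=> [/DB' /submx_trans|/submx_trans vB]; [exact|apply/DB'; exact: vB].
Qed.

Section Coordinates.
Variables (R : realType) (m s r : nat).
Variables (U : set (rvec R m)) (H : rvec R m -> set (cvec R m)) (O : set (rvec R m)).
Variable phi : frame R m s r.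
Hypotheses (nb : CR_nbhd s r U H O) (ad : adapted U H O phi).
Implicit Types (q y : rvec R m) (v : cvec R m).

Definition fmat q : 'M[R[i]]_(s, m.+1) := \matrix_k ff phi k q.
Definition emat q : 'M[R[i]]_(r, m.+1) := \matrix_a fe phi a q.
Definition hmat q := col_mx (fmat q) (emat q).
(** The rows [f], [e], their conjugates and [g] form a basis of all complex tangent
   vectors; the columns of its right inverse are the dual coframe. Multiplication by
   [cf], [ce], [cfb], [ceb], [cu] gives the coordinates of a vector along [f], [e],
   their conjugates and [g]. *)
Definition fullmat q := col_mx (col_mx (hmat q) (conjm (hmat q))) (fg phi q).
Definition dualmat q : 'M[R[i]]_(m.+1, (s + r) + (s + r) + 1) := pinvmx (fullmat q).

Definition cH q := lsubmx (lsubmx (dualmat q)).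
Definition cHb q := rsubmx (lsubmx (dualmat q)).
Definition cu q := rsubmx (dualmat q).
Definition cf q := lsubmx (cH q).
Definition ce q := rsubmx (cH q).
Definition cfb q := lsubmx (cHb q).
Definition ceb q := rsubmx (cHb q).

Lemma row_fmat q k : row k (fmat q) = ff phi k q.
Proof. by rewrite rowK. Qed.
Lemma row_emat q a : row a (emat q) = fe phi a q.
Proof. by rewrite rowK. Qed.

Lemma conj_hmat q : conjm (hmat q) = col_mx (conjm (fmat q)) (conjm (emat q)).
Proof. exact: map_col_mx. Qed.

Lemma memK q v : O q -> Kb U H 2 q v <-> (v <= emat q)%MS.
Proof.
move=> Oq; have [rk fr] := ad_ebasis ad Oq; apply: has_rank_basis rk fr _ v => a.
by rewrite row_emat; have [_] := ad_e ad a; exact.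
Qed.

Lemma K_sub_H q v : Kb U H 2 q v -> H q v.
Proof. by case. Qed.

Lemma memH q v : O q -> H q v <-> (v <= hmat q)%MS.
Proof.
move=> Oq; have [rk fr] := ad_fbasis ad Oq; apply: has_rank_basis rk fr _ v => j.
rewrite -[j]splitK; case: (fintype.split j) => a /=.
  by rewrite rowKu row_fmat; have [_] := ad_f ad a; exact.
by rewrite rowKd row_emat; apply: K_sub_H; have [_] := ad_e ad a; exact.
Qed.

Lemma submx_conj (k : nat) v (B : 'M[R[i]]_(k, m.+1)) :
  (conjm v <= B)%MS = (v <= conjm B)%MS.
Proof. by rewrite -(map_submx (@conjc R)) -![map_mx _ _]/(conjm _) conjmK. Qed.

Lemma memHb q v : O q -> conjset (H q) v <-> (v <= conjm (hmat q))%MS.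
Proof. by move=> Oq; rewrite -submx_conj; exact: memH. Qed.

Lemma memKb q v : O q -> conjset (Kb U H 2 q) v <-> (v <= conjm (emat q))%MS.
Proof. by move=> Oq; rewrite -submx_conj; exact: memK. Qed.

Lemma memHc q v : O q -> Hc H q v <-> (v <= col_mx (hmat q) (conjm (hmat q)))%MS.
Proof.
move=> Oq; rewrite -addsmxE; split.
  move=> [a [b [/(memH _ Oq) Ha /(memHb _ Oq) Hb ->]]].
  by apply: addmx_sub_adds.
case/sub_addsmxP => [[a b] /= ->]; exists (a *m hmat q), (b *m conjm (hmat q)); split=> //.
  by apply/memH => //; exact: submxMl.
by apply/memHb => //; exact: submxMl.
Qed.

(** The holomorphic and antiholomorphic parts are independent since the structure is
   totally real, and [g] is transverse to both. *)
Lemma fullmat_free q : O q -> row_free (fullmat q).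
Proof.
move=> Oq; have [_ fr] := ad_fbasis ad Oq.
have frb : row_free (conjm (hmat q)) by rewrite row_free_map.
apply: inj_row_free => x; rewrite -[x]hsubmxK -[lsubmx x]hsubmxK.
move: (lsubmx (lsubmx x)) (rsubmx (lsubmx x)) (rsubmx x) => a b c.
rewrite !mul_row_col => E.
have c0 : c = 0.
  apply/eqP; apply/contraT => c0; case: (ad_gbasis ad Oq); apply/(memHc _ Oq).
  have c00 : c 0 0 != 0.
    by apply: contraNneq c0 => c00; apply/eqP/rowP => i; rewrite ord1 c00 mxE.
  rewrite -(scale1r (fg phi q)) -(mulVf c00) -scalerA scalemx_sub //.
  have -> : c 0 0 *: fg phi q = - (row_mx a b *m col_mx (hmat q) (conjm (hmat q))).
    rewrite mul_row_col -mul_scalar_mx -mx11_scalar; apply/eqP.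
    by rewrite -addr_eq0 addrC; exact/eqP.
  by rewrite eqmx_opp submxMl.
rewrite {}c0 mul0mx addr0 in E *.
have aH : a *m hmat q = 0.
  apply: (nb_tot nb Oq); first by apply/(memH _ Oq); exact: submxMl.
  apply/(memHb _ Oq); move/eqP: E; rewrite addr_eq0 => /eqP ->.
  by rewrite eqmx_opp submxMl.
have a0 : a = 0 by apply: (row_free_inj fr); rewrite aH mul0mx.
have b0 : b = 0.
  by apply: (row_free_inj frb); rewrite mul0mx -[RHS]E aH add0r.
by rewrite a0 b0 !row_mx0.
Qed.

Lemma full_dual q : O q -> fullmat q *m dualmat q = 1%:M.
Proof. by move=> Oq; exact: mulmxVp (fullmat_free Oq). Qed.

Lemma dual_full q : O q -> dualmat q *m fullmat q = 1%:M.
Proof.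
move=> Oq; apply: mulVpmx; move: (fullmat_free Oq).
by rewrite /row_free /row_full => /eqP ->; rewrite -(nb_dim nb).
Qed.

Lemma dual_rels q : O q ->
  [/\ (hmat q *m cH q = 1%:M) * (hmat q *m cHb q = 0) * (hmat q *m cu q = 0),
      (conjm (hmat q) *m cH q = 0) * (conjm (hmat q) *m cHb q = 1%:M) *
      (conjm (hmat q) *m cu q = 0)
    & (fg phi q *m cH q = 0) * (fg phi q *m cHb q = 0) * (fg phi q *m cu q = 1%:M)].
Proof.
move=> Oq; have := full_dual Oq.
rewrite /fullmat -[dualmat q]hsubmxK -[lsubmx (dualmat q)]hsubmxK.
rewrite -/(cH q) -/(cHb q) -/(cu q) mul_col_row mul_col_row mul_col_mx mul_mx_row.
rewrite 2!scalar_mx_block => /eq_block_mx[].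
move=> /eq_block_mx[-> -> -> ->] + + ->.
by rewrite mul_col_mx -col_mx0 => /eq_col_mx[-> ->]; rewrite -row_mx0 => /eq_row_mx[-> ->].
Qed.

Lemma dual_complete q v : O q ->
  v = v *m cH q *m hmat q + v *m cHb q *m conjm (hmat q) + v *m cu q *m fg phi q.
Proof.
move=> Oq; rewrite -{1}[v]mulmx1 -(dual_full Oq) /fullmat.
rewrite -[dualmat q]hsubmxK -[lsubmx (dualmat q)]hsubmxK -/(cH q) -/(cHb q) -/(cu q).
by rewrite !mul_row_col !mulmxDr !mulmxA.
Qed.

Lemma split_H q (a : 'rV[R[i]]_(s + r)) :
  a *m hmat q = lsubmx a *m fmat q + rsubmx a *m emat q.
Proof. by rewrite -{1}[a]hsubmxK mul_row_col. Qed.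

Lemma split_Hb q (a : 'rV[R[i]]_(s + r)) :
  a *m conjm (hmat q) = lsubmx a *m conjm (fmat q) + rsubmx a *m conjm (emat q).
Proof. by rewrite -{1}[a]hsubmxK conj_hmat mul_row_col. Qed.

Lemma mul_cH q v : v *m cH q = row_mx (v *m cf q) (v *m ce q).
Proof. by rewrite -[cH q]hsubmxK mul_mx_row. Qed.
Lemma mul_cHb q v : v *m cHb q = row_mx (v *m cfb q) (v *m ceb q).
Proof. by rewrite -[cHb q]hsubmxK mul_mx_row. Qed.

Lemma frame_expand q v : O q ->
  v = v *m cf q *m fmat q + v *m ce q *m emat q
    + (v *m cfb q *m conjm (fmat q) + v *m ceb q *m conjm (emat q))
    + v *m cu q *m fg phi q.
Proof.
move=> Oq; rewrite {1}(dual_complete v Oq) split_H split_Hb.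
by rewrite mul_cH mul_cHb !row_mxKl !row_mxKr.
Qed.

Lemma dual_fe q : O q ->
  [/\ (fmat q *m cf q = 1%:M) * (fmat q *m ce q = 0) * (fmat q *m cu q = 0)
      * (fmat q *m cfb q = 0) * (fmat q *m ceb q = 0)
    & (emat q *m cf q = 0) * (emat q *m ce q = 1%:M) * (emat q *m cu q = 0)
      * (emat q *m cfb q = 0) * (emat q *m ceb q = 0)].
Proof.
move=> Oq; have [[[A B] C] _ _] := dual_rels Oq; move: A B C.
rewrite -[cH q]hsubmxK -[cHb q]hsubmxK -/(cf q) -/(ce q) -/(cfb q) -/(ceb q) /hmat.
rewrite mul_col_row scalar_mx_block => /eq_block_mx[-> -> -> ->].
rewrite mul_col_row -block_mx0 => /eq_block_mx[-> -> -> ->].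
by rewrite mul_col_mx -col_mx0 => /eq_col_mx[-> ->].
Qed.

Lemma dual_feb q : O q ->
  [/\ (conjm (fmat q) *m cfb q = 1%:M) * (conjm (fmat q) *m ceb q = 0)
      * (conjm (fmat q) *m cu q = 0) * (conjm (fmat q) *m cf q = 0)
      * (conjm (fmat q) *m ce q = 0)
    & (conjm (emat q) *m cfb q = 0) * (conjm (emat q) *m ceb q = 1%:M)
      * (conjm (emat q) *m cu q = 0) * (conjm (emat q) *m cf q = 0)
      * (conjm (emat q) *m ce q = 0)].
Proof.
move=> Oq; have [_ [[A B] C] _] := dual_rels Oq; move: A B C.
rewrite -[cH q]hsubmxK -[cHb q]hsubmxK -/(cf q) -/(ce q) -/(cfb q) -/(ceb q) conj_hmat.
rewrite mul_col_row -block_mx0 => /eq_block_mx[-> -> -> ->].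
rewrite mul_col_row scalar_mx_block => /eq_block_mx[-> -> -> ->].
by rewrite mul_col_mx -col_mx0 => /eq_col_mx[-> ->].
Qed.

Lemma Hc_cu q v : O q -> Hc H q v <-> v *m cu q = 0.
Proof.
move=> Oq; have [[_ A] [_ B] _] := dual_rels Oq; split.
  move=> [a [b [/(memH _ Oq)/submxP[x ->] /(memHb _ Oq)/submxP[y ->] ->]]].
  by rewrite mulmxDl -!mulmxA A B !mulmx0 addr0.
move=> v0; rewrite (dual_complete v Oq) v0 mul0mx addr0; apply/(memHc _ Oq).
by rewrite -mul_row_col submxMl.
Qed.

Lemma H_coord q v : O q -> H q v ->
  [/\ v *m cu q = 0, v *m cfb q = 0, v *m ceb q = 0 &
      v = v *m cf q *m fmat q + v *m ce q *m emat q].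
Proof.
move=> Oq Hv; suff [a b c] : [/\ v *m cu q = 0, v *m cfb q = 0 & v *m ceb q = 0].
  by split=> //; rewrite {1}(frame_expand v Oq) a b c !mul0mx !addr0.
move/(memH _ Oq)/submxP: Hv => [x ->]; rewrite split_H.
have [A B] := dual_fe Oq; rewrite !mulmxDl -!mulmxA !A !B.
by rewrite !mulmx0 !addr0.
Qed.

Lemma Hb_coord q v : O q -> conjset (H q) v ->
  [/\ v *m cu q = 0, v *m cf q = 0, v *m ce q = 0 &
      v = v *m cfb q *m conjm (fmat q) + v *m ceb q *m conjm (emat q)].
Proof.
move=> Oq Hv; suff [a b c] : [/\ v *m cu q = 0, v *m cf q = 0 & v *m ce q = 0].
  by split=> //; rewrite {1}(frame_expand v Oq) a b c !mul0mx !addr0 !add0r.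
move/(memHb _ Oq)/submxP: Hv => [x ->]; rewrite split_Hb.
have [A B] := dual_feb Oq; rewrite !mulmxDl -!mulmxA !A !B.
by rewrite !mulmx0 !addr0.
Qed.

Lemma K_coord q v : O q -> Kb U H 2 q v <-> H q v /\ v *m cf q = 0.
Proof.
move=> Oq; have [A B] := dual_fe Oq; split.
  by move=> Kv; split; [exact: K_sub_H|move/(memK _ Oq)/submxP: Kv => [x ->]; rewrite -mulmxA B mulmx0].
move=> [Hv v0]; have [_ _ _] := H_coord Oq Hv; rewrite v0 mul0mx add0r => ->.
by apply/(memK _ Oq); exact: submxMl.
Qed.

Lemma Kb_coord q v : O q -> conjset (Kb U H 2 q) v -> v *m cfb q = 0.
Proof.
by move=> Oq /(memKb _ Oq)/submxP[x ->]; have [_ B] := dual_feb Oq; rewrite -mulmxA B mulmx0.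
Qed.

Lemma KHb_coord q v : O q ->
  sumset (Kb U H 2 q) (conjset (H q)) v <-> v *m cf q = 0 /\ v *m cu q = 0.
Proof.
move=> Oq; split.
  move=> [a [b [/(K_coord _ Oq)[Ha a0] Hb ->]]]; rewrite !mulmxDl a0.
  have [-> _ _ _] := H_coord Oq Ha.
  by have [-> -> _ _] := Hb_coord Oq Hb; rewrite !addr0.
move=> [v1 v2]; rewrite (frame_expand v Oq) v1 v2 !mul0mx add0r addr0.
eexists; eexists; split; last by reflexivity.
  by apply/(memK _ Oq); exact: submxMl.
apply/(memHb _ Oq); rewrite conj_hmat -mul_row_col; exact: submxMl.
Qed.

Lemma Kc_coord q v : O q -> Kc U H q v ->
  [/\ v *m cf q = 0, v *m cfb q = 0 & v *m cu q = 0].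
Proof.
move=> Oq [a [b [/(K_coord _ Oq)[Ha a0] Kb ->]]].
have Hb : conjset (H q) b by exact: K_sub_H.
have [a1 a2 _ _] := H_coord Oq Ha; have [b1 b2 _ _] := Hb_coord Oq Hb.
by rewrite !mulmxDl a0 a1 a2 b1 b2 (Kb_coord Oq Kb) !addr0.
Qed.

Lemma smooth_mdf (X : vfield R m) q : smooth_vf O X -> O q -> mdf X q.
Proof. exact: smooth_vf_mdf. Qed.

Lemma mdf_rows (k : nat) (F : 'I_k -> vfield R m) q :
  (forall a, mdf (F a) q) -> mdf (fun y => \matrix_a F a y) q.
Proof. by move=> dF i j; under eq_fun do rewrite mxE; exact: dF. Qed.

Lemma mdf_col (k l : nat) (A : rvec R m -> 'M[R[i]]_(k, m.+1))
    (B : rvec R m -> 'M[R[i]]_(l, m.+1)) q :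
  mdf A q -> mdf B q -> mdf (fun y => col_mx (A y) (B y)) q.
Proof.
move=> dA dB i j; under eq_fun do rewrite mxE.
by case: (fintype.split i).
Qed.

Lemma mdf_fmat q : O q -> mdf fmat q.
Proof. by move=> Oq; apply: mdf_rows => k; have [sf _] := ad_f ad k; exact: smooth_mdf. Qed.
Lemma mdf_emat q : O q -> mdf emat q.
Proof. by move=> Oq; apply: mdf_rows => k; have [sf _] := ad_e ad k; exact: smooth_mdf. Qed.
Lemma mdf_hmat q : O q -> mdf hmat q.
Proof. by move=> Oq; apply: mdf_col; [exact: mdf_fmat|exact: mdf_emat]. Qed.
Lemma mdf_fullmat q : O q -> mdf fullmat q.
Proof.
move=> Oq; apply: mdf_col; last exact: smooth_mdf (ad_g ad) Oq.
by apply: mdf_col; [exact: mdf_hmat|apply: mdf_conj; exact: mdf_hmat].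
Qed.

Lemma mdf_near (a b : nat) (F G : rvec R m -> 'M[R[i]]_(a, b)) q :
  (\forall y \near q, F y = G y) -> mdf F q -> mdf G q.
Proof.
move=> FG dF i j; have [d1 d2] := dF i j; split.
  by apply: differentiable_ext d1; apply: filterS FG => y ->.
by apply: differentiable_ext d2; apply: filterS FG => y ->.
Qed.

Lemma left_inverse_mul (a b : nat) (A : 'M[R[i]]_(a, b)) (B C : 'M[R[i]]_(b, a)) :
  C *m A = 1%:M -> A *m B \in unitmx -> B *m invmx (A *m B) = C.
Proof.
move=> CA AB; rewrite -[LHS]mul1mx -CA -!mulmxA [A *m (B *m _)]mulmxA.
by rewrite mulmxV // mulmx1.
Qed.

(** With the constant right inverse [dualmat q] of the frame at [q], the square
   matrix [fullmat y *m dualmat q] stays invertible, and its inverse is rational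
   in the entries of [fullmat y]. *)
Lemma mdf_dualmat q : O q -> mdf dualmat q.
Proof.
move=> Oq.
pose N y := fullmat y *m dualmat q.
have N1 : N q = 1%:M by exact: full_dual.
have dN : mdf N q by apply: mdf_mul; [exact: mdf_fullmat|exact: mdf_cst].
have Nu y : O y -> N y \in unitmx.
  move=> Oy; have E1 : N y *m (fullmat q *m dualmat y) = 1%:M.
    by rewrite -mulmxA (mulmxA (dualmat q)) dual_full // mul1mx full_dual.
  by have [Nu _] := mulmx1_unit E1; exact: Nu.
have E y : O y -> dualmat q *m ((\det (N y))^-1 *: \adj (N y)) = dualmat y.
  move=> Oy; have -> : (\det (N y))^-1 *: \adj (N y) = invmx (N y) by rewrite /invmx Nu.
  exact: left_inverse_mul (dual_full Oy) (Nu _ Oy).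
apply: (@mdf_near _ _ (fun y => dualmat q *m ((\det (N y))^-1 *: \adj (N y)))).
  by apply: near_open (nb_open nb) Oq _; exact: E.
apply: mdf_mul; first exact: mdf_cst.
by apply: mdf_inv; [exact: Nu|].
Qed.

Lemma mdf_sub (a b a' b' : nat) (F : rvec R m -> 'M[R[i]]_(a, b))
    (i0 : 'I_a' -> 'I_a) (j0 : 'I_b' -> 'I_b) (G : rvec R m -> 'M[R[i]]_(a', b')) q :
  (forall y i j, G y i j = F y (i0 i) (j0 j)) -> mdf F q -> mdf G q.
Proof. by move=> GF dF i j; under eq_fun do rewrite GF; exact: dF. Qed.

Lemma mdf_lsub (a b b' : nat) (F : rvec R m -> 'M[R[i]]_(a, b + b')) q :
  mdf F q -> mdf (fun y => lsubmx (F y)) q.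
Proof. by apply: (mdf_sub (i0 := id) (j0 := lshift b')) => y i j; rewrite mxE. Qed.
Lemma mdf_rsub (a b b' : nat) (F : rvec R m -> 'M[R[i]]_(a, b + b')) q :
  mdf F q -> mdf (fun y => rsubmx (F y)) q.
Proof. by move=> dF; apply: (@mdf_sub a (b + b') a b' F id (@rshift b b')) dF => y i j; rewrite mxE. Qed.

Lemma mdf_cf q : O q -> mdf cf q.
Proof. by move=> Oq; do 3 apply: mdf_lsub; exact: mdf_dualmat. Qed.
Lemma mdf_ce q : O q -> mdf ce q.
Proof. by move=> Oq; apply: mdf_rsub; do 2 apply: mdf_lsub; exact: mdf_dualmat. Qed.
Lemma mdf_cu q : O q -> mdf cu q.
Proof. by move=> Oq; apply: mdf_rsub; exact: mdf_dualmat. Qed.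

End Coordinates.

(** * The Levi form and the Levi kernel *)

Section Tensoriality.
Variables (R : realType) (m : nat).
Implicit Types (q : rvec R m) (X Y Z : vfield R m).

Lemma lieDl X X' Y q : mdf X q -> mdf X' q ->
  lie (fun y => X y + X' y) Y q = lie X Y q + lie X' Y q.
Proof.
move=> dX dX'; have := cder_mx_linear 1 (X q) (X' q) Y q; rewrite !scale1r => E.
by rewrite /lie (cder_mxD _ dX dX') E opprD addrACA.
Qed.

Lemma cramer_row (k n : nat) (c : 'rV[R[i]]_k) (B : 'M[R[i]]_(k, n)) (Q : 'M[R[i]]_(n, k)) :
  \det (B *m Q) *: (c *m B) = c *m B *m Q *m (\adj (B *m Q) *m B).
Proof.
rewrite -(mulmxA c B Q) [RHS]mulmxA -(mulmxA c (B *m Q)) mul_mx_adj mul_mx_scalar.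
by rewrite scalemxAl.
Qed.

(** Where the rows of [B] are independent, a section of their span is [X *m Q] times the
   rows up to an invertible factor; at a zero of [X] only the derivative of this
   coefficient survives. *)
Lemma vanishing_derivative (k : nat) (B : rvec R m -> 'M[R[i]]_(k, m.+1)) X q v :
  mdf X q -> mdf B q -> row_free (B q) ->
  (\forall y \near q, (X y <= B y)%MS) -> X q = 0 -> (cder_mx v X q <= B q)%MS.
Proof.
move=> dX dB fB XB X0; pose Q := pinvmx (B q); pose N y := B y *m Q.
have N1 : N q = 1%:M by exact: mulmxVp.
have dN : mdf N q by apply: mdf_mul => //; exact: mdf_cst.
have dXQ : mdf (fun y => X y *m Q) q by apply: mdf_mul => //; exact: mdf_cst.
have E : \forall y \near q, \det (N y) *: X y = X y *m Q *m (\adj (N y) *m B y).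
  by apply: filterS XB => y /submxP[c ->]; exact: cramer_row.
have := cder_mx_near v E; rewrite (cder_mxZ _ (Cdiff_det dN) dX) X0 scaler0 add0r.
have dAB : mdf (fun y => \adj (N y) *m B y) q by apply: mdf_mul => //; exact: mdf_adj.
rewrite N1 det1 scale1r => ->.
rewrite (cder_mxM _ dXQ dAB) X0 mul0mx mul0mx addr0 N1 adj1 mul1mx.
exact: submxMl.
Qed.

Lemma lie_vanishing (k : nat) (B : rvec R m -> 'M[R[i]]_(k, m.+1)) X Y q :
  mdf X q -> mdf B q -> row_free (B q) ->
  (\forall y \near q, (X y <= B y)%MS) -> X q = 0 -> (lie X Y q <= B q)%MS.
Proof.
move=> dX dB fB XB X0; rewrite /lie X0 cder_mx0l sub0r eqmx_opp.
exact: vanishing_derivative.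
Qed.

Lemma lie_cong (k : nat) (B : rvec R m -> 'M[R[i]]_(k, m.+1)) X X' Y q :
  mdf X q -> mdf X' q -> mdf B q -> row_free (B q) ->
  (\forall y \near q, (X y <= B y)%MS) -> (\forall y \near q, (X' y <= B y)%MS) ->
  X q = X' q -> (lie X Y q - lie X' Y q <= B q)%MS.
Proof.
move=> dX dX' dB fB XB XB' XX'; rewrite -lieBl //.
apply: lie_vanishing => //; first by apply: mdfD => //; exact: mdfN.
  apply: filterS2 XB XB' => y Xy X'y.
  by rewrite addmx_sub // eqmx_opp.
by rewrite XX' subrr.
Qed.

Lemma conj_rows (k : nat) (F : 'I_k -> vfield R m) y :
  conjm (\matrix_a F a y) = \matrix_a conjvf (F a) y.
Proof. by apply/row_matrixP => a; rewrite rowK; apply/rowP => j; rewrite !mxE. Qed.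

Lemma rows_mul0 (k l : nat) (w : 'I_k -> cvec R m) (A : 'M[R[i]]_(m.+1, l)) :
  (forall a, w a *m A = 0) -> (\matrix_a w a) *m A = 0.
Proof. by move=> wA; apply/row_matrixP => a; rewrite row_mul rowK wA row0. Qed.

Lemma mxE_row (k l : nat) (A : 'M[R[i]]_(k, l)) i j : row i A 0 j = A i j.
Proof. exact: mxE. Qed.

Lemma map_enum1 (T : Type) (f : 'I_1 -> T) : [seq f a | a <- enum 'I_1] = [:: f 0].
Proof. by rewrite enum_ordSl enum_ord0. Qed.

Lemma map_enum2 (T : Type) (f : 'I_2 -> T) :
  [seq f a | a <- enum 'I_2] = [:: f 0; f 1].
Proof.
rewrite !enum_ordSl enum_ord0 /=; congr [:: _; f _]; exact: val_inj.
Qed.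

End Tensoriality.

Lemma mul_inv_cancel (F : fieldType) (c a b : F) : c != 0 -> - (a * - b) = c * (c^-1 * b * a).
Proof. by move=> c0; rewrite mulrN opprK -(mulrA c^-1) mulVKf // mulrC. Qed.

Lemma mulmxD4l (F : pzRingType) (a b c : nat) (A B C D : 'M[F]_(a, b)) (E : 'M[F]_(b, c)) :
  (A + B + (C + D)) *m E = A *m E + B *m E + (C *m E + D *m E).
Proof. by rewrite !mulmxDl. Qed.

Lemma sum4_first (V : nmodType) (a b c d : V) :
  b = 0 -> c = 0 -> d = 0 -> a + b + (c + d) = a.
Proof. by move=> -> -> ->; rewrite !addr0. Qed.

Lemma mulr_signswap (F : comPzRingType) (a b c : F) : a * (b * - c) = b * (- a * c).
Proof. by rewrite mulrN mulrN mulNr mulrN mulrCA. Qed.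

Section LeviForm.
Variables (R : realType) (m s r : nat).
Variables (U : set (rvec R m)) (H : rvec R m -> set (cvec R m)) (O : set (rvec R m)).
Variable phi : frame R m s r.
Hypotheses (nb : CR_nbhd s r U H O) (ad : adapted U H O phi).
Implicit Types (q y : rvec R m) (v : cvec R m) (X Y Z : vfield R m).

Let Hb y := conjset (H y).
Let Kbar y := conjset (Kb U H 2 y).

Lemma conj_section D V X : open V -> section_on D V X ->
  section_on (fun y => conjset (D y)) V (conjvf X).
Proof.
move=> oV [sX DX]; split; first exact: smooth_vf_conj.
by move=> y /DX; rewrite /conjset /= /conjvf conjmK.
Qed.

Lemma conj_sectionK D V X : open V -> section_on (fun y => conjset (D y)) V X ->
  section_on D V (conjvf X).
Proof. by move=> oV [sX DX]; split; [exact: smooth_vf_conj|]. Qed.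

Lemma conjvfK X : conjvf (conjvf X) = X.
Proof. by apply/funext => y; rewrite /conjvf conjmK. Qed.

Lemma sectionS D V V' X : V' `<=` V -> section_on D V X -> section_on D V' X.
Proof. by move=> VV [sX DX]; split; [exact: smooth_vfS sX|move=> y /VV; exact: DX]. Qed.

Lemma Hc_conj q v : Hc H q v -> Hc H q (conjm v).
Proof.
move=> [a [b [Ha Hb' ->]]]; exists (conjm b), (conjm a); split=> //.
  by rewrite /conjset /= conjmK.
by rewrite conjmD addrC.
Qed.

Lemma Hc_scale q c v : c != 0 -> O q -> Hc H q (c *: v) <-> Hc H q v.
Proof.
move=> c0 Oq; rewrite !(Hc_cu nb ad _ Oq) -scalemxAl; split=> [/eqP|->]; last by rewrite scaler0.
by rewrite scaler_eq0 (negbTE c0) => /eqP.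
Qed.

Lemma ii2_neq0 : (2 * 'i%C)^-1 != 0 :> R[i].
Proof.
rewrite invr_eq0 mulf_neq0 ?pnatr_eq0 //; apply/eqP => /(congr1 (fun z : R[i] => z * z)).
by move/eqP; rewrite mul_ii mulr0 oppr_eq0 oner_eq0.
Qed.

Lemma const_full_cu q v : O q -> v *m cu phi q = 0 ->
  v = v *m cf phi q *m fmat phi q + v *m ce phi q *m emat phi q
    + (v *m cfb phi q *m conjm (fmat phi q) + v *m ceb phi q *m conjm (emat phi q)).
Proof. by move=> Oq v0; rewrite {1}(frame_expand nb ad v Oq) v0 mul0mx addr0. Qed.

Lemma lie_K_Hb V X Y q : open V -> V `<=` O -> V q ->
  section_on (Kb U H 2) V X -> section_on Hb V Y -> Hc H q (lie X Y q).
Proof.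
move=> oV VO Vq sX sY; have [_ KX] := sX; have Oq := VO _ Vq.
have [_ /(_ V X (fun=> conjvf Y))] := KX _ Vq; rewrite map_enum1 /= conjvfK.
rewrite (Hc_scale _ ii2_neq0 Oq); apply=> //.
- by split=> //; apply: subset_trans VO (nb_sub nb).
- by split; [exact: sX.1|move=> y /KX []].
- by move=> _; exact: conj_sectionK.
Qed.

Lemma sec_mdf D V X q : section_on D V X -> V q -> mdf X q.
Proof. by move=> [sX _]; exact: smooth_vf_mdf. Qed.

Lemma lie_Hb_Hb V X Y q : open V -> V `<=` O -> V q ->
  section_on Hb V X -> section_on Hb V Y -> Hb q (lie X Y q).
Proof.
move=> oV VO Vq sX sY; rewrite /Hb /conjset /= -lie_conj; last 2 first.
  exact: sec_mdf sX Vq.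
  exact: sec_mdf sY Vq.
by have [_] := nb_inv nb oV VO (conj_sectionK oV sX) (conj_sectionK oV sY); exact.
Qed.

Lemma lie_H_Kb V X Y q : open V -> V `<=` O -> V q ->
  section_on H V X -> section_on Kbar V Y -> Hc H q (lie X Y q).
Proof.
move=> oV VO Vq sX sY; have Oq := VO _ Vq.
rewrite lieN -scaleN1r (Hc_scale _ _ Oq) ?oppr_eq0 ?oner_eq0 //.
rewrite -[lie Y X q]conjmK; apply: Hc_conj.
rewrite -lie_conj; [|exact: sec_mdf sY Vq|exact: sec_mdf sX Vq].
exact: lie_K_Hb (conj_sectionK oV sY) (conj_section oV sX).
Qed.

Lemma f_section V k : V `<=` O -> section_on H V (ff phi k).
Proof. by move=> VO; exact: sectionS (ad_f ad k). Qed.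
Lemma e_section V a : V `<=` O -> section_on (Kb U H 2) V (fe phi a).
Proof. by move=> VO; exact: sectionS (ad_e ad a). Qed.
Lemma fb_section V k : open V -> V `<=` O -> section_on Hb V (conjvf (ff phi k)).
Proof. by move=> oV VO; apply: conj_section => //; exact: f_section. Qed.
Lemma eb_section V a : open V -> V `<=` O -> section_on Kbar V (conjvf (fe phi a)).
Proof. by move=> oV VO; apply: conj_section => //; exact: e_section. Qed.
Lemma Kbar_Hb V X : section_on Kbar V X -> section_on Hb V X.
Proof. by move=> [sX KX]; split=> // y /KX; case. Qed.

Definition HHb q := col_mx (hmat phi q) (conjm (hmat phi q)).

Lemma HHb_free q : O q -> row_free (HHb q).
Proof.
move=> Oq; apply: inj_row_free => x x0.
have : row_mx x (0 : 'rV_1) *m fullmat phi q = 0 *m fullmat phi q.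
  by rewrite mul_row_col x0 !mul0mx addr0.
by move/(row_free_inj (fullmat_free nb ad Oq)); rewrite -row_mx0 => /eq_row_mx[].
Qed.

Lemma mdf_HHb q : O q -> mdf HHb q.
Proof.
by move=> Oq; apply: mdf_col; [exact: (mdf_hmat ad)|apply: mdf_conj; exact: (mdf_hmat ad)].
Qed.

Lemma HHb_cu q v : O q -> (v <= HHb q)%MS -> v *m cu phi q = 0.
Proof. by move=> Oq /(memHc ad _ Oq) /(Hc_cu nb ad _ Oq). Qed.

Lemma hbmat_free q : O q -> row_free (conjm (hmat phi q)).
Proof. by move=> Oq; rewrite row_free_map; have [_] := ad_fbasis ad Oq. Qed.

Lemma ematfree q : O q -> row_free (emat phi q).
Proof. by move=> Oq; have [_] := ad_ebasis ad Oq. Qed.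

(** The values at [q] of the brackets of sections only matter, up to sections of
   a subbundle: a section can be replaced by the combination of the frame with
   constant coefficients that has the same value at [q]. *)
Definition const_H q v y := v *m cf phi q *m fmat phi y + v *m ce phi q *m emat phi y.
Definition const_Hb q v y :=
  v *m cfb phi q *m conjm (fmat phi y) + v *m ceb phi q *m conjm (emat phi y).

Lemma mdf_const_H q v : O q -> mdf (const_H q v) q.
Proof.
by move=> Oq; apply: mdfD; apply: mdf_mul; (try exact: mdf_cst);
  [exact: (mdf_fmat ad)|exact: (mdf_emat ad)].
Qed.
Lemma mdf_const_Hb q v : O q -> mdf (const_Hb q v) q.
Proof.
by move=> Oq; apply: mdfD; apply: mdf_mul; (try exact: mdf_cst); apply: mdf_conj;
  [exact: (mdf_fmat ad)|exact: (mdf_emat ad)].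
Qed.

(** The coordinates of [const_H] are frozen, so bracketing is linear in the frame. *)
Lemma lie_const_H q v Y : O q -> lie (const_H q v) Y q =
  v *m cf phi q *m (\matrix_k lie (ff phi k) Y q)
  + v *m ce phi q *m (\matrix_a lie (fe phi a) Y q).
Proof.
move=> Oq; have df k : mdf (ff phi k) q by exact: sec_mdf (ad_f ad k) Oq.
have de a : mdf (fe phi a) q by exact: sec_mdf (ad_e ad a) Oq.
have dF : mdf (fun y => v *m cf phi q *m (\matrix_k ff phi k y)) q.
  by apply: mdf_mul; [exact: mdf_cst|exact: (mdf_fmat ad)].
have dE : mdf (fun y => v *m ce phi q *m (\matrix_k fe phi k y)) q.
  by apply: mdf_mul; [exact: mdf_cst|exact: (mdf_emat ad)].
by rewrite [LHS](lieDl Y dF dE) (lie_comb _ _ df) (lie_comb _ _ de).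
Qed.

Lemma lie_const_Hb q v Y : O q -> lie (const_Hb q v) Y q =
  v *m cfb phi q *m (\matrix_k lie (conjvf (ff phi k)) Y q)
  + v *m ceb phi q *m (\matrix_a lie (conjvf (fe phi a)) Y q).
Proof.
move=> Oq; have df k : mdf (conjvf (ff phi k)) q.
  by apply: mdf_conj; exact: sec_mdf (ad_f ad k) Oq.
have de a : mdf (conjvf (fe phi a)) q by apply: mdf_conj; exact: sec_mdf (ad_e ad a) Oq.
have dF : mdf (fun y => v *m cfb phi q *m (\matrix_k conjvf (ff phi k) y)) q.
  by apply: mdf_mul; [exact: mdf_cst|exact: mdf_rows].
have dE : mdf (fun y => v *m ceb phi q *m (\matrix_k conjvf (fe phi k) y)) q.
  by apply: mdf_mul; [exact: mdf_cst|exact: mdf_rows].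
have -> : const_Hb q v = fun y => v *m cfb phi q *m (\matrix_k conjvf (ff phi k) y)
    + v *m ceb phi q *m (\matrix_k conjvf (fe phi k) y).
  by apply/funext => y; rewrite /const_Hb /fmat /emat !conj_rows.
by rewrite (lieDl Y dF dE) (lie_comb _ _ df) (lie_comb _ _ de).
Qed.

Lemma const_Hb_sub q v y : (const_Hb q v y <= conjm (hmat phi y))%MS.
Proof. by rewrite /const_Hb conj_hmat -mul_row_col submxMl. Qed.
Lemma const_H_sub q v y : (const_H q v y <= hmat phi y)%MS.
Proof. by rewrite /const_H /hmat -mul_row_col submxMl. Qed.

Lemma lie_Hb_const V Y Z q : open V -> V `<=` O -> V q -> section_on Hb V Y ->
  (lie Y Z q - lie (const_Hb q (Y q)) Z q <= conjm (hmat phi q))%MS.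
Proof.
move=> oV VO Vq sY; have Oq := VO _ Vq.
apply: (lie_cong (B := fun y => conjm (hmat phi y))).
- exact: sec_mdf sY Vq.
- exact: mdf_const_Hb.
- by apply: mdf_conj; exact: (mdf_hmat ad).
- exact: hbmat_free.
- apply: near_open oV Vq _ => y Vy; apply/(memHb ad _ (VO _ Vy)); exact: sY.2.
- by apply: filterE => y; exact: const_Hb_sub.
- by have [_ _ _] := Hb_coord nb ad Oq (sY.2 _ Vq).
Qed.

(** The Levi form in the frame [f], measured along [g]; it is the matrix of the values
   on conjugates of the symbol isomorphism of the frame. *)
Definition levi q : 'M[R[i]]_s :=
  \matrix_(k, j) ((2 * 'i%C)^-1 * (lie (ff phi k) (conjvf (ff phi j)) q *m cu phi q) 0 0).

Lemma levi_f V Y q k : open V -> V `<=` O -> V q -> section_on Hb V Y ->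
  lie (ff phi k) Y q *m cu phi q =
  (2 * 'i%C) *: (row k (levi q) *m (Y q *m cfb phi q)^T).
Proof.
move=> oV VO Vq sY; have Oq := VO _ Vq; have sf := f_section k VO.
have := lie_Hb_const (ff phi k) oV VO Vq sY => D.
have D0 : (lie Y (ff phi k) q - lie (const_Hb q (Y q)) (ff phi k) q) *m cu phi q = 0.
  by apply/HHb_cu => //; rewrite /HHb -addsmxE; apply: submx_trans D (addsmxSr _ _).
move: D0; rewrite mulmxBl => /eqP; rewrite subr_eq0 => /eqP D0.
rewrite lieN mulNmx D0 (lie_const_Hb _ _ Oq) mulmxDl -!mulmxA.
rewrite (rows_mul0 (w := fun a => lie (conjvf (fe phi a)) (ff phi k) q)); last first.
  move=> a; rewrite lieN mulNmx.
  by have /(Hc_cu nb ad _ Oq) -> := lie_H_Kb oV VO Vq sf (eb_section a oV VO); rewrite oppr0.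
rewrite !mulmx0 addr0; apply/rowP => z; rewrite ord1 [LHS]mxE [RHS]mxE mulmxA.
rewrite mxE [X in _ = _ * X]mxE mulr_sumr -sumrN; apply: eq_bigr => j _.
have -> : ((\matrix_k0 lie (conjvf (ff phi k0)) (ff phi k) q) *m cu phi q) j 0 =
   - (lie (ff phi k) (conjvf (ff phi j)) q *m cu phi q) 0 0.
  rewrite -mxE_row row_mul rowK lieN mulNmx.
  by rewrite [LHS]mxE.
rewrite [row k _ _ _]mxE [levi q _ _]mxE [(_^T) _ _]mxE.
by apply: mul_inv_cancel; rewrite -invr_eq0 ii2_neq0.
Qed.

Opaque lie.

(** Tensoriality of the Levi form, for fields with values in [Hc]: the parts of the
   field in the Levi kernel and in the conjugate bundle have brackets in [Hc]. *)
Lemma levi_tensor V Z Y q : open V -> V `<=` O -> V q -> mdf Z q ->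
  (forall y, V y -> Hc H y (Z y)) -> section_on Hb V Y ->
  lie Z Y q *m cu phi q =
  (2 * 'i%C) *: (Z q *m cf phi q *m levi q *m (Y q *m cfb phi q)^T).
Proof.
move=> oV VO Vq dZ HZ sY; have Oq := VO _ Vq.
pose Z' : vfield R m := fun y => const_H q (Z q) y + const_Hb q (Z q) y.
have dZ' : mdf Z' q by apply: mdfD; [exact: mdf_const_H|exact: mdf_const_Hb].
have ZZ' : Z q = Z' q by apply: const_full_cu => //; apply/(Hc_cu nb ad _ Oq); exact: HZ.
have D : (lie Z Y q - lie Z' Y q <= HHb q)%MS.
  apply: lie_cong => //; [exact: mdf_HHb|exact: HHb_free| |].
    by apply: near_open oV Vq _ => y Vy; apply/(memHc ad _ (VO _ Vy)); exact: HZ.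
  apply: filterE => y; rewrite /HHb -addsmxE.
  by apply: addmx_sub_adds; [exact: const_H_sub|exact: const_Hb_sub].
have := HHb_cu Oq D; rewrite mulmxBl => /eqP; rewrite subr_eq0 => /eqP ->.
have kill (k : nat) (w : 'I_k -> cvec R m) (c : 'rV_k) :
    (forall a, Hc H q (w a)) -> c *m (\matrix_a w a) *m cu phi q = 0.
  by move=> Hw; rewrite -mulmxA rows_mul0 ?mulmx0 // => a; apply/(Hc_cu nb ad _ Oq).
have HbHc v : Hb q v -> Hc H q v.
  by move=> /(Hb_coord nb ad Oq)[v0 _ _ _]; apply/(Hc_cu nb ad _ Oq).
have dH := @mdf_const_H q (Z q) Oq; have dHb := @mdf_const_Hb q (Z q) Oq.
have -> : lie Z' Y q = lie (const_H q (Z q)) Y q + lie (const_Hb q (Z q)) Y q.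
  exact: (lieDl Y dH dHb).
rewrite (lie_const_H _ _ Oq) (lie_const_Hb _ _ Oq) mulmxD4l.
rewrite sum4_first.
- have E : (\matrix_k lie (ff phi k) Y q) *m cu phi q =
           (2 * 'i%C) *: (levi q *m (Y q *m cfb phi q)^T).
    apply/row_matrixP => k; rewrite row_mul rowK (levi_f k oV VO Vq sY) linearZ /=.
    by rewrite row_mul.
  by rewrite -[LHS]mulmxA E -scalemxAr mulmxA.
- by apply: kill => a; exact: lie_K_Hb (e_section a VO) sY.
- by apply: kill => a; apply: HbHc; exact: lie_Hb_Hb (fb_section a oV VO) sY.
- by apply: kill => a; apply: HbHc; exact: lie_Hb_Hb (Kbar_Hb (eb_section a oV VO)) sY.
Qed.

(** A vector annihilated by the Levi form of [H/K_2] would lie in [K_2], which has no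
   part along [f]. *)
Lemma levi_unit q : O q -> levi q \in unitmx.
Proof.
move=> Oq; rewrite -row_free_unit; apply: inj_row_free => x x0.
have [Ff Fe] := dual_fe nb ad Oq; set v := x *m fmat phi q.
have Hv : H q v.
  apply/(memH ad _ Oq); have -> : v = row_mx x 0 *m hmat phi q.
    by rewrite /hmat mul_row_col mul0mx addr0.
  exact: submxMl.
have Kv : Kb U H 2 q v.
  split=> //= O' V Xs [oO' O'U O'q] sV Vv sX; rewrite map_enum1 /=.
  have oV : open (O' `&` O) by apply: openI => //; exact: nb_open nb.
  have Vq : (O' `&` O) q by [].
  apply/(Hc_scale _ ii2_neq0 Oq).
  apply/(Hc_cu nb ad _ Oq).
  have sV' : section_on H (O' `&` O) V by apply: sectionS sV => y [].
  have sX' : section_on Hb (O' `&` O) (conjvf (Xs 0)).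
    by apply: conj_section => //; apply: sectionS (sX 0) => y [].
  rewrite (levi_tensor oV _ Vq (sec_mdf sV' Vq) _ sX').
  - by rewrite Vv /v -!mulmxA (mulmxA (fmat phi q)) Ff mul1mx mulmxA x0 mul0mx scaler0.
  - by move=> y [].
  - move=> y [yO' Oy]; apply/(Hc_cu nb ad _ Oy).
    by have [] := H_coord nb ad Oy (sV.2 _ yO').
have [_] := (K_coord nb ad _ Oq).1 Kv.
by rewrite /v -mulmxA Ff mulmx1.
Qed.

(** The factor by which complex conjugation differs from the conjugation of the
   last coordinate. *)
Definition twist q : R[i] := (conjm (fg phi q) *m cu phi q) 0 0.

Lemma conj_cu q v : O q ->
  (conjm v *m cu phi q) 0 0 = twist q * conjc ((v *m cu phi q) 0 0).
Proof.
move=> Oq; have Hh : Hc H q (v - v *m cu phi q *m fg phi q).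
  apply/(Hc_cu nb ad _ Oq); have [_ _ [_ gu]] := dual_rels nb ad Oq.
  by rewrite mulmxBl -(mulmxA (v *m _)) gu mulmx1 subrr.
have := (Hc_cu nb ad _ Oq).1 (Hc_conj Hh); rewrite conjmB mulmxBl => /eqP.
rewrite subr_eq0 => /eqP ->.
by rewrite [v *m cu phi q]mx11_scalar mul_scalar_mx conjmZ -scalemxAl mxE mulrC [in RHS]mxE eqxx mulr1n.
Qed.

Lemma twist_unit q : O q -> twist q * conjc (twist q) = 1.
Proof.
move=> Oq; rewrite -(conj_cu _ Oq) conjmK.
by have [_ _ [_ ->]] := dual_rels nb ad Oq; rewrite mxE.
Qed.

Lemma leviE q k j : levi q k j =
  (2 * 'i%C)^-1 * (lie (ff phi k) (conjvf (ff phi j)) q *m cu phi q) 0 0.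
Proof. by rewrite mxE. Qed.

Lemma conj_2ii : conjc (2 * 'i%C)^-1 = - (2 * 'i%C)^-1 :> R[i].
Proof.
rewrite -invrN; have -> : - (2 * 'i%C) = conjc (2 * 'i%C) :> R[i].
  rewrite rmorphM rmorph_nat -mulrN; apply: (congr1 ( *%R _)).
  by apply/eqP; rewrite eq_complex /= oppr0 !eqxx.
exact: fmorphV.
Qed.

(** The Levi form is Hermitian up to the factor [twist], because the bracket of two
   real fields is real whereas [fg phi] need not be. *)
Lemma levi_hermitian q : O q -> levi q = twist q *: (conjm (levi q))^T.
Proof.
move=> Oq; apply/matrixP => k j.
rewrite [RHS]mxE [X in _ * X]mxE conjmE !leviE.
have dk : mdf (ff phi k) q by exact: sec_mdf (ad_f ad k) Oq.
have dj : mdf (ff phi j) q by exact: sec_mdf (ad_f ad j) Oq.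
have -> : lie (ff phi k) (conjvf (ff phi j)) q =
          conjm (- lie (ff phi j) (conjvf (ff phi k)) q).
  by rewrite -lieN -lie_conj ?conjvfK //; exact: mdf_conj.
rewrite (conj_cu _ Oq) mulNmx [in LHS]mxE.
move: ((lie (ff phi j) _ q *m _) 0 0) => w.
have -> : conjc (- w) = - conjc w by exact: rmorphN.
have -> : conjc ((2 * 'i%C)^-1 * w) = - (2 * 'i%C)^-1 * conjc w.
  by rewrite -conj_2ii; exact: (rmorphM (@conjc R)).
exact: mulr_signswap.
Qed.

End LeviForm.

(** * The maps iota and the third kernel *)

Section Iota.
Variables (R : realType) (m s r : nat).
Variables (U : set (rvec R m)) (H : rvec R m -> set (cvec R m)) (O : set (rvec R m)).
Variable phi : frame R m s r.
Hypotheses (nb : CR_nbhd s r U H O) (ad : adapted U H O phi).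
Implicit Types (q y : rvec R m) (v : cvec R m) (X Y Z : vfield R m).

Let Hb y := conjset (H y).

(** The transpose appears because the columns of the matrices Xi are the images of the
   conjugates of [f]. *)
Definition xi (a : 'I_r) q : 'M[R[i]]_s :=
  (\matrix_k (lie (fe phi a) (conjvf (ff phi k)) q *m cf phi q))^T.

Lemma Kb_section_Kc V X : V `<=` O -> section_on (Kb U H 2) V X ->
  section_on (Kc U H) V X /\ (open V -> section_on (Kc U H) V (conjvf X)).
Proof.
move=> VO [sX KX]; have K0 y : V y -> Kb U H 2 y 0.
  by move=> /VO Oy; apply/(memK ad _ Oy); exact: sub0mx.
split; first split=> // y Vy.
  exists (X y), 0; split; [exact: KX| |by rewrite addr0].
  by rewrite /conjset /= conjm0; exact: K0.
move=> oV; split=> [|y Vy]; first exact: smooth_vf_conj.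
exists 0, (conjvf X y); split; [exact: K0| |by rewrite add0r].
by rewrite /conjset /= /conjvf conjmK; exact: KX.
Qed.

Lemma comb_mul (k l : nat) (c : 'rV[R[i]]_k) (w : 'I_k -> cvec R m) (A : 'M[R[i]]_(m.+1, l)) :
  c *m (\matrix_a w a) *m A = \sum_a c 0 a *: (w a *m A).
Proof. by rewrite comb_sum mulmx_suml; apply: eq_bigr => a _; rewrite scalemxAl. Qed.

Lemma iota_e V Y q a : open V -> V `<=` O -> V q -> section_on Hb V Y ->
  lie (fe phi a) Y q *m cf phi q = Y q *m cfb phi q *m (xi a q)^T.
Proof.
move=> oV VO Vq sY; have Oq := VO _ Vq; have se := e_section ad a VO.
have D0 : (lie Y (fe phi a) q - lie (const_Hb phi q (Y q)) (fe phi a) q) *m cf phi q = 0.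
  have D := lie_Hb_const nb ad (fe phi a) oV VO Vq sY.
  by have [_ -> _ _] := Hb_coord nb ad Oq ((memHb ad _ Oq).2 D).
move: D0; rewrite mulmxBl => /eqP; rewrite subr_eq0 => /eqP D0.
have E : lie (const_Hb phi q (Y q)) (fe phi a) q *m cf phi q =
    Y q *m cfb phi q *m (\matrix_k lie (conjvf (ff phi k)) (fe phi a) q) *m cf phi q.
  rewrite (lie_const_Hb ad _ _ Oq) [LHS]mulmxDl.
  rewrite -[X in _ + X]mulmxA (rows_mul0 (w := fun b => lie (conjvf (fe phi b)) (fe phi a) q)).
    by rewrite mulmx0 addr0.
  move=> b; have [sb _] := Kb_section_Kc VO se.
  have [_ /(_ oV) sbb] := Kb_section_Kc VO (e_section ad b VO).
  by have [] := Kc_coord nb ad Oq (nb_kc nb oV VO sbb sb Vq).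
rewrite lieN mulNmx D0 E -[X in - X]mulmxA -mulmxN; apply: (congr1 (mulmx _)).
rewrite /xi trmxK; apply/row_matrixP => k.
by rewrite linearN /= row_mul !rowK -mulNmx -lieN.
Qed.

Definition xi_comb (c : 'rV[R[i]]_r) q := \sum_a c 0 a *: xi a q.

(** Only brackets of [e] with the conjugates of [f] contribute: those with the
   conjugates of [e] have no part in [H/K_2], because [Kc] is involutive. *)
Lemma iota_tensor V X Y q : open V -> V `<=` O -> V q ->
  section_on (Kb U H 2) V X -> section_on Hb V Y ->
  lie X Y q *m cf phi q =
  Y q *m cfb phi q *m (xi_comb (X q *m ce phi q) q)^T.
Proof.
move=> oV VO Vq sX sY; have Oq := VO _ Vq.
pose X' : vfield R m := fun y => X q *m ce phi q *m (\matrix_a fe phi a y).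
have KX : Kb U H 2 q (X q) by exact: sX.2.
have XX' : X q = X' q.
  have [_ _ _] := H_coord nb ad Oq (K_sub_H KX); have [_ ->] := (K_coord nb ad _ Oq).1 KX.
  by rewrite mul0mx add0r.
have dX' : mdf X' q by apply: mdf_mul; [exact: mdf_cst|exact: (mdf_emat ad)].
have D : (lie X Y q - lie X' Y q <= emat phi q)%MS.
  apply: lie_cong => //.
  - exact: sec_mdf sX Vq.
  - exact: (mdf_emat ad).
  - exact: (ematfree ad).
  - by apply: near_open oV Vq _ => y Vy; apply/(memK ad _ (VO _ Vy)); exact: sX.2.
  - by apply: filterE => y; exact: submxMl.
have [_] := (K_coord nb ad _ Oq).1 ((memK ad _ Oq).2 D).
rewrite mulmxBl => /eqP; rewrite subr_eq0 => /eqP ->.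
have de a : mdf (fe phi a) q by exact: sec_mdf (ad_e ad a) Oq.
have -> : lie X' Y q = X q *m ce phi q *m \matrix_a lie (fe phi a) Y q by exact: lie_comb.
rewrite comb_mul /xi_comb linear_sum mulmx_sumr; apply: eq_bigr => a _.
by rewrite (iota_e a oV VO Vq sY) linearZ /= scalemxAr.
Qed.

Lemma sub_levi0 q (x : 'rV[R[i]]_s) : O q ->
  (forall j : 'I_s, x *m levi phi q *m (delta_mx 0 j : 'rV_s)^T = 0) -> x = 0.
Proof.
move=> Oq x0; have E : x *m levi phi q = 0.
  apply/rowP => j; have /rowP/(_ 0) := x0 j.
  by rewrite trmx_delta -colE !mxE.
by rewrite -[x](mulmxK (levi_unit nb ad Oq)) E mul0mx.
Qed.

(** The second bracket in the definition of [K_3] is a Levi form evaluated on the part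
   of the first one in [H/K_2], and the Levi form is nondegenerate there. *)
Lemma K3_iota q v : O q ->
  Kb U H 3 q v <-> Kb U H 2 q v /\ xi_comb (v *m ce phi q) q = 0.
Proof.
move=> Oq; have oO := nb_open nb.
have nbO : subnbhd U q O by split=> //; exact: nb_sub nb.
have [Ffb _] := dual_feb nb ad Oq.
have fbq k : conjvf (ff phi k) q *m cfb phi q = delta_mx 0 k.
  have -> : conjvf (ff phi k) q = row k (conjm (fmat phi q)).
    by rewrite /conjvf -(row_fmat phi q k) /conjm map_row.
  by rewrite -row_mul Ffb row1.
split.
- move=> Kv; have Kv2 : Kb U H 2 q v by case: Kv.
  split=> //; case: Kv => _ Kv.
  pose V : vfield R m := fun y => v *m ce phi q *m (\matrix_a fe phi a y).
  have sV : section_on (Kb U H 2) O V.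
    split; first by apply: smooth_vf_comb => // a; have [] := ad_e ad a.
    by move=> y Oy; apply/(memK ad _ Oy); exact: submxMl.
  have Vq : V q = v.
    have [_ _ _] := H_coord nb ad Oq (K_sub_H Kv2).
    by have [_ ->] := (K_coord nb ad _ Oq).1 Kv2; rewrite mul0mx add0r => /esym.
  have zero k : lie V (conjvf (ff phi k)) q *m cf phi q = 0.
    apply: (sub_levi0 Oq) => j.
    pose Xs (b : 'I_2) := if b == 0 then ff phi k else ff phi j.
    have /(_ O V Xs nbO sV Vq) := Kv; rewrite map_enum2 /=.
    rewrite (Hc_scale nb ad _ (ii2_neq0 R) Oq) => HZ.
    have {}HZ : Hc H q (lie (lie V (conjvf (ff phi k))) (conjvf (ff phi j)) q).
      by apply: HZ => b; rewrite /Xs; case: ifP => _; exact: ad_f ad _.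
    move/(Hc_cu nb ad _ Oq): HZ.
    rewrite (levi_tensor nb ad oO _ Oq _ _ (fb_section ad j oO _)) //; last first.
    + move=> y Oy; exact: (lie_K_Hb nb ad oO _ Oy sV (fb_section ad k oO _)).
    + by apply: (mdf_lie (U := O)); [exact: sV.1|exact: (fb_section ad k oO _).1|].
    rewrite fbq => /eqP; rewrite scaler_eq0 -invr_eq0 (negbTE (ii2_neq0 R)) /=.
    by move/eqP.
  apply: trmx_inj; rewrite trmx0; apply/row_matrixP => k; rewrite row0 rowE -(fbq k).
  have := zero k; rewrite (iota_tensor oO _ Oq sV (fb_section ad k oO _)) //.
  by rewrite Vq.
- move=> [Kv x0]; split=> // O' V Xs [oO' O'U O'q] sV Vv sX; rewrite map_enum2 /=.
  apply/(Hc_scale nb ad _ (ii2_neq0 R) Oq)/(Hc_cu nb ad _ Oq).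
  have oV : open (O' `&` O) by exact: openI.
  have VO : (O' `&` O) `<=` O by move=> y [].
  have Vq : (O' `&` O) q by [].
  have sV' : section_on (Kb U H 2) (O' `&` O) V by apply: sectionS sV => y [].
  have sX' b : section_on Hb (O' `&` O) (conjvf (Xs b)).
    by apply: conj_section => //; apply: sectionS (sX b) => y [].
  rewrite (levi_tensor nb ad oV VO Vq _ _ (sX' 1)).
  + rewrite (iota_tensor oV VO Vq sV' (sX' 0)) Vv x0 trmx0 !mulmx0 !mul0mx.
    by rewrite scaler0.
  + by apply: (mdf_lie _ _ Vq); [exact: sV'.1|exact: (sX' 0).1].
  + by move=> y Vy; exact: (lie_K_Hb nb ad oV VO Vy sV' (sX' 0)).
Qed.

End Iota.

(** * Families of constant rank *)

Section ConstantRank.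
Variables (R : realType) (m : nat).
Implicit Types (q : rvec R m).

Lemma Cdiff_near_neq0 (f : rvec R m -> R[i]) q : Cdiff f q -> f q = 1 ->
  \forall y \near q, f y != 0.
Proof.
move=> [df _] fq; have c : {for q, continuous (fun y => complex.Re (f y))}.
  exact: differentiable_continuous.
have n1 : \forall y \near q, 0 < complex.Re (f y).
  by apply: (cvgr_gt (complex.Re (f q)) c); rewrite fq.
apply: filterS n1 => y; apply: contraTneq => ->.
by rewrite ltxx.
Qed.

(** The Schur complement formula: if the rank of [A] is at most the size of an
   invertible compression [X *m A *m Y], then the bordered determinant vanishes.
   Multiplying by the determinant avoids inverses, so that both sides are
   differentiable expressions. *)
Lemma schur_rank (k n t : nat) (A : 'M[R[i]]_(k, n)) (X : 'M[R[i]]_(t, k))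
    (Y : 'M[R[i]]_(n, t)) (c : 'rV_k) (d : 'cV_n) :
  X *m A *m Y \in unitmx -> (\rank A <= t)%N ->
  \det (X *m A *m Y) *: (c *m A *m d) =
  c *m A *m Y *m (\adj (X *m A *m Y) *m (X *m A *m d)).
Proof.
move=> Eu rA; set E := X *m A *m Y in Eu *.
pose M : 'M[R[i]]_(t + 1) := block_mx E (X *m A *m d) (c *m A *m Y) (c *m A *m d).
have M0 : \det M = 0.
  apply/eqP; apply: contraT; rewrite -unitfE -unitmxE -row_free_unit /row_free => /eqP rM.
  have EM : M = col_mx X c *m A *m row_mx Y d by rewrite mul_col_mx mul_col_row.
  have : (\rank M <= \rank A)%N.
    by rewrite EM; apply: leq_trans (mxrankM_maxl _ _) (mxrankM_maxr _ _).
  by rewrite rM addn1 ltnNge => /negP[].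
pose P : 'M[R[i]]_(t + 1) := block_mx 1%:M 0 (- (c *m A *m Y *m invmx E)) 1%:M.
have EP : P *m M = block_mx E (X *m A *m d) 0 (c *m A *m d - c *m A *m Y *m invmx E *m (X *m A *m d)).
  rewrite mulmx_block !mul1mx !mul0mx !addr0 !mulNmx.
  by rewrite -[c *m A *m Y *m invmx E *m E]mulmxA mulVmx // mulmx1 addNr addrC.
have := det_mulmx P M; rewrite M0 mulr0 EP det_ublock => /eqP.
rewrite mulf_eq0 -[\det E == 0]negbK -unitfE -unitmxE Eu /= => /eqP dz.
have {dz} : c *m A *m d - c *m A *m Y *m invmx E *m (X *m A *m d) = 0.
  by rewrite [LHS]mx11_scalar -det_mx11 dz raddf0.
move/eqP; rewrite subr_eq0 => /eqP ->.
rewrite /invmx Eu -scalemxAr -!scalemxAl scalerA mulrV ?scale1r -?mulmxA //.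
Qed.

(** Vectors in the left kernel of [F q] extend to the left kernels nearby when the rank
   does not increase. Differentiating the Schur complement identity at [q] replaces
   this extension: for [d] in the right kernel of [F q], both factors on the right
   vanish at [q]. *)
Lemma constant_rank_derivative (k n : nat) (F : rvec R m -> 'M[R[i]]_(k, n)) q v
    (c : 'rV_k) : mdf F q ->
  (\forall y \near q, (\rank (F y) <= \rank (F q))%N) -> c *m F q = 0 ->
  (c *m cder_mx v F q <= F q)%MS.
Proof.
move=> dF rF c0.
pose X := pinvmx (col_base (F q)); pose Y := pinvmx (row_base (F q)).
pose E y := X *m F y *m Y.
have E1 : E q = 1%:M.
  have := congr1 (mulmx X) (mulmx_base (F q)).
  rewrite mulmxA mulVpmx ?col_base_full // mul1mx /E => <-.
  by rewrite mulmxVp // row_base_free.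
have dcst (a b : nat) (P : 'M[R[i]]_(a, k)) (Q : 'M[R[i]]_(n, b)) : mdf (fun y => P *m F y *m Q) q.
  by apply: mdf_mul; [apply: mdf_mul => //; exact: mdf_cst|exact: mdf_cst].
have dE : mdf E q by exact: dcst.
have dcst_val (a b : nat) (P : 'M[R[i]]_(a, k)) (Q : 'M[R[i]]_(n, b)) :
    cder_mx v (fun y => P *m F y *m Q) q = P *m cder_mx v F q *m Q.
  rewrite (cder_mxM _ (mdf_mul (mdf_cst P q) dF) (mdf_cst Q q)).
  rewrite (cder_mxM _ (mdf_cst P q) dF) !cder_mx_cst mul0mx add0r.
  by rewrite mulmx0 addr0.
have Eu : \forall y \near q, E y \in unitmx.
  have detE1 : \det (E q) = 1 by rewrite E1 det1.
  apply: filterS (Cdiff_near_neq0 (Cdiff_det dE) detE1) => y.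
  by rewrite unitmxE unitfE.
have key (d : 'cV_n) : F q *m d = 0 -> c *m cder_mx v F q *m d = 0.
  move=> d0.
  have id : \forall y \near q, \det (E y) *: (c *m F y *m d) =
      c *m F y *m Y *m (\adj (E y) *m (X *m F y *m d)).
    by apply: filterS2 Eu rF => y; exact: schur_rank.
  have dN : mdf (fun y => c *m F y *m d) q by exact: dcst.
  have dA : mdf (fun y => c *m F y *m Y) q by exact: dcst.
  have dB : mdf (fun y => X *m F y *m d) q by exact: dcst.
  have dAB : mdf (fun y => \adj (E y) *m (X *m F y *m d)) q.
    by apply: mdf_mul => //; exact: mdf_adj.
  have := cder_mx_near v id.
  rewrite (cder_mxZ v (Cdiff_det dE) dN) (cder_mxM v dA dAB) E1 det1 scale1r.
  rewrite c0 !mul0mx scaler0 add0r addr0 dcst_val => ->.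
  by rewrite -(mulmxA X) d0 !mulmx0.
rewrite submxE; apply/eqP/matrixP => i j; rewrite [RHS]mxE.
have := key (col j (cokermx (F q))); rewrite colE mulmxA mulmx_coker mul0mx => /(_ erefl).
by rewrite mulmxA -colE => /colP/(_ i); rewrite mxE [in X in _ = X]mxE.
Qed.

End ConstantRank.

Section IotaRank.
Variables (R : realType) (m s r : nat).
Variables (U : set (rvec R m)) (H : rvec R m -> set (cvec R m)) (O : set (rvec R m)).
Variable phi : frame R m s r.
Hypotheses (nb : CR_nbhd s r U H O) (ad : adapted U H O phi).
Implicit Types (q y : rvec R m) (v : cvec R m).

(** The family [xi] as a single matrix, so that its rank can be spoken of. *)
Definition ximat q : 'M[R[i]]_(r, s * s) := \matrix_a mxvec (xi phi a q).

Lemma mdf_xi q a : O q -> mdf (xi phi a) q.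
Proof.
move=> Oq; apply: mdf_tr => k l; under eq_fun do rewrite mxE.
have dl : mdf (lie (fe phi a) (conjvf (ff phi k))) q.
  apply: (mdf_lie (U := O)) => //; first by have [] := ad_e ad a.
  by apply: smooth_vf_conj; [exact: nb_open nb|have [] := ad_f ad k].
by have := mdf_mul dl (mdf_cf nb ad Oq); apply.
Qed.

Lemma mdf_levi q : O q -> mdf (levi phi) q.
Proof.
move=> Oq k j; under eq_fun do rewrite mxE.
have dl : mdf (lie (ff phi k) (conjvf (ff phi j))) q.
  apply: (mdf_lie (U := O)) => //; first by have [] := ad_f ad k.
  by apply: smooth_vf_conj; [exact: nb_open nb|have [] := ad_f ad j].
apply: CdiffM; first exact: Cdiff_cst.
by have := mdf_mul dl (mdf_cu nb ad Oq); apply.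
Qed.

Lemma mul_ximat q (c : 'rV[R[i]]_r) : c *m ximat q = mxvec (xi_comb phi c q).
Proof.
rewrite mulmx_sum_row /xi_comb linear_sum; apply: eq_bigr => a _.
by rewrite rowK linearZ.
Qed.

Lemma mdf_ximat q : O q -> mdf ximat q.
Proof.
move=> Oq a k; case/mxvec_indexP: k => i j.
under eq_fun do rewrite mxE mxvecE; exact: mdf_xi.
Qed.

(** The left kernel of [ximat] is the third kernel in the basis [e]. *)
Lemma rank_ximat : exists t : nat, forall y, O y -> \rank (ximat y) = t.
Proof.
have [t rk] := nb_K3 nb; exists (r - t)%N => y Oy.
have [B [fB DB]] := rk y Oy; have [_ Ee] := dual_fe nb ad Oy.
have sub1 : (kermx (ximat y) *m emat phi y <= B)%MS.
  apply/row_subP => z; rewrite row_mul; apply/DB/(K3_iota nb ad _ Oy); split.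
    by apply/(memK ad _ Oy); exact: submxMl.
  rewrite -mulmxA Ee mulmx1; apply: (can_inj (@mxvecK _ _ _)).
  by rewrite -mul_ximat linear0 -row_mul mulmx_ker row0.
have sub2 : (B <= kermx (ximat y) *m emat phi y)%MS.
  apply/row_subP => z; have /DB/(K3_iota nb ad _ Oy)[Kz xz] := row_sub z B.
  have [_ _ _] := H_coord nb ad Oy (K_sub_H Kz).
  have [_ ->] := (K_coord nb ad _ Oy).1 Kz; rewrite mul0mx add0r => ->.
  apply: submxMr; apply/sub_kermxP.
  by rewrite mul_ximat xz linear0.
have : \rank (kermx (ximat y) *m emat phi y) = t.
  have /eqP <- : \rank B == t by move: fB; rewrite /row_free.
  by apply/eqP; rewrite eqn_leq !mxrankS.
rewrite mxrankMfree ?(ematfree ad) // mxrank_ker => <-.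
by rewrite subKn // rank_leq_row.
Qed.

(** This is the reason why the maps O are well defined: a relation between the [xi] at
   [q] continues, to first order, modulo their span. *)
Lemma xi_relation q v (c : 'rV[R[i]]_r) : O q -> xi_comb phi c q = 0 ->
  exists d : 'rV[R[i]]_r,
    \sum_a c 0 a *: cder_mx v (xi phi a) q = xi_comb phi d q.
Proof.
move=> Oq x0; have [t rk] := rank_ximat.
have rr y : O y -> (\rank (ximat y) <= \rank (ximat q))%N.
  move=> Oy; apply: eq_leq; exact: etrans (rk y Oy) (esym (rk q Oq)).
have /submxP[d Ed] : (c *m cder_mx v ximat q <= ximat q)%MS.
  apply: constant_rank_derivative; first exact: mdf_ximat.
    exact: (near_open (nb_open nb) Oq rr).
  by rewrite mul_ximat x0 linear0.
exists d; apply: (can_inj (@mxvecK _ _ _)); rewrite -mul_ximat -Ed.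
rewrite linear_sum mulmx_sum_row; apply: eq_bigr => a _; rewrite linearZ /=.
apply: (congr1 ( *:%R _)); apply/rowP => k; case/mxvec_indexP: k => i j.
rewrite mxvecE mxE_row [LHS]cder_mxij [RHS]cder_mxij; apply: cder_ext => y.
by rewrite [RHS]mxE mxvecE.
Qed.

End IotaRank.

(** * The symbol isomorphism and the matrices of a frame in coordinates *)

Section Cis.
Variable R : realType.
Implicit Types (h : R) (z : R[i]).

Lemma cisN h : cis (- h) * cis h = 1.
Proof.
rewrite /cis cosN sinN; apply: complex_eq; rewrite ?cReM ?cImM /=.
  by rewrite mulNr opprK -!expr2 cos2Dsin2.
by rewrite mulNr mulrC subrr.
Qed.

Lemma cis_neq0 h : cis h != 0.
Proof. by apply/eqP => h0; have /eqP := cisN h; rewrite h0 mulr0 eq_sym oner_eq0. Qed.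

Lemma cis_conj h : conjc (cis h) = cis (- h).
Proof. by rewrite /cis cosN sinN. Qed.

Lemma unit_cis z : z * conjc z = 1 -> exists h, z = cis h.
Proof.
case: z => a b /(congr1 (@complex.Re R)) /=; rewrite mulrN opprK => ab1.
have a1 : -1 <= a <= 1.
  by apply/andP; split; nra.
have sb : Num.sqrt (1 - a ^+ 2) = `|b|.
  by rewrite -sqrtr_sqr; congr Num.sqrt; rewrite -ab1; ring.
have [b0|b0] := lerP 0 b.
  by exists (acos a); rewrite /cis acosK ?sin_acos ?sb ?ger0_norm.
by exists (- acos a); rewrite /cis cosN sinN acosK ?sin_acos ?sb ?ltr0_norm ?opprK.
Qed.

(** Needed to split the phase [twist] of the Levi matrix evenly, which makes the
   remaining factor Hermitian. *)
Lemma unit_sqrt z : z * conjc z = 1 -> exists h, cis h * cis h = z.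
Proof.
move=> /unit_cis[h ->]; exists (h / 2).
apply: complex_eq; rewrite ?cReM ?cImM /=.
  by rewrite -cosD -splitr.
by rewrite addrC -sinD -splitr.
Qed.

End Cis.

Section FrameIso.
Variables (R : realType) (m s r : nat).
Variables (U : set (rvec R m)) (H : rvec R m -> set (cvec R m)) (O : set (rvec R m)).
Variable phi : frame R m s r.
Hypotheses (nb : CR_nbhd s r U H O) (ad : adapted U H O phi).
Implicit Types (q y : rvec R m) (v w : cvec R m) (tau : symmap R m s).

Lemma subnbhd_O q : O q -> subnbhd U q O.
Proof. by move=> Oq; split=> //; [exact: nb_open nb|exact: nb_sub nb]. Qed.

Lemma section_const_Hb q v : section_on (fun y => conjset (H y)) O (const_Hb phi q v).
Proof.
have oO := nb_open nb; split; last first.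
  by move=> y Oy; apply/(memHb ad _ Oy); exact: const_Hb_sub.
have -> : const_Hb phi q v = fun y => v *m cfb phi q *m (\matrix_k conjvf (ff phi k) y)
    + v *m ceb phi q *m (\matrix_k conjvf (fe phi k) y).
  by apply/funext => y; rewrite /const_Hb /fmat /emat !conj_rows.
apply: smooth_vfD => //; apply: smooth_vf_comb => // k; apply: smooth_vf_conj => //.
  by have [] := ad_f ad k.
by have [] := ad_e ad k.
Qed.

Definition iso_values q tau := [/\ forall v, val_u tau v = (v *m cu phi q) 0 0,
  forall v, H q v -> val_1 tau v = (v *m cf phi q)^T &
  forall v, conjset (H q) v -> val_2 tau v = levi phi q *m (v *m cfb phi q)^T].

Lemma ff_cf q k : O q -> ff phi k q *m cf phi q = delta_mx 0 k.
Proof.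
move=> Oq; have [E _] := dual_fe nb ad Oq.
by rewrite -(row_fmat phi q k) -row_mul E row1.
Qed.

Lemma ffb_cfb q k : O q -> conjm (ff phi k q) *m cfb phi q = delta_mx 0 k.
Proof.
move=> Oq; have [E _] := dual_feb nb ad Oq.
have -> : conjm (ff phi k q) = row k (conjm (fmat phi q)).
  by rewrite -(row_fmat phi q k) /conjm map_row.
by rewrite -row_mul E row1.
Qed.

Lemma mx11_eq0 (A : 'M[R[i]]_1) : A 0 0 = 0 <-> A = 0.
Proof. by split=> [A0|->]; [rewrite [A]mx11_scalar A0 raddf0|rewrite mxE]. Qed.

Lemma tr_eq0 (k l : nat) (A : 'M[R[i]]_(k, l)) : A^T = 0 <-> A = 0.
Proof. by split=> [A0|->]; [apply: trmx_inj; rewrite A0 trmx0|exact: trmx0]. Qed.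

(** The bracket condition determines the values on the conjugate bundle from those on
   [H] and on the top degree: they are the coordinates multiplied by the Levi matrix. *)
Lemma iso_valuesP q tau : O q -> frame_iso U H phi q tau <-> iso_values q tau.
Proof.
move=> Oq; split.
- move=> [F g1 f1]; have Hg v : v *m cu phi q *m fg phi q = (v *m cu phi q) 0 0 *: fg phi q.
    by rewrite {1}[v *m cu phi q]mx11_scalar mul_scalar_mx.
  have vu v : val_u tau v = (v *m cu phi q) 0 0.
    have /(Fq_u F) : Hc H q (v - v *m cu phi q *m fg phi q).
      apply/(Hc_cu nb ad _ Oq); have [_ _ [_ gu]] := dual_rels nb ad Oq.
      by rewrite mulmxBl -(mulmxA (v *m _)) gu mulmx1 subrr.
    rewrite /val_u mulmxBl Hg -scalemxAl !mxE => /eqP.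
    have := g1; rewrite /val_u mxE => ->.
    by rewrite mulr1 subr_eq0 => /eqP.
  have fi : fmat phi q *m i1 tau = 1%:M.
    apply/row_matrixP => k; rewrite row_mul row_fmat row1; apply: trmx_inj.
    by rewrite trmx_delta; exact: f1.
  have ei : emat phi q *m i1 tau = 0.
    apply/row_matrixP => a; rewrite row_mul row_emat row0; apply/tr_eq0.
    have Ke : Kb U H 2 q (fe phi a q) by have [_] := ad_e ad a; apply.
    exact: ((Fq_1 F (K_sub_H Ke)).2 Ke).
  split=> // v Hv.
    have [_ _ _ {1}->] := H_coord nb ad Oq Hv.
    by rewrite /val_1 mulmxDl -!mulmxA fi ei mulmx1 !mulmx0 addr0.
  apply/colP => k.
  have E := Fq_br F (subnbhd_O Oq) (ad_f ad k) (section_const_Hb q v).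
  have vE : const_Hb phi q v q = v.
    by have [_ _ _ E1] := Hb_coord nb ad Oq Hv; rewrite /const_Hb -E1.
  move: E; rewrite vE f1 br_hel => /gm_inj[_ _ E _ _].
  have c0 : 2 * 'i%C != 0 :> R[i] by rewrite -invr_eq0; exact: ii2_neq0.
  apply: (mulfI c0); rewrite trmx_delta -rowE mxE in E; rewrite E vu.
  rewrite (levi_f nb ad k (nb_open nb) _ Oq (section_const_Hb q v)) // vE.
  by rewrite mxE -row_mul mxE.
- move=> [vu v1 v2]; split.
  + split.
    * by move=> v; rewrite vu mx11_eq0 -(Hc_cu nb ad _ Oq).
    * move=> v Hv; rewrite (v1 _ Hv) tr_eq0; split=> [v0|]; first exact/(K_coord nb ad _ Oq).
      by case/(K_coord nb ad _ Oq).
    * move=> v Hv; rewrite (v2 _ Hv); split=> [v0|Kv]; last first.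
        by rewrite (Kb_coord nb ad Oq Kv) trmx0 mulmx0.
      have c0 : v *m cfb phi q = 0.
        apply/tr_eq0; rewrite -[LHS](mulKmx (levi_unit nb ad Oq)) v0 mulmx0 //.
      have [_ _ _ ->] := Hb_coord nb ad Oq Hv; rewrite c0 mul0mx add0r.
      by apply/(memKb ad _ Oq); exact: submxMl.
    * move=> O' X Y [oO' O'U O'q] sX sY.
      have oV : open (O' `&` O) by apply: openI => //; exact: nb_open nb.
      have Vq : (O' `&` O) q by [].
      have sX' : section_on H (O' `&` O) X by apply: sectionS sX => y [].
      have sY' : section_on (fun y => conjset (H y)) (O' `&` O) Y by apply: sectionS sY => y [].
      rewrite br_hel vu (v1 _ (sX.2 _ O'q)) (v2 _ (sY.2 _ O'q)) trmxK.
      rewrite (levi_tensor nb ad oV _ Vq (sec_mdf sX' Vq) _ sY').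
      - by apply: (congr1 (fun t => hel t 0 0)); rewrite [RHS]mxE mulmxA.
      - by move=> y [].
      - move=> y Vy; apply/(Hc_cu nb ad _ Vy.2).
        by have [] := H_coord nb ad Vy.2 (sX'.2 _ Vy).
  + by rewrite vu; have [_ _ [_ ->]] := dual_rels nb ad Oq; rewrite mxE.
  + move=> k; rewrite v1; first by rewrite ff_cf // trmx_delta.
    by have [_] := ad_f ad k; apply.
Qed.

Definition iso0 q := Symmap (cu phi q) (cf phi q) (cfb phi q *m (levi phi q)^T).

Lemma iso0_values q : iso_values q (iso0 q).
Proof.
split=> [v|v _|v _] //; rewrite /val_2 /=.
by rewrite mulmxA trmx_mul trmxK.
Qed.

Lemma herm_pairP q (Hh : 'M[R[i]]_s * R) : O q ->
  is_hermitian_pair U H phi q Hh <->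
  (conjm Hh.1)^T = Hh.1 /\ cis Hh.2 *: Hh.1 = levi phi q.
Proof.
have Hf k : O q -> conjset (H q) (conjm (ff phi k q)).
  by move=> Oq; rewrite /conjset /= conjmK; have [_] := ad_f ad k; apply.
move=> Oq; split=> [[h1 [tau [/(iso_valuesP _ Oq)[_ _ v2] E]]]|[h1 E]]; split=> //.
  apply/matrixP => k j; have := E j; rewrite v2 ?ffb_cfb //; last exact: Hf.
  rewrite trmx_delta -colE => /colP/(_ k).
  by rewrite mxE => ->; rewrite !mxE.
exists (iso0 q); split; first by apply/(iso_valuesP _ Oq); exact: iso0_values.
move=> j; have [_ _ ->] := iso0_values q; last exact: Hf.
by rewrite ffb_cfb // trmx_delta -colE -E; apply/colP => k; rewrite !mxE.
Qed.

(** The Hermitian pair is only defined up to a sign, but its product is always the Levi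
   matrix; therefore the matrices S depend smoothly on the point whichever sign is
   chosen. *)
Lemma herm_pair_levi q : O q ->
  cis (herm_pair U H phi q).2 *: (herm_pair U H phi q).1 = levi phi q.
Proof.
move=> Oq; suff /(herm_pairP _ Oq)[] : is_hermitian_pair U H phi q (herm_pair U H phi q) by [].
apply: (xgetPex (0, 0)).
have [h hh] := unit_sqrt (twist_unit nb ad Oq).
exists (cis (- h) *: levi phi q, h); apply/(herm_pairP _ Oq) => /=; split; last first.
  by rewrite scalerA mulrC cisN scale1r.
rewrite conjmZ cis_conj opprK linearZ /= [in RHS](levi_hermitian nb ad Oq) scalerA -hh.
by rewrite mulrA cisN mul1r.
Qed.

End FrameIso.

Section SMatrices.
Variables (R : realType) (m s r : nat).
Variables (U : set (rvec R m)) (H : rvec R m -> set (cvec R m)) (O : set (rvec R m)).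
Variable phi : frame R m s r.
Hypotheses (nb : CR_nbhd s r U H O) (ad : adapted U H O phi).
Implicit Types (q y : rvec R m) (v w : cvec R m).

Lemma comb_col q (X : 'M[R[i]]_s) k :
  \sum_l X l k *: ff phi l q = (col k X)^T *m fmat phi q.
Proof. by rewrite comb_sum; apply: eq_bigr => l _; rewrite !mxE. Qed.

Lemma is_XiP q a (X : 'M[R[i]]_s) : O q -> is_Xi U H phi q a X <-> X = xi phi a q.
Proof.
move=> Oq; have oO := nb_open nb; have nbO := subnbhd_O nb Oq.
have [Ff _] := dual_fe nb ad Oq.
have xrow k : (conjvf (ff phi k) q *m cfb phi q) *m (xi phi a q)^T = (col k (xi phi a q))^T.
  by rewrite (ffb_cfb nb ad k Oq) -rowE tr_col.
have ea : fe phi a q *m ce phi q = delta_mx 0 a.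
  by have [_ Fe] := dual_fe nb ad Oq; rewrite -(row_emat phi q a) -row_mul Fe row1.
have comb1 : xi_comb phi (delta_mx 0 a) q = xi phi a q.
  rewrite /xi_comb (bigD1 a) //= mxE !eqxx scale1r big1 ?addr0 // => b ba.
  by rewrite mxE eqxx (negbTE ba) scale0r.
split=> [XiX|-> k].
  apply: trmx_inj; apply/row_matrixP => k; rewrite -!tr_col.
  have [_ /(_ O _ _ nbO (ad_e ad a) (fb_section ad k oO (@subset_refl _ O)) erefl erefl)] := XiX k.
  move/(KHb_coord nb ad _ Oq) => [+ _]; rewrite comb_col mulmxBl -mulmxA Ff mulmx1.
  rewrite (iota_e nb ad a oO (@subset_refl _ O) Oq (fb_section ad k oO (@subset_refl _ O))) xrow.
  by move/eqP; rewrite subr_eq0 => /eqP ->.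
have -> := comb_col q (xi phi a q) k; split.
  have Hk : H q ((col k (xi phi a q))^T *m fmat phi q + 0 *m emat phi q).
    by apply/(memH ad _ Oq); rewrite /hmat -mul_row_col submxMl.
  by rewrite mul0mx addr0 in Hk.
move=> O' V W' [oO' O'U O'q] sV sW Vq Wq; apply/(KHb_coord nb ad _ Oq).
have oV : open (O' `&` O) by exact: openI.
have VO : (O' `&` O) `<=` O by move=> y [].
have Oq' : (O' `&` O) q by [].
have sV' : section_on (Kb U H 2) (O' `&` O) V by apply: sectionS sV => y [].
have sW' : section_on (fun y => conjset (H y)) (O' `&` O) W' by apply: sectionS sW => y [].
have /(Hc_cu nb ad _ Oq) HcVW := lie_K_Hb nb ad oV VO Oq' sV' sW'.
split; rewrite mulmxBl -mulmxA Ff.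
  by rewrite (iota_tensor nb ad oV VO Oq' sV' sW') Vq Wq ea comb1 xrow mulmx1 subrr.
by rewrite HcVW mulmx0 subrr.
Qed.

Lemma Xi_xi q a : O q -> Xi U H phi a q = xi phi a q.
Proof.
move=> Oq; apply/(is_XiP _ _ Oq); apply: (xgetPex 0); exists (xi phi a q).
exact/(is_XiP _ _ Oq).
Qed.

(** The phase and the Hermitian factor of the Levi matrix occur only through their
   product, so that [spos] and [sneg] are the blocks of S in degree 2 and -2. *)
Definition spos a q : 'M[R[i]]_s := xi phi a q *m invmx (levi phi q).
Definition sneg a q : 'M[R[i]]_s := levi phi q *m conjm (xi phi a q).

Lemma Spos_spos q a : O q -> Spos U H phi a q = cel 0 0 (spos a q) 0.
Proof.
move=> Oq; rewrite /Spos Xi_xi //; apply: (congr1 (fun S => cel 0 0 S 0)).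
rewrite /spos -(herm_pair_levi nb ad Oq) invmxZ; last first.
  by rewrite (herm_pair_levi nb ad Oq); exact: (levi_unit nb ad).
rewrite -scalemxAr; apply: (congr1 ( *:%R^~ _)).
by apply: (mulIf (cis_neq0 (herm_pair U H phi q).2)); rewrite cisN mulVf ?cis_neq0.
Qed.

Lemma Sneg_sneg q a : O q -> Sneg U H phi a q = cel 0 0 0 (sneg a q).
Proof.
move=> Oq; rewrite /Sneg Xi_xi //; apply: (congr1 (fun S => cel 0 0 0 S)).
by rewrite scalemxAl (herm_pair_levi nb ad Oq).
Qed.

Lemma mdf_spos q a : O q -> mdf (spos a) q.
Proof.
move=> Oq; apply: mdf_mul; first exact: (mdf_xi nb ad).
apply: (@mdf_near _ _ _ _ (fun y => (\det (levi phi y))^-1 *: \adj (levi phi y))).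
  apply: near_open (nb_open nb) Oq _ => y Oy.
  by rewrite /invmx (levi_unit nb ad Oy).
by apply: mdf_inv; [exact: (levi_unit nb ad)|exact: (mdf_levi nb ad)].
Qed.

Lemma mdf_sneg q a : O q -> mdf (sneg a) q.
Proof.
by move=> Oq; apply: mdf_mul; [exact: (mdf_levi nb ad)|apply: mdf_conj; exact: (mdf_xi nb ad)].
Qed.

End SMatrices.

Section CelDerivative.
Variables (R : realType) (m s : nat).
Implicit Types (q : rvec R m) (v : cvec R m) (S : rvec R m -> 'M[R[i]]_s).

(** Each entry of the matrix is a fixed entry of the block or constantly zero, which
   reduces differentiation of the matrix to that of the block. *)
Lemma cpos_entry (a b : 'I_(1 + (s + (s + 1)))) :
  (exists k l, forall S : 'M[R[i]]_s, cel 0 0 S 0 a b = S k l) \/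
  (forall S : 'M[R[i]]_s, cel 0 0 S 0 a b = 0).
Proof.
rewrite -[a]splitK -[b]splitK.
case: (fintype.split a) => i1; case: (fintype.split b) => j1 /=;
  try by right => S; rewrite cposE ?(block_mxEul, block_mxEur, block_mxEdl) mxE.
rewrite -[i1]splitK -[j1]splitK.
case: (fintype.split i1) => i2; case: (fintype.split j1) => j2 /=;
  try by right => S; rewrite cposE block_mxEdr ?(block_mxEul, block_mxEdl, block_mxEdr) mxE.
rewrite -[j2]splitK; case: (fintype.split j2) => j3 /=.
  by left; exists i2, j3 => S; rewrite cposE block_mxEdr block_mxEur row_mxEl.
by right => S; rewrite cposE block_mxEdr block_mxEur row_mxEr mxE.
Qed.

Lemma cneg_entry (a b : 'I_(1 + (s + (s + 1)))) :
  (exists k l, forall S : 'M[R[i]]_s, cel 0 0 0 S a b = S k l) \/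
  (forall S : 'M[R[i]]_s, cel 0 0 0 S a b = 0).
Proof.
rewrite -[a]splitK -[b]splitK.
case: (fintype.split a) => i1; case: (fintype.split b) => j1 /=;
  try by right => S; rewrite cnegE ?(block_mxEul, block_mxEur, block_mxEdl) mxE.
rewrite -[i1]splitK -[j1]splitK.
case: (fintype.split i1) => i2; case: (fintype.split j1) => j2 /=;
  try by right => S; rewrite cnegE block_mxEdr ?(block_mxEul, block_mxEur, block_mxEdr) mxE.
rewrite -[i2]splitK; case: (fintype.split i2) => i3 /=.
  by left; exists i3, j2 => S; rewrite cnegE block_mxEdr block_mxEdl col_mxEu.
by right => S; rewrite cnegE block_mxEdr block_mxEdl col_mxEd mxE.
Qed.

Lemma cder_cpos v S q :
  cder_mx v (fun y => cel 0 0 (S y) 0) q = cel 0 0 (cder_mx v S q) 0.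
Proof.
apply/matrixP => i j; rewrite cder_mxij.
have [[k [l E]]|E] := cpos_entry i j.
  by rewrite [RHS]E [RHS]cder_mxij; apply: cder_ext => y; exact: E.
by rewrite [RHS]E; apply: (etrans _ (cder_cst v 0 q)); apply: cder_ext => y; exact: E.
Qed.

Lemma cder_cneg v S q :
  cder_mx v (fun y => cel 0 0 0 (S y)) q = cel 0 0 0 (cder_mx v S q).
Proof.
apply/matrixP => i j; rewrite cder_mxij.
have [[k [l E]]|E] := cneg_entry i j.
  by rewrite [RHS]E [RHS]cder_mxij; apply: cder_ext => y; exact: E.
by rewrite [RHS]E; apply: (etrans _ (cder_cst v 0 q)); apply: cder_ext => y; exact: E.
Qed.

End CelDerivative.

Opaque cf ce cu cfb ceb fmat emat levi xi.

(** * Change of adapted frame *)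

Lemma mx11_mul (F : comPzRingType) (k : nat) (A : 'M[F]_1) (B : 'M[F]_(1, k)) (C : 'M[F]_(k, 1)) :
  (A *m B *m C) 0 0 = A 0 0 * (B *m C) 0 0.
Proof. by rewrite -mulmxA mxE big_ord1. Qed.

Lemma mul3_entry (F : pzRingType) (a b c d : nat) (A : 'M[F]_(a, b)) (L : 'M[F]_(b, c))
    (B : 'M[F]_(d, c)) k j :
  (A *m L *m B^T) k j = (row k A *m L *m (row j B)^T) 0 0.
Proof.
rewrite -row_mul [LHS]mxE [RHS]mxE; apply: eq_bigr => l _.
by rewrite [in RHS]mxE [B^T _ _]mxE [(row j B)^T _ _]mxE [row j B _ _]mxE.
Qed.

Lemma cancel_scale (F : fieldType) (c x w z : F) : c != 0 ->
  x * w = c * z -> x * (c^-1 * w) = z.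
Proof. by move=> c0 E; rewrite mulrCA E mulKf. Qed.

Lemma mul_congr (F : pzRingType) (k : nat) (A L B X Z S C : 'M[F]_k) :
  B *m X = Z *m C -> L *m Z = S -> A *m L *m B *m X = A *m S *m C.
Proof. by move=> E1 <-; rewrite -[LHS]mulmxA E1 !mulmxA. Qed.

Lemma congruence_inv (F : fieldType) (k : nat) (c : F) (A B L L' X' Y : 'M[F]_k) :
  c != 0 -> L \in unitmx -> L' \in unitmx -> c *: L' = A *m L *m B ->
  A^T *m X' = Y *m B -> A^T *m (X' *m invmx L') *m A = c *: (Y *m invmx L).
Proof.
move=> c0 Lu Lu' EL EX; rewrite mulmxA EX.
have E1 : A *m (c^-1 *: (L *m B *m invmx L')) = 1%:M.
  by rewrite -scalemxAr !mulmxA -EL -scalemxAl mulmxV // scalerA mulVf // scale1r.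
have := mulmx1C E1; rewrite -scalemxAl -!mulmxA => E2.
have -> : B *m (invmx L' *m A) = c *: invmx L.
  by rewrite -[LHS](mulKmx Lu) -[L *m _](scalerKV c0) E2 -scalemxAr mulmx1.
by rewrite -scalemxAr.
Qed.

Section FrameChange.
Variables (R : realType) (m s r : nat).
Variables (U : set (rvec R m)) (H : rvec R m -> set (cvec R m)) (O : set (rvec R m)).
Hypothesis nb : CR_nbhd s r U H O.
Implicit Types (q y : rvec R m) (v w : cvec R m) (phi : frame R m s r).

(** The change of frame: [chA], [chE] and [chr] are the matrices of the frame of [phi']
   in that of [phi], on [H/K_2], [K_2] and the quotient by [Hc]. *)
Definition chA phi phi' q : 'M[R[i]]_s := fmat phi' q *m cf phi q.
Definition chE phi phi' q : 'M[R[i]]_r := emat phi' q *m ce phi q.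
Definition chr phi phi' q : R[i] := (fg phi' q *m cu phi q) 0 0.

Variables phi phi' : frame R m s r.
Hypotheses (ad : adapted U H O phi) (ad' : adapted U H O phi').

Lemma emat_H q : O q -> H q 0 /\ forall a, Kb U H 2 q (fe phi' a q).
Proof.
by move=> Oq; split=> [|a]; [apply/(memH ad _ Oq); exact: sub0mx|have [_] := ad_e ad' a; apply].
Qed.

Lemma emat_coords q : O q ->
  (emat phi' q *m cf phi q = 0) * (emat phi' q *m cu phi q = 0).
Proof.
move=> Oq; split; apply/row_matrixP => a; rewrite row_mul row_emat row0;
  have [_ /(_ a) Ka] := emat_H Oq.
  by have [_] := (K_coord nb ad _ Oq).1 Ka.
by have [] := H_coord nb ad Oq (K_sub_H Ka).
Qed.

Lemma ebmat_coords q : O q -> conjm (emat phi' q) *m cfb phi q = 0.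
Proof.
move=> Oq; apply/row_matrixP => a; rewrite row_mul row0.
have -> : row a (conjm (emat phi' q)) = conjm (fe phi' a q).
  by rewrite -(row_emat phi' q a) /conjm map_row.
apply: (Kb_coord nb ad Oq); rewrite /conjset /= conjmK.
by have [_] := emat_H Oq; apply.
Qed.

Lemma hbmat_coords q : O q ->
  (conjm (fmat phi' q) *m cf phi q = 0) * (conjm (emat phi' q) *m cf phi q = 0).
Proof.
move=> Oq; split; apply/row_matrixP => a; rewrite row_mul row0.
  have -> : row a (conjm (fmat phi' q)) = conjm (ff phi' a q).
    by rewrite -(row_fmat phi' q a) /conjm map_row.
  have Hb : conjset (H q) (conjm (ff phi' a q)).
    by rewrite /conjset /= conjmK; have [_] := ad_f ad' a; apply.
  by have [_ -> _ _] := Hb_coord nb ad Oq Hb.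
have -> : row a (conjm (emat phi' q)) = conjm (fe phi' a q).
  by rewrite -(row_emat phi' q a) /conjm map_row.
have Hb : conjset (H q) (conjm (fe phi' a q)).
  by rewrite /conjset /= conjmK; apply: K_sub_H; have [_] := emat_H Oq; apply.
by have [_ -> _ _] := Hb_coord nb ad Oq Hb.
Qed.

Lemma fbmat_cfb q : O q -> conjm (fmat phi' q) *m cfb phi q = conjm (chA phi phi' q).
Proof.
move=> Oq; have E : fmat phi' q = chA phi phi' q *m fmat phi q
    + fmat phi' q *m ce phi q *m emat phi q.
  apply/row_matrixP => k; rewrite linearD /= !row_mul row_fmat.
  have Hk : H q (ff phi' k q) by have [_] := ad_f ad' k; apply.
  by have [_ _ _ {1}->] := H_coord nb ad Oq Hk.
rewrite {1}E conjmD !conjmM mulmxDl -!mulmxA.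
have [Ffb Feb] := dual_feb nb ad Oq; rewrite Ffb Feb.
by rewrite mulmx1 !mulmx0 addr0.
Qed.

Lemma ch_cf q v : O q -> Hc H q v -> v *m cf phi q = v *m cf phi' q *m chA phi phi' q.
Proof.
move=> Oq /(Hc_cu nb ad' _ Oq) v0.
have [e1 _] := emat_coords Oq; have [e2 e3] := hbmat_coords Oq.
rewrite {1}(frame_expand nb ad' v Oq) v0 mul0mx addr0 mulmxD4l -!mulmxA e1 e2 e3.
by rewrite !mulmx0 !addr0 mulmxA.
Qed.

Lemma ch_cfb q v : O q -> conjset (H q) v ->
  v *m cfb phi q = v *m cfb phi' q *m conjm (chA phi phi' q).
Proof.
move=> Oq Hv; have [_ _ _ {1}->] := Hb_coord nb ad' Oq Hv.
by rewrite mulmxDl -!mulmxA (ebmat_coords Oq) (fbmat_cfb Oq) !mulmx0 addr0.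
Qed.

Lemma ch_ce q v : O q -> Kb U H 2 q v -> v *m ce phi q = v *m ce phi' q *m chE phi phi' q.
Proof.
move=> Oq Kv; have [_ _ _] := H_coord nb ad' Oq (K_sub_H Kv).
have [_ ->] := (K_coord nb ad' _ Oq).1 Kv; rewrite mul0mx add0r => {1}->.
by rewrite -!mulmxA.
Qed.

Lemma ch_cu q v : O q -> (v *m cu phi q) 0 0 = chr phi phi' q * (v *m cu phi' q) 0 0.
Proof.
move=> Oq; have Hh : Hc H q (v - v *m cu phi' q *m fg phi' q).
  apply/(Hc_cu nb ad' _ Oq); have [_ _ [_ gu]] := dual_rels nb ad' Oq.
  by rewrite mulmxBl -(mulmxA (v *m _)) gu mulmx1 subrr.
have := (Hc_cu nb ad _ Oq).1 Hh; rewrite mulmxBl => /subr0_eq E.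
apply: (etrans (congr1 (fun A : 'M[R[i]]_1 => A 0 0) E)).
by apply: (etrans (mx11_mul _ _ _)); exact: mulrC.
Qed.

End FrameChange.

Section FrameChangeInverse.
Variables (R : realType) (m s r : nat).
Variables (U : set (rvec R m)) (H : rvec R m -> set (cvec R m)) (O : set (rvec R m)).
Hypothesis nb : CR_nbhd s r U H O.
Variables phi phi' : frame R m s r.
Hypotheses (ad : adapted U H O phi) (ad' : adapted U H O phi').
Implicit Types (q y : rvec R m) (v w : cvec R m).

Lemma row_chA (psi psi' : frame R m s r) q k :
  row k (chA psi psi' q) = ff psi' k q *m cf psi q.
Proof. by rewrite /chA row_mul row_fmat. Qed.

Lemma row_chE (psi psi' : frame R m s r) q k :
  row k (chE psi psi' q) = fe psi' k q *m ce psi q.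
Proof. by rewrite /chE row_mul row_emat. Qed.

Lemma chA_inv q : O q -> chA phi phi' q *m chA phi' phi q = 1%:M.
Proof.
move=> Oq; have [E _] := dual_fe nb ad' Oq; rewrite -[RHS]E.
apply/row_matrixP => k; rewrite [LHS]row_mul [RHS]row_mul row_chA row_fmat.
have Hk : Hc H q (ff phi' k q).
  have [_ /(_ q Oq) Hf] := ad_f ad' k.
  by apply/(Hc_cu nb ad _ Oq); have [] := H_coord nb ad Oq Hf.
by rewrite [RHS](ch_cf nb ad' ad Oq Hk).
Qed.

Lemma chE_inv q : O q -> chE phi phi' q *m chE phi' phi q = 1%:M.
Proof.
move=> Oq; have [_ E] := dual_fe nb ad' Oq; rewrite -[RHS]E.
apply/row_matrixP => k; rewrite [LHS]row_mul [RHS]row_mul row_chE row_emat.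
have Kk : Kb U H 2 q (fe phi' k q) by have [_] := ad_e ad' k; apply.
by rewrite [RHS](ch_ce nb phi' ad Oq Kk).
Qed.

Lemma chr_inv q : O q -> chr phi phi' q * chr phi' phi q = 1.
Proof.
move=> Oq; have [_ _ [_ E]] := dual_rels nb ad' Oq.
have E1 := congr1 (fun A : 'M[R[i]]_1 => A 0 0) E.
have E2 : (1%:M : 'M[R[i]]_1) 0 0 = 1 by rewrite mxE eqxx mulr1n.
have E3 := ch_cu nb ad' ad (fg phi' q) Oq.
exact: etrans (mulrC _ _) (etrans (esym E3) (etrans E1 E2)).
Qed.

Opaque chA chE chr.

Lemma chA_unit q : O q -> chA phi phi' q \in unitmx.
Proof. move=> Oq; have [Au _] := mulmx1_unit (chA_inv Oq); exact: Au. Qed.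

Lemma chE_unit q : O q -> chE phi phi' q \in unitmx.
Proof. move=> Oq; have [Au _] := mulmx1_unit (chE_inv Oq); exact: Au. Qed.

Lemma chr_neq0 q : O q -> chr phi phi' q != 0.
Proof.
by move=> Oq; apply/eqP => c0; have /eqP := chr_inv Oq; rewrite c0 mul0r eq_sym oner_eq0.
Qed.

(** The Levi form is Hermitian in [H/K_2] with values in the quotient by [Hc], hence
   transforms by congruence and by the factor [chr]. *)
Lemma levi_change q : O q -> chr phi phi' q *: levi phi' q =
  chA phi phi' q *m levi phi q *m (conjm (chA phi phi' q))^T.
Proof.
move=> Oq; have oO := nb_open nb; have OO := @subset_refl _ O.
apply/matrixP => k j; rewrite [RHS]mul3_entry [LHS]mxE leviE.
have sk := f_section ad' k OO; have sj := fb_section ad' j oO OO.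
have HcO y : O y -> Hc H y (ff phi' k y).
  move=> Oy; apply/(Hc_cu nb ad _ Oy).
  by have [] := H_coord nb ad Oy (sk.2 _ Oy).
have Ek : row k (chA phi phi' q) = ff phi' k q *m cf phi q by exact: row_chA.
have Ej : row j (conjm (chA phi phi' q)) = conjvf (ff phi' j) q *m cfb phi q.
  rewrite -(fbmat_cfb nb ad ad' Oq) row_mul; apply: (congr1 (mulmx^~ _)).
  by rewrite /conjvf -(row_fmat phi' q j) /conjm map_row.
have E := levi_tensor nb ad oO OO Oq (sec_mdf sk Oq) HcO sj.
rewrite Ek Ej; apply: cancel_scale; first by rewrite -invr_eq0; exact: ii2_neq0.
apply: etrans (esym (ch_cu nb ad ad' _ Oq)) _.
by apply: (etrans (congr1 (fun A : 'M[R[i]]_1 => A 0 0) E)); rewrite [LHS]mxE.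
Qed.

(** The matrices of iota transform as those of a map from the conjugate of [H/K_2]
   to [H/K_2]. *)
Lemma xi_change q a : O q ->
  (chA phi phi' q)^T *m xi phi' a q =
  xi_comb phi (row a (chE phi phi' q)) q *m (conjm (chA phi phi' q))^T.
Proof.
move=> Oq; have oO := nb_open nb; have OO := @subset_refl _ O.
apply: trmx_inj; rewrite [LHS]trmx_mul [RHS]trmx_mul (trmxK (chA phi phi' q)) (trmxK (conjm _)).
apply/row_matrixP => k.
have sa := e_section ad' a OO; have sk := fb_section ad' k oO OO.
have HcL := lie_K_Hb nb ad' oO OO Oq sa sk.
have Ek : row k (conjm (chA phi phi' q)) = conjvf (ff phi' k) q *m cfb phi q.
  rewrite -(fbmat_cfb nb ad ad' Oq) row_mul; apply: (congr1 (mulmx^~ _)).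
  by rewrite /conjvf -(row_fmat phi' q k) /conjm map_row.
have E1 := iota_tensor nb ad oO OO Oq sa sk.
have E2 := ch_cf nb ad ad' Oq HcL.
have E3 := iota_e nb ad' a oO OO Oq sk.
rewrite [LHS]row_mul [RHS]row_mul Ek (row_chE phi phi' q a).
apply: etrans _ E1; apply: etrans _ (esym E2); apply: (congr1 (mulmx^~ _)).
apply: etrans _ (esym E3).
by rewrite (ffb_cfb nb ad' k Oq) -rowE.
Qed.

Lemma spos_change q a : O q ->
  (chA phi phi' q)^T *m spos phi' a q *m chA phi phi' q =
  chr phi phi' q *: \sum_b chE phi phi' q a b *: spos phi b q.
Proof.
move=> Oq; apply: (etrans (congruence_inv (chr_neq0 Oq) (levi_unit nb ad Oq)
  (levi_unit nb ad' Oq) (levi_change Oq) (xi_change a Oq))).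
apply: (congr1 ( *:%R _)); rewrite /xi_comb mulmx_suml; apply: eq_bigr => b _.
by rewrite mxE_row -scalemxAl.
Qed.

Lemma sneg_change q a : O q ->
  chr phi phi' q *: sneg phi' a q =
  chA phi phi' q *m (\sum_b conjc (chE phi phi' q a b) *: sneg phi b q) *m
    (chA phi phi' q)^T.
Proof.
move=> Oq; rewrite /sneg scalemxAl (levi_change Oq).
apply: (@mul_congr _ _ _ _ _ _ (conjm (xi_comb phi (row a (chE phi phi' q)) q))).
  have E : conjm (chA phi phi' q)^T = (conjm (chA phi phi' q))^T by exact: conjm_tr.
  by rewrite -E -conjmM (xi_change a Oq) conjmM -E conjmK.
rewrite /xi_comb conjm_sum mulmx_sumr; apply: eq_bigr => b _.
by rewrite mxE_row conjmZ -scalemxAr.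
Qed.

End FrameChangeInverse.

(** * Change of frame to first order *)

Lemma half_scale (F : numFieldType) (k : nat) (c : F) (S : 'M[F]_k) :
  (c / 2)%:M *m S + S *m (c / 2)%:M^T = c *: S.
Proof. by rewrite tr_scalar_mx mul_mx_scalar mul_scalar_mx -scalerDl -splitr. Qed.

Lemma half_linear (F : numFieldType) (c x y : F) :
  - ((c * x + y) / 2) = c * - (x / 2) - y / 2.
Proof. by rewrite mulrDl opprD mulrN mulrA. Qed.

Lemma traceless_linear (F : numFieldType) (k : nat) (c x y : F) (X Y : 'M[F]_k) :
  (c *: X + Y)^T - ((c * x + y) / 2)%:M =
  c *: (X^T - (x / 2)%:M) + (Y^T - (y / 2)%:M).
Proof.
rewrite linearD linearZ /= mulrDl raddfD /= opprD addrACA scalerBr scale_scalar_mx.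
by rewrite mulrA.
Qed.

Lemma solve_sum (V : zmodType) (X Y Z D D' : V) :
  X + D' + Y = Z + D -> D' = D - (X + Y - Z).
Proof.
move=> E; have -> : X + Y = Z + D - D' by rewrite -E addrAC addrK.
by rewrite addrAC [Z + D]addrC addrK opprB addrC subrK.
Qed.

Lemma pos_derivative_alg (F : numFieldType) (k : nat) (a S dS S' dS' : 'M[F]_k) (c : F) :
  (a^T *m S' + 1%:M^T *m dS') *m 1%:M + 1%:M^T *m S' *m a = c *: S + 1 *: dS -> S' = S ->
  dS' = dS - ((a^T - (c / 2)%:M) *m S + S *m (a^T - (c / 2)%:M)^T).
Proof.
rewrite trmx1 !mul1mx mulmx1 scale1r => + ES; rewrite ES => /solve_sum ->.
by rewrite [in RHS]linearB /= trmxK mulmxBl mulmxBr addrACA -opprD half_scale.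
Qed.

Lemma neg_derivative_alg (F : numFieldType) (k : nat) (a S dS S' dS' : 'M[F]_k) (c : F) :
  c *: S' + 1 *: dS' = (a *m S + 1%:M *m dS) *m 1%:M^T + 1%:M *m S *m a^T -> S' = S ->
  dS' = dS - (- ((a^T - (c / 2)%:M)^T *m S) - S *m (a^T - (c / 2)%:M)).
Proof.
rewrite trmx1 !mul1mx mulmx1 scale1r => + ES; rewrite ES [_ + dS]addrC -addrA [RHS]addrC.
rewrite -[c *: S + _]addr0 => /solve_sum ->; rewrite addr0.
have EL : (a^T - (c / 2)%:M)^T = a - (c / 2)%:M^T by rewrite linearB /= trmxK.
rewrite EL mulmxBl mulmxBr -[in RHS]opprD addrACA -opprD.
by rewrite tr_scalar_mx -{2}(tr_scalar_mx _ (c / 2)) half_scale opprB opprK.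
Qed.

Lemma linear_comb (F : pzRingType) (V W : lmodType F) (I : finType) (f : V -> W)
    (c : I -> F) (S : I -> V) : linear f ->
  f (\sum_b c b *: S b) = \sum_b c b *: f (S b).
Proof.
move=> lf; have f0 : f 0 = 0.
  by apply: (addrI (1 *: f 0)); rewrite -lf scaler0 scale1r !addr0.
by elim/big_rec2: _ => // b X Y _ <-; exact: lf.
Qed.

Lemma linear_change (F : pzRingType) (V W : lmodType F) (I : finType) (f : V -> W) (K : V -> V)
    (e e' : I -> F) (S S' : I -> V) : linear f -> linear K ->
  f (\sum_b (e b *: S' b + e' b *: S b) - K (\sum_b e b *: S b)) =
  \sum_b e b *: (f (S' b) - f (K (S b))) + \sum_b e' b *: f (S b).
Proof.
move=> lf lK; have fB X Y : f (X - Y) = f X - f Y.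
  by rewrite -[X - Y]addrC -scaleN1r lf scaleN1r addrC.
rewrite fB linear_comb // linear_comb // big_split /=.
have -> : f (\sum_b e b *: S' b + \sum_b e' b *: S b) =
    \sum_b e b *: f (S' b) + \sum_b e' b *: f (S b).
  have fD X Y : f (X + Y) = f X + f Y by rewrite -[X]scale1r lf !scale1r.
  by rewrite fD; apply: (congr2 +%R); exact: linear_comb.
rewrite addrAC; congr (_ + _); rewrite -sumrB; apply: eq_bigr => b _.
by rewrite scalerBr.
Qed.

Lemma pos_action_linear (F : comPzRingType) (k : nat) (L : 'M[F]_k) :
  linear (fun S : 'M[F]_k => L *m S + S *m L^T).
Proof.
by move=> c S T; rewrite mulmxDr mulmxDl -scalemxAl -scalemxAr scalerDr addrACA.
Qed.

Lemma neg_action_linear (F : comPzRingType) (k : nat) (L : 'M[F]_k) :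
  linear (fun S : 'M[F]_k => - (L^T *m S) - S *m L).
Proof.
move=> c S T; rewrite mulmxDr mulmxDl -scalemxAl -scalemxAr scalerBr scalerN !opprD.
by rewrite addrACA.
Qed.

Lemma cel_pos_linear (R : realType) (s : nat) :
  linear (fun S : 'M[R[i]]_s => cel 0 0 S 0).
Proof. by move=> c S T; rewrite cel_linear mulr0 !scaler0 !addr0. Qed.

Lemma cel_neg_linear (R : realType) (s : nat) :
  linear (fun S : 'M[R[i]]_s => cel 0 0 0 S).
Proof. by move=> c S T; rewrite cel_linear mulr0 !scaler0 !addr0. Qed.

Section FirstOrder.
Variables (R : realType) (m s r : nat).
Variables (U : set (rvec R m)) (H : rvec R m -> set (cvec R m)) (O : set (rvec R m)).
Hypothesis nb : CR_nbhd s r U H O.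
Variables phi phi' : frame R m s r.
Hypotheses (ad : adapted U H O phi) (ad' : adapted U H O phi').
Implicit Types (q y : rvec R m) (v w : cvec R m).
Variable p : rvec R m.
Hypotheses (Op : O p) (A1 : chA phi phi' p = 1%:M) (r1 : chr phi phi' p = 1).

Lemma mdf_chA : mdf (chA phi phi') p.
Proof. by apply: mdf_mul; [exact: (mdf_fmat ad')|exact: (mdf_cf nb ad)]. Qed.

Lemma mdf_chE : mdf (chE phi phi') p.
Proof. by apply: mdf_mul; [exact: (mdf_emat ad')|exact: (mdf_ce nb ad)]. Qed.

Lemma Cdiff_chr : Cdiff (chr phi phi') p.
Proof.
apply: (mdf_mul (F := fg phi') (G := cu phi)); last exact: (mdf_cu nb ad).
by apply: smooth_vf_mdf (ad_g ad') Op.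
Qed.

(** The derivative of the change of frame, as an element of [csp00]. Since [c] acts by
   [- 2 * c] in degree -2, the derivative of [chr] determines [c]; the multiple of the
   identity subtracted from [L] makes the action in degree (-1,1) exactly the
   transposed derivative of [chA]. *)
Definition cgen v : gmat R s :=
  cel (- (cder v (chr phi phi') p / 2))
      ((cder_mx v (chA phi phi') p)^T - (cder v (chr phi phi') p / 2)%:M) 0 0.

Lemma cgen_linear c v w : cgen (c *: v + w) = c *: cgen v + cgen w.
Proof.
have celE (x x' : R[i]) (L L' : 'M[R[i]]_s) : x = x' -> L = L' -> cel x L 0 0 = cel x' L' 0 0.
  by move=> -> ->.
rewrite /cgen cel_linear !scaler0 !addr0 cder_linear cder_mx_linear.
by apply: celE; [exact: half_linear|exact: traceless_linear].
Qed.

Lemma cgen00 v : csp00 (cgen v).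
Proof.
exact: ex_intro _ (- (cder v (chr phi phi') p / 2)) (ex_intro _ _ erefl).
Qed.

Lemma cder_Spos (psi : frame R m s r) : adapted U H O psi -> forall v b,
  cder_mx v (Spos U H psi b) p = cel 0 0 (cder_mx v (spos psi b) p) 0.
Proof.
move=> adp v b; rewrite -cder_cpos; apply: cder_mx_near.
by apply: near_open (nb_open nb) Op _ => y Oy; exact: (Spos_spos nb adp).
Qed.

Lemma cder_Sneg (psi : frame R m s r) : adapted U H O psi -> forall v b,
  cder_mx v (Sneg U H psi b) p = cel 0 0 0 (cder_mx v (sneg psi b) p).
Proof.
move=> adp v b; rewrite -cder_cneg; apply: cder_mx_near.
by apply: near_open (nb_open nb) Op _ => y Oy; exact: (Sneg_sneg nb adp).
Qed.

Lemma spos_p a : spos phi' a p = \sum_b chE phi phi' p a b *: spos phi b p.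
Proof.
have := spos_change nb ad ad' a Op.
by rewrite A1 r1 trmx1 mul1mx mulmx1 scale1r.
Qed.

Lemma sneg_p a : sneg phi' a p = \sum_b conjc (chE phi phi' p a b) *: sneg phi b p.
Proof.
have := sneg_change nb ad ad' a Op.
by rewrite A1 r1 trmx1 mul1mx mulmx1 scale1r.
Qed.

Lemma mdf_comb (c : 'I_r -> rvec R m -> R[i]) (S : 'I_r -> rvec R m -> 'M[R[i]]_s) :
  (forall b, Cdiff (c b) p) -> (forall b, mdf (S b) p) ->
  mdf (fun y => \sum_b c b y *: S b y) p.
Proof. by move=> dc dS; apply: mdf_sum => b; exact: mdfZ. Qed.

Lemma cder_comb v (c : 'I_r -> rvec R m -> R[i]) (S : 'I_r -> rvec R m -> 'M[R[i]]_s) :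
  (forall b, Cdiff (c b) p) -> (forall b, mdf (S b) p) ->
  cder_mx v (fun y => \sum_b c b y *: S b y) p =
  \sum_b (c b p *: cder_mx v (S b) p + cder v (c b) p *: S b p).
Proof.
move=> dc dS; rewrite cder_mx_sum; last by move=> b; exact: mdfZ.
by apply: eq_bigr => b _; rewrite cder_mxZ // addrC.
Qed.

(** The first sum is the effect of the change of frame on the symbols, the second one,
   in the span, that of the change of basis of [K_2]. *)
Lemma cder_Spos_change v a : cder_mx v (Spos U H phi' a) p =
  \sum_b chE phi phi' p a b *: (cder_mx v (Spos U H phi b) p - br (cgen v) (Spos U H phi b p))
  + \sum_b cder v (fun y => chE phi phi' y a b) p *: Spos U H phi b p.
Proof.
have dA := mdf_chA; have dS' := mdf_spos nb ad' a Op.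
have dS b := mdf_spos nb ad b Op; have dE b : Cdiff (fun y => chE phi phi' y a b) p by exact: mdf_chE.
have near_eq : \forall y \near p, (chA phi phi' y)^T *m spos phi' a y *m chA phi phi' y =
    chr phi phi' y *: \sum_b chE phi phi' y a b *: spos phi b y.
  by apply: near_open (nb_open nb) Op _ => y Oy; exact: (spos_change nb ad ad').
have dSum : mdf (fun y => \sum_b chE phi phi' y a b *: spos phi b y) p.
  exact: (mdf_comb dE dS).
have EL := cder_mxM v (mdf_mul (mdf_tr dA) dS') dA.
rewrite (cder_mxM v (mdf_tr dA) dS') cder_mx_tr A1 in EL.
have ER := cder_mxZ v Cdiff_chr dSum.
rewrite (cder_comb v dE dS) r1 in ER.
have E := pos_derivative_alg (etrans (esym EL) (etrans (cder_mx_near v near_eq) ER)) (spos_p a).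
apply: etrans (cder_Spos ad' v a) _.
apply: etrans (congr1 (fun S => cel 0 0 S 0) E) _.
have L1 := linear_change (fun b => chE phi phi' p a b)
  (fun b => cder v (fun y => chE phi phi' y a b) p) (fun b => spos phi b p)
  (fun b => cder_mx v (spos phi b) p) (@cel_pos_linear R s)
  (pos_action_linear ((cder_mx v (chA phi phi') p)^T - (cder v (chr phi phi') p / 2)%:M)).
apply: etrans L1 _.
apply: (congr2 +%R); apply: eq_bigr => b _; apply: (congr1 ( *:%R _)); last first.
  exact: esym (Spos_spos nb ad b Op).
apply: (congr2 (fun X Y => X - Y)); first exact: esym (cder_Spos ad v b).
by apply: etrans (esym (br_pos _ _ _)) (congr1 (br _) (esym (Spos_spos nb ad b Op))).
Qed.

Lemma cder_Sneg_change v a : cder_mx v (Sneg U H phi' a) p =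
  \sum_b conjc (chE phi phi' p a b) *:
    (cder_mx v (Sneg U H phi b) p - br (cgen v) (Sneg U H phi b p))
  + \sum_b cder v (fun y => conjc (chE phi phi' y a b)) p *: Sneg U H phi b p.
Proof.
have dA := mdf_chA; have dS' := mdf_sneg nb ad' a Op.
have dS b := mdf_sneg nb ad b Op.
have dE b : Cdiff (fun y => conjc (chE phi phi' y a b)) p by apply: Cdiff_conj; exact: mdf_chE.
have near_eq : \forall y \near p, chr phi phi' y *: sneg phi' a y =
    chA phi phi' y *m (\sum_b conjc (chE phi phi' y a b) *: sneg phi b y) *m
      (chA phi phi' y)^T.
  by apply: near_open (nb_open nb) Op _ => y Oy; exact: (sneg_change nb ad ad').
have dSum : mdf (fun y => \sum_b conjc (chE phi phi' y a b) *: sneg phi b y) p.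
  exact: (mdf_comb dE dS).
have ER := cder_mxM v (mdf_mul dA dSum) (mdf_tr dA).
rewrite (cder_mxM v dA dSum) cder_mx_tr A1 (cder_comb v dE dS) in ER.
have EL := cder_mxZ v Cdiff_chr dS'; rewrite r1 in EL.
have E := neg_derivative_alg (etrans (esym EL) (etrans (cder_mx_near v near_eq) ER)) (sneg_p a).
apply: etrans (cder_Sneg ad' v a) _.
apply: etrans (congr1 (fun S => cel 0 0 0 S) E) _.
have L1 := linear_change (fun b => conjc (chE phi phi' p a b))
  (fun b => cder v (fun y => conjc (chE phi phi' y a b)) p) (fun b => sneg phi b p)
  (fun b => cder_mx v (sneg phi b) p) (@cel_neg_linear R s)
  (neg_action_linear ((cder_mx v (chA phi phi') p)^T - (cder v (chr phi phi') p / 2)%:M)).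
apply: etrans L1 _.
apply: (congr2 +%R); apply: eq_bigr => b _; apply: (congr1 ( *:%R _)); last first.
  exact: esym (Sneg_sneg nb ad b Op).
apply: (congr2 (fun X Y => X - Y)); first exact: esym (cder_Sneg ad v b).
by apply: etrans (esym (br_neg _ _ _)) (congr1 (br _) (esym (Sneg_sneg nb ad b Op))).
Qed.

End FirstOrder.

(** * The bilinear maps of a section under a change of frame *)

Section Spans.
Variables (F : fieldType) (V : lmodType F) (r : nat).
Implicit Types (S T D : 'I_r -> V) (c : 'I_r -> F) (X Y : V).

Definition in_span S X := exists c, X = \sum_a c a *: S a.

Lemma in_spanD S X Y : in_span S X -> in_span S Y -> in_span S (X + Y).
Proof.
move=> [c ->] [d ->]; exists (fun a => c a + d a); rewrite -big_split /=.
by apply: eq_bigr => a _; rewrite scalerDl.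
Qed.

Lemma in_spanZ S k X : in_span S X -> in_span S (k *: X).
Proof.
move=> [c ->]; exists (fun a => k * c a); rewrite scaler_sumr.
by apply: eq_bigr => a _; rewrite scalerA.
Qed.

Lemma in_spanN S X : in_span S X -> in_span S (- X).
Proof. by rewrite -scaleN1r; exact: in_spanZ. Qed.

Lemma in_span_comb S c : in_span S (\sum_a c a *: S a).
Proof. by exists c. Qed.

Lemma comb_exchange (e : 'M[F]_r) c S :
  \sum_a c a *: \sum_b e a b *: S b = \sum_b (\sum_a c a * e a b) *: S b.
Proof.
under eq_bigr do rewrite scaler_sumr; rewrite exchange_big /=; apply: eq_bigr => b _.
by rewrite scaler_suml; apply: eq_bigr => a _; rewrite scalerA.
Qed.

Lemma comb_delta S b : \sum_a (a == b)%:R *: S a = S b.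
Proof.
rewrite (bigD1 b) //= eqxx scale1r big1 ?addr0 // => a /negbTE ->.
by rewrite scale0r.
Qed.

Variables (T D T' D' : 'I_r -> V) (e f : 'M[F]_r) (K : V -> V).
Hypotheses (eu : e \in unitmx) (lK : linear K).
Hypothesis ET : forall a, T' a = \sum_b e a b *: T b.
Hypothesis ED : forall a,
  D' a = \sum_b e a b *: (D b - K (T b)) + \sum_b f a b *: T b.
Hypothesis relD : forall c, \sum_a c a *: T a = 0 -> in_span T (\sum_a c a *: D a).

Lemma einv b a : \sum_k invmx e b k * e k a = (a == b)%:R.
Proof. by have /matrixP/(_ b a) := mulVmx eu; rewrite !mxE eq_sym. Qed.

(** Both families span the same space because [e] is invertible. *)
Lemma span_change X : in_span T' X <-> in_span T X.
Proof.
split=> [[c ->]|[c ->]].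
  by rewrite (eq_bigr (fun a => c a *: \sum_b e a b *: T b)) ?comb_exchange;
     [exact: in_span_comb | move=> a _; rewrite ET].
have Tb b : in_span T' (T b).
  exists (fun a => invmx e b a); under eq_bigr do rewrite ET.
  by rewrite comb_exchange; under eq_bigr do rewrite einv; rewrite comb_delta.
elim/big_ind: _ => [|X1 X2|a _]; [|exact: in_spanD|exact: in_spanZ].
by exists (fun=> 0); rewrite big1 // => a _; rewrite scale0r.
Qed.

Lemma comb_change c (c' := fun b => \sum_a c a * e a b) :
  \sum_a c a *: D' a = \sum_b c' b *: D b - K (\sum_b c' b *: T b)
     + \sum_b (\sum_a c a * f a b) *: T b.
Proof.
under eq_bigr do rewrite ED scalerDr.
rewrite big_split /= !comb_exchange; congr (_ + _).
rewrite (linear_comb c' T lK) -sumrB; apply: eq_bigr => b _.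
by rewrite scalerBr.
Qed.

(** A relation between the [T b] changes the value of the quotient map only by an
   element of the span, by [relD]; so the value may be computed with any coefficients,
   for example those from the inverse of [e]. *)
Lemma quotient_map_change b Y :
  (exists c, T b = \sum_a c a *: T' a /\ in_span T' (Y - \sum_a c a *: D' a)) <->
  in_span T (Y - (D b - K (T b))).
Proof.
split=> [[c [Tb /span_change SY]]|SY]; last first.
  have cE a : \sum_k invmx e b k * e k a = (a == b)%:R by exact: einv.
  exists (fun a => invmx e b a); split.
    under eq_bigr do rewrite ET.
    by rewrite comb_exchange; under eq_bigr do rewrite einv; rewrite comb_delta.
  apply/span_change; rewrite comb_change.
  have -> : \sum_b0 (\sum_a invmx e b a * e a b0) *: D b0 = D b.
    by under eq_bigr do rewrite einv; rewrite comb_delta.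
  have -> : \sum_b0 (\sum_a invmx e b a * e a b0) *: T b0 = T b.
    by under eq_bigr do rewrite einv; rewrite comb_delta.
  by rewrite opprD addrA; apply: in_spanD => //; apply: in_spanN; exact: in_span_comb.
pose c' a := \sum_k c k * e k a.
have Tb' : \sum_a c' a *: T a = T b.
  by rewrite Tb -comb_exchange; apply: eq_bigr => a _; rewrite ET.
have SD : in_span T (\sum_a c' a *: D a - D b).
  have := relD (c := fun a => c' a - (a == b)%:R).
  have E S : \sum_a (c' a - (a == b)%:R) *: S a = \sum_a c' a *: S a - S b.
    by under eq_bigr do rewrite scalerBl; rewrite sumrB comb_delta.
  by rewrite !E; apply; rewrite Tb' subrr.
rewrite comb_change -/c' Tb' in SY.
have -> : Y - (D b - K (T b)) = (Y - (\sum_a c' a *: D a - K (T b)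
    + \sum_b0 (\sum_a c a * f a b0) *: T b0)) + (\sum_a c' a *: D a - D b)
    + \sum_b0 (\sum_a c a * f a b0) *: T b0.
  move: (\sum_a _ *: D a) (\sum_b0 _ *: T b0) (D b) (K _) => d t db k.
  by rewrite [RHS]addrAC (opprD (d - k)) (addrA Y) subrK !opprB -addrA (addrA (k - d)) subrK.
by apply: in_spanD; [exact: in_spanD|exact: in_span_comb].
Qed.

End Spans.

Section OMaps.
Variables (R : realType) (m s r : nat).
Variables (U : set (rvec R m)) (H : rvec R m -> set (cvec R m)) (O : set (rvec R m)).
Hypothesis nb : CR_nbhd s r U H O.
Variables (p : rvec R m).
Hypothesis Op : O p.
Implicit Types (v w : cvec R m).

Section Relations.
Variable phi : frame R m s r.
Hypothesis ad : adapted U H O phi.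
Implicit Types (c : 'I_r -> R[i]).

Lemma xi_combE c q : xi_comb phi (\row_a c a) q = \sum_a c a *: xi phi a q.
Proof. by apply: eq_bigr => a _; rewrite mxE. Qed.

Lemma spos_levi a : spos phi a p *m levi phi p = xi phi a p.
Proof. by rewrite /spos mulmxKV //; exact: (levi_unit nb ad Op). Qed.

Lemma cder_xi v a : cder_mx v (xi phi a) p =
  cder_mx v (spos phi a) p *m levi phi p + spos phi a p *m cder_mx v (levi phi) p.
Proof.
have E := cder_mxM v (mdf_spos nb ad a Op) (mdf_levi nb ad Op).
apply: etrans _ E; apply: cder_mx_near.
apply: near_open (nb_open nb) Op _ => y Oy; rewrite /spos mulmxKV //.
exact: (levi_unit nb ad Oy).
Qed.

Lemma cder_sneg v a : cder_mx v (sneg phi a) p =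
  cder_mx v (levi phi) p *m conjm (xi phi a p)
  + levi phi p *m conjm (cder_mx (conjm v) (xi phi a) p).
Proof.
have dxi := mdf_xi nb ad a Op.
have E := cder_mxM v (mdf_levi nb ad Op) (mdf_conj dxi).
by rewrite (cder_mx_conj v dxi) in E; exact: E.
Qed.

Lemma comb_mull c (S : 'I_r -> 'M[R[i]]_s) (B : 'M[R[i]]_s) :
  (\sum_a c a *: S a) *m B = \sum_a c a *: (S a *m B).
Proof. by rewrite mulmx_suml; apply: eq_bigr => a _; rewrite scalemxAl. Qed.

Lemma comb_mulr c (S : 'I_r -> 'M[R[i]]_s) (B : 'M[R[i]]_s) :
  B *m (\sum_a c a *: S a) = \sum_a c a *: (B *m S a).
Proof. by rewrite mulmx_sumr; apply: eq_bigr => a _; rewrite scalemxAr. Qed.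

Lemma comb_addr c (S S' : 'I_r -> 'M[R[i]]_s) :
  \sum_a c a *: (S a + S' a) = \sum_a c a *: S a + \sum_a c a *: S' a.
Proof. by rewrite -big_split /=; apply: eq_bigr => a _; rewrite scalerDr. Qed.

Lemma comb_conj c (S : 'I_r -> 'M[R[i]]_s) :
  \sum_a c a *: conjm (S a) = conjm (\sum_a conjc (c a) *: S a).
Proof. by rewrite conjm_sum; apply: eq_bigr => a _; rewrite conjmZ conjcK. Qed.

(** The kernel of iota has constant rank, so that a relation between the values at [p]
   continues to nearby points, to first order, by relations modulo the span. *)
Lemma spos_relation v c : \sum_a c a *: spos phi a p = 0 ->
  in_span (fun a => spos phi a p) (\sum_a c a *: cder_mx v (spos phi a) p).
Proof.
move=> E; have Lu := levi_unit nb ad Op.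
have X0 : xi_comb phi (\row_a c a) p = 0.
  have E0 : (\sum_a c a *: spos phi a p) *m levi phi p = 0 by rewrite E mul0mx.
  rewrite xi_combE; rewrite comb_mull in E0; apply: etrans _ E0.
  by apply: eq_bigr => a _; rewrite spos_levi.
have [d Ed] := xi_relation nb ad v Op X0; exists (fun a => d 0 a).
apply: (can_inj (mulmxK Lu)); rewrite !comb_mull.
apply: (etrans _ (etrans Ed _)); last by apply: eq_bigr => a _; rewrite spos_levi.
have E1 : \sum_a (\row_a c a) 0 a *: cder_mx v (xi phi a) p =
    \sum_a c a *: cder_mx v (xi phi a) p by apply: eq_bigr => a _; rewrite mxE.
rewrite E1; under [RHS]eq_bigr => a _ do rewrite cder_xi.
by rewrite comb_addr -(comb_mull c (fun a => spos phi a p)) E mul0mx addr0.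
Qed.

Lemma sneg_relation v c : \sum_a c a *: sneg phi a p = 0 ->
  in_span (fun a => sneg phi a p) (\sum_a c a *: cder_mx v (sneg phi a) p).
Proof.
move=> E; have Lu := levi_unit nb ad Op.
have X1 : \sum_a c a *: conjm (xi phi a p) = 0.
  by apply: (can_inj (mulKmx Lu)); rewrite mulmx0 comb_mulr.
have X0 : xi_comb phi (\row_a conjc (c a)) p = 0.
  by rewrite xi_combE; apply: (can_inj (@conjmK _ _ _)); rewrite -comb_conj X1 conjm0.
have [d Ed] := xi_relation nb ad (conjm v) Op X0; exists (fun a => conjc (d 0 a)).
under eq_bigr => a _ do rewrite cder_sneg.
rewrite comb_addr -(comb_mulr c (fun a => conjm (xi phi a p))) X1 mulmx0 add0r.
rewrite -(comb_mulr c) -(comb_mulr (fun a => conjc (d 0 a))); apply: (congr1 (mulmx _)).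
rewrite !comb_conj; apply: (congr1 (@conjm _ _ _)).
apply: (etrans _ (etrans Ed _)); apply: eq_bigr => a _; first by rewrite mxE.
by rewrite conjcK.
Qed.

Lemma Spos_relation v c : \sum_a c a *: Spos U H phi a p = 0 ->
  in_span (fun a => Spos U H phi a p) (\sum_a c a *: cder_mx v (Spos U H phi a) p).
Proof.
have E (d : 'I_r -> R[i]) (S : 'I_r -> gmat R s) (T : 'I_r -> 'M[R[i]]_s) :
    (forall a, S a = cel 0 0 (T a) 0) ->
    \sum_a d a *: S a = cel 0 0 (\sum_a d a *: T a) 0.
  move=> ST; apply: etrans (esym (linear_comb d T (@cel_pos_linear R s))).
  by apply: eq_bigr => a _; rewrite ST.
rewrite (E _ _ _ (fun a => Spos_spos nb ad a Op)) (E _ _ _ (cder_Spos nb Op ad v)) => E0.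
have /(spos_relation v)[d Ed] : \sum_a c a *: spos phi a p = 0.
  have : cel 0 0 (\sum_a c a *: spos phi a p) 0 = cel 0 0 0 0 :> gmat R s.
    by rewrite E0 cposE row_mx0 !block_mx0.
  by move=> /gm_inj[_ _ _ _ []].
by exists d; rewrite (E _ _ _ (fun a => Spos_spos nb ad a Op)) Ed.
Qed.

Lemma Sneg_relation v c : \sum_a c a *: Sneg U H phi a p = 0 ->
  in_span (fun a => Sneg U H phi a p) (\sum_a c a *: cder_mx v (Sneg U H phi a) p).
Proof.
have E (d : 'I_r -> R[i]) (S : 'I_r -> gmat R s) (T : 'I_r -> 'M[R[i]]_s) :
    (forall a, S a = cel 0 0 0 (T a)) ->
    \sum_a d a *: S a = cel 0 0 0 (\sum_a d a *: T a).
  move=> ST; apply: etrans (esym (linear_comb d T (@cel_neg_linear R s))).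
  by apply: eq_bigr => a _; rewrite ST.
rewrite (E _ _ _ (fun a => Sneg_sneg nb ad a Op)) (E _ _ _ (cder_Sneg nb Op ad v)) => E0.
have /(sneg_relation v)[d Ed] : \sum_a c a *: sneg phi a p = 0.
  have : cel 0 0 0 (\sum_a c a *: sneg phi a p) = cel 0 0 0 0 :> gmat R s.
    by rewrite E0 cnegE col_mx0 !block_mx0.
  by move=> /gm_inj[_ _ _ _ []].
by exists d; rewrite (E _ _ _ (fun a => Sneg_sneg nb ad a Op)) Ed.
Qed.

End Relations.

Section Maps.
Variables phi phi' : frame R m s r.
Hypotheses (ad : adapted U H O phi) (ad' : adapted U H O phi').
Hypotheses (A1 : chA phi phi' p = 1%:M) (r1 : chr phi phi' p = 1).

Lemma br_linear (C : gmat R s) : linear (br C).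
Proof. by move=> c X Y; exact: br_linearr. Qed.

Lemma conjE_unit : conjm (chE phi phi' p) \in unitmx.
Proof. by rewrite conjm_unit; exact: (chE_unit nb ad ad' Op). Qed.

Lemma Spos_p a : Spos U H phi' a p = \sum_b chE phi phi' p a b *: Spos U H phi b p.
Proof.
rewrite (Spos_spos nb ad' a Op) (spos_p nb ad ad' Op A1 r1).
apply: etrans (linear_comb _ _ (@cel_pos_linear R s)) _.
by apply: eq_bigr => b _; rewrite (Spos_spos nb ad b Op).
Qed.

Lemma Sneg_p a : Sneg U H phi' a p =
  \sum_b conjm (chE phi phi' p) a b *: Sneg U H phi b p.
Proof.
rewrite (Sneg_sneg nb ad' a Op) (sneg_p nb ad ad' Op A1 r1).
apply: etrans (linear_comb _ _ (@cel_neg_linear R s)) _.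
by apply: eq_bigr => b _; rewrite (Sneg_sneg nb ad b Op) conjmE.
Qed.

Lemma gpos_change : gpos U H phi' p = gpos U H phi p.
Proof.
have Q X := span_change (chE_unit nb ad ad' Op) Spos_p X.
by apply/seteqP; split=> X HX; [exact: (Q X).1 HX|exact: (Q X).2 HX].
Qed.

Lemma gneg_change : gneg U H phi' p = gneg U H phi p.
Proof.
have Q X := span_change conjE_unit Sneg_p X.
by apply/seteqP; split=> X HX; [exact: (Q X).1 HX|exact: (Q X).2 HX].
Qed.

Lemma Opos_change v b : Kb U H 2 p v -> Opos U H phi' p v (Spos U H phi b p) =
  mcoset (cder_mx v (Spos U H phi b) p - br (cgen phi phi' p v) (Spos U H phi b p))
    (gpos U H phi p).
Proof.
move=> Kv; have ED a : cder_mx v (Spos U H phi' a) p =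
    \sum_b chE phi phi' p a b *: (cder_mx v (Spos U H phi b) p
                                  - br (cgen phi phi' p v) (Spos U H phi b p))
    + \sum_b (\matrix_(a, b) cder v (fun y => chE phi phi' y a b) p) a b *: Spos U H phi b p.
  apply: etrans (cder_Spos_change nb ad ad' Op A1 r1 v a) _.
  apply: (congr2 +%R (erefl _)).
  by apply: eq_bigr => b' _; rewrite mxE.
have Q Y := quotient_map_change (chE_unit nb ad ad' Op) (br_linear (cgen phi phi' p v))
  Spos_p ED (fun c => Spos_relation ad v (c := c)) b Y.
apply/seteqP; split=> Y; first by move=> [_ SY]; exact: (Q Y).1 SY.
by move=> SY; split=> //; exact: (Q Y).2 SY.
Qed.

Lemma Oneg_change v b : Kb U H 2 p v -> Oneg U H phi' p v (Sneg U H phi b p) =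
  mcoset (cder_mx v (Sneg U H phi b) p - br (cgen phi phi' p v) (Sneg U H phi b p))
    (gneg U H phi p).
Proof.
move=> Kv; have ED a : cder_mx v (Sneg U H phi' a) p =
    \sum_b conjm (chE phi phi' p) a b *: (cder_mx v (Sneg U H phi b) p
                                  - br (cgen phi phi' p v) (Sneg U H phi b p))
    + \sum_b (\matrix_(a, b) cder v (fun y => conjc (chE phi phi' y a b)) p) a b
        *: Sneg U H phi b p.
  apply: etrans (cder_Sneg_change nb ad ad' Op A1 r1 v a) _.
  apply: (congr2 +%R); apply: eq_bigr => b' _; first by rewrite conjmE.
  by rewrite [X in _ = X *: _]mxE.
have Q Y := quotient_map_change conjE_unit (br_linear (cgen phi phi' p v))
  Sneg_p ED (fun c => Sneg_relation ad v (c := c)) b Y.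
apply/seteqP; split=> Y; first by move=> [_ SY]; exact: (Q Y).1 SY.
by move=> SY; split=> //; exact: (Q Y).2 SY.
Qed.

End Maps.
End OMaps.

(** * Sections with the same value at a point *)

Section Restriction.
Variables (R : realType) (m s r : nat).
Variables (U : set (rvec R m)) (H : rvec R m -> set (cvec R m)) (O O' : set (rvec R m)).
Hypothesis OO' : O' `<=` O.

Lemma adaptedS (phi : frame R m s r) : adapted U H O phi -> adapted U H O' phi.
Proof.
move=> [ag af ae gb eb fb]; split.
- exact: smooth_vfS OO' ag.
- by move=> k; exact: sectionS OO' (af k).
- by move=> a; exact: sectionS OO' (ae a).
- by move=> x /OO'; exact: gb.
- by move=> x /OO'; exact: eb.
- by move=> x /OO'; exact: fb.
Qed.

Lemma CR_nbhdS : open O' -> CR_nbhd s r U H O -> CR_nbhd s r U H O'.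
Proof.
move=> oO' [oO OU dm inv tot kc [t K3]]; split=> //.
- by move=> y /OO'; exact: OU.
- by move=> V X Y oV VO'; apply: inv oV _; exact: subset_trans VO' OO'.
- by move=> x v /OO'; exact: tot.
- by move=> V X Y oV VO'; apply: kc oV _; exact: subset_trans VO' OO'.
- by exists t => x /OO'; exact: K3.
Qed.

End Restriction.

Section SameValue.
Variables (R : realType) (m s r : nat).
Variables (U : set (rvec R m)) (H : rvec R m -> set (cvec R m)) (O : set (rvec R m)).
Hypothesis nb : CR_nbhd s r U H O.
Variables (p : rvec R m) (phi phi' : frame R m s r).
Hypotheses (Op : O p) (ad : adapted U H O phi) (ad' : adapted U H O phi').

(** A symbol isomorphism determines the classes of [f] and [g] by their values. *)
Lemma same_iso_ch : same_iso U H p phi phi' ->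
  chA phi phi' p = 1%:M /\ chr phi phi' p = 1.
Proof.
move=> [tau [/(iso_valuesP nb ad _ Op)[vu v1 _] [_ g1 f1]]]; split; last first.
  by apply: etrans g1; exact: esym (vu _).
apply/row_matrixP => k; rewrite row_chA row1.
have Hk : H p (ff phi' k p) by have [_] := ad_f ad' k; apply.
by apply: trmx_inj; rewrite trmx_delta; apply: etrans (f1 k); exact: esym (v1 _ Hk).
Qed.

(** At the point, the frames have the same dual coframe modulo the Levi kernel and the
   same Levi matrix, by [levi_change]. *)
Lemma frame_iso_eq : same_iso U H p phi phi' ->
  frame_iso U H phi p = frame_iso U H phi' p.
Proof.
move=> /same_iso_ch[A1 r1].
have L1 : levi phi' p = levi phi p.
  have := levi_change nb ad ad' Op.
  by rewrite A1 r1 conjm1 trmx1 mul1mx mulmx1 scale1r.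
have Eu (v : cvec R m) : (v *m cu phi p) 0 0 = (v *m cu phi' p) 0 0.
  by have := ch_cu nb ad ad' v Op; rewrite r1 mul1r.
have E1 v : H p v -> v *m cf phi p = v *m cf phi' p.
  move=> Hv; have HHv : Hc H p v.
    by apply/(Hc_cu nb ad _ Op); have [] := H_coord nb ad Op Hv.
  by have := ch_cf nb ad ad' Op HHv; rewrite A1 mulmx1.
have E2 v : conjset (H p) v -> v *m cfb phi p = v *m cfb phi' p.
  by move=> Hv; have := ch_cfb nb ad ad' Op Hv; rewrite A1 conjm1 mulmx1.
apply/seteqP; split=> tau.
- move=> /(iso_valuesP nb ad _ Op)[vu v1 v2]; apply/(iso_valuesP nb ad' _ Op); split.
  + by move=> v; rewrite vu.
  + by move=> v Hv; have X := E1 v Hv; have Y := v1 v Hv; rewrite -X; exact: Y.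
  + move=> v Hv; have X := E2 v Hv; have Y := v2 v Hv.
    by rewrite L1 -X; exact: Y.
- move=> /(iso_valuesP nb ad' _ Op)[vu v1 v2]; apply/(iso_valuesP nb ad _ Op); split.
  + by move=> v; rewrite Eu.
  + by move=> v Hv; have X := E1 v Hv; have Y := v1 v Hv; rewrite X; exact: Y.
  + move=> v Hv; have X := E2 v Hv; have Y := v2 v Hv.
    by rewrite -L1 X; exact: Y.
Qed.

Lemma sym_relP q w2 w1 w1' (X : gmat R s) : O q ->
  sym_rel U H phi q w2 w1 w1' X <->
  [/\ H q w1, conjset (H q) w1' &
      X = hel ((w2 *m cu phi q) 0 0) (w1 *m cf phi q)^T
              (levi phi q *m (w1' *m cfb phi q)^T)].
Proof.
move=> Oq; split=> [[Hw Hw' [tau [/(iso_valuesP nb ad _ Oq)[vu v1 v2] ->]]]|[Hw Hw' ->]].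
  have E1 := v1 w1 Hw; have E2 := v2 w1' Hw'.
  by split; [exact: Hw|exact: Hw'|rewrite vu E1 E2].
split=> //; exists (iso0 phi q); split.
  by apply/(iso_valuesP nb ad _ Oq); exact: iso0_values.
have [vu v1 v2] := iso0_values H phi q.
have E1 := v1 w1 Hw; have E2 := v2 w1' Hw'.
by rewrite vu E1 E2.
Qed.

End SameValue.

Section SameSymbols.
Variables (R : realType) (m s r : nat).
Variables (U : set (rvec R m)) (H : rvec R m -> set (cvec R m)) (p : rvec R m).
Variables phi phi' : frame R m s r.
Hypothesis E : frame_iso U H phi p = frame_iso U H phi' p.

Lemma sym_rel_eq : sym_rel U H phi p = sym_rel U H phi' p :> (_ -> _ -> _ -> gmat R s -> Prop).
Proof. by rewrite /sym_rel E. Qed.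

Lemma conj_der_eq : conj_der U H phi p = conj_der U H phi' p :> (gmat R s -> _).
Proof. by rewrite /conj_der /conj_rel sym_rel_eq. Qed.

Lemma Oclass_eq : Oclass U H phi p = Oclass U H phi' p.
Proof. by rewrite /Oclass /extension /same_iso E. Qed.

End SameSymbols.

(** * Transport along the leaves *)

Lemma cancel_w (F : fieldType) (k : nat) (A A' L L' B : 'M[F]_k) (c : F) (w x : 'cV[F]_k) :
  c != 0 -> A *m A' = 1%:M -> c *: L' = A *m L *m B ->
  c *: (A' *m w) = L *m (B *m x) -> w = L' *m x.
Proof.
move=> c0 AA EL E; apply: (scalerI c0); rewrite scalemxAl EL -!mulmxA -E.
by rewrite -scalemxAr mulmxA AA mul1mx.
Qed.

Lemma hel_congr (R : realType) (s : nat) (x y : R[i]) (a b d e : 'cV[R[i]]_s) :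
  x = y -> a = b -> d = e -> hel x a d = hel y b e.
Proof. by move=> -> -> ->. Qed.

Section Transport.
Variables (R : realType) (m m' s r : nat).
Variables (U : set (rvec R m)) (H : rvec R m -> set (cvec R m)) (O : set (rvec R m)).
Hypothesis nb : CR_nbhd s r U H O.
Variables (p : rvec R m) (prj : rvec R m -> rvec R m').
Hypothesis Op : O p.
Hypothesis kp : forall v, cdiff prj p v = 0 -> Kc U H p v.
Variable phi : frame R m s r.
Hypothesis ad : adapted U H O phi.
Implicit Types (q : rvec R m) (X Y : gmat R s).

Lemma cdiff_linear q c v w : cdiff prj q (c *: v + w) = c *: cdiff prj q v + cdiff prj q w.
Proof.
apply/rowP => k; rewrite [RHS]mxE [X in _ = X + _]mxE !cdiffE; exact: cder_linear.
Qed.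

Lemma H_linear q c v w : O q -> H q v -> H q w -> H q (c *: v + w).
Proof.
move=> Oq /(memH ad _ Oq) Hv /(memH ad _ Oq) Hw; apply/(memH ad _ Oq).
exact: addmx_sub (scalemx_sub _ Hv) Hw.
Qed.

Lemma Hb_linear q c v w : O q ->
  conjset (H q) v -> conjset (H q) w -> conjset (H q) (c *: v + w).
Proof.
move=> Oq /(memHb ad _ Oq) Hv /(memHb ad _ Oq) Hw; apply/(memHb ad _ Oq).
exact: addmx_sub (scalemx_sub _ Hv) Hw.
Qed.

Lemma Hc_linear q c v w : O q -> Hc H q v -> Hc H q w -> Hc H q (c *: v + w).
Proof.
move=> Oq /(memHc ad _ Oq) Hv /(memHc ad _ Oq) Hw; apply/(memHc ad _ Oq).
exact: addmx_sub (scalemx_sub _ Hv) Hw.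
Qed.

Lemma sym_rel_linear q c w2 w1 w1' X z2 z1 z1' Y : O q ->
  sym_rel U H phi q w2 w1 w1' X -> sym_rel U H phi q z2 z1 z1' Y ->
  sym_rel U H phi q (c *: w2 + z2) (c *: w1 + z1) (c *: w1' + z1') (c *: X + Y).
Proof.
move=> Oq /(sym_relP nb ad _ _ _ _ Oq)[Hw Hw' ->] /(sym_relP nb ad _ _ _ _ Oq)[Hz Hz' ->].
apply/(sym_relP nb ad _ _ _ _ Oq); split; [exact: H_linear|exact: Hb_linear|].
apply: etrans (hel_linear _ _ _ _ _ _ _) _.
apply: hel_congr.
- by rewrite mulmxDl -scalemxAl [RHS]mxE [X in _ = X + _]mxE.
- by rewrite mulmxDl -scalemxAl linearD linearZ.
- by rewrite mulmxDl -scalemxAl linearD linearZ /= mulmxDr -scalemxAr.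
Qed.

Lemma sym_rel0 q : O q -> sym_rel U H phi q 0 0 0 0.
Proof.
move=> Oq; apply/(sym_relP nb ad _ _ _ _ Oq); split.
- by apply/(memH ad _ Oq); exact: sub0mx.
- by apply/(memHb ad _ Oq); exact: sub0mx.
- by rewrite !mul0mx !trmx0 mulmx0 mxE helE mul0r !(raddf0 (@scalar_mx _ 1)) trmx0 oppr0 !col_mx0 !block_mx0.
Qed.

Lemma transport_linear q c X X' Y Y' : O q ->
  transport U H prj phi p q X Y -> transport U H prj phi p q X' Y' ->
  transport U H prj phi p q (c *: X + X') (c *: Y + Y').
Proof.
move=> Oq [w2 [w1 [w1' [z2 [z1 [z1' [SX SY [d Hd E2] E1]]]]]]].
move=> [y2 [y1 [y1' [x2 [x1 [x1' [SX' SY' [d' Hd' E2'] E1']]]]]]].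
exists (c *: w2 + y2), (c *: w1 + y1), (c *: w1' + y1').
exists (c *: z2 + x2), (c *: z1 + x1), (c *: z1' + x1'); split.
- exact: sym_rel_linear.
- exact: sym_rel_linear.
- exists (c *: d + d'); first exact: Hc_linear.
  rewrite cdiff_linear E2 E2' -cdiff_linear; apply: (congr1 (cdiff prj p)).
  by rewrite scalerDr addrACA.
- have E (a b a' b' : cvec R m) : c *: a + b + (c *: a' + b') = c *: (a + a') + (b + b').
    by rewrite addrACA -scalerDr.
  by rewrite !E !cdiff_linear E1 E1'.
Qed.

Lemma transport0 q : O q -> transport U H prj phi p q 0 0.
Proof.
move=> Oq; exists 0, 0, 0, 0, 0, 0; split; [exact: sym_rel0|exact: sym_rel0| |].
  exists 0; first by apply/(memHc ad _ Op); exact: sub0mx.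
  have E q' : cdiff prj q' 0 = 0.
    by apply/rowP => k; rewrite !mxE big1 // => j _; rewrite mxE mul0r.
  by rewrite addr0 !E.
have E q' : cdiff prj q' 0 = 0.
  by apply/rowP => k; rewrite !mxE big1 // => j _; rewrite mxE mul0r.
by rewrite addr0 !E.
Qed.

Lemma transport_comb q (I : finType) (c : I -> R[i]) (X Y : I -> gmat R s) : O q ->
  (forall k, transport U H prj phi p q (X k) (Y k)) ->
  transport U H prj phi p q (\sum_k c k *: X k) (\sum_k c k *: Y k).
Proof.
move=> Oq XY; elim/big_rec2: _ => [|k A B _ AB]; first exact: transport0.
exact: transport_linear.
Qed.

(** At the base point the transport is the identity, since the differential of the
   projection is injective modulo its kernel. *)
Lemma transport_refl X Y : transport U H prj phi p p X Y -> X = Y.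
Proof.
move=> [w2 [w1 [w1' [z2 [z1 [z1' [SX SY [d Hd E2] E1]]]]]]].
have [Hw Hw' ->] := (sym_relP nb ad _ _ _ _ Op).1 SX.
have [Hz Hz' ->] := (sym_relP nb ad _ _ _ _ Op).1 SY.
have sub v w : cdiff prj p v = cdiff prj p w -> Kc U H p (- w + v).
  by move=> E; apply: kp; rewrite -scaleN1r cdiff_linear E scaleN1r addNr.
have [_ _ u0] := Kc_coord nb ad Op (sub _ _ E2).
have [k1 k2 _] := Kc_coord nb ad Op (sub _ _ E1).
have du := (Hc_cu nb ad _ Op).1 Hd.
have [_ b1 _ _] := H_coord nb ad Op Hw; have [_ b2 _ _] := H_coord nb ad Op Hz.
have [_ a1 _ _] := Hb_coord nb ad Op Hw'; have [_ a2 _ _] := Hb_coord nb ad Op Hz'.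
have e2 : w2 *m cu phi p = z2 *m cu phi p.
  by move: u0; rewrite mulmxDl mulNmx mulmxDl du addr0 addrC => /subr0_eq.
have e1 : w1 *m cf phi p = z1 *m cf phi p.
  by move: k1; rewrite mulmxDl mulNmx !mulmxDl a1 a2 !addr0 addrC => /subr0_eq.
have e3 : w1' *m cfb phi p = z1' *m cfb phi p.
  by move: k2; rewrite mulmxDl mulNmx !mulmxDl b1 b2 !add0r addrC => /subr0_eq.
by rewrite e1 e2 e3.
Qed.

Variable phi' : frame R m s r.
Hypothesis ad' : adapted U H O phi'.
Hypothesis E : frame_iso U H phi p = frame_iso U H phi' p.

(** The same tangent vectors represent both symbols; only their coordinates in degrees
   -2, (-1,1) and (-1,-1) change, by [chr], the transpose of [chA], and the latter's
   contragredient times [chr]. *)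
Lemma transport_change q u v w Y : O q ->
  transport U H prj phi p q
    (hel (chr phi phi' q * u) ((chA phi phi' q)^T *m v)
         (chr phi phi' q *: (chA phi' phi q *m w))) Y ->
  transport U H prj phi' p q (hel u v w) Y.
Proof.
move=> Oq [w2 [w1 [w1' [z2 [z1 [z1' [SX SY Ed E1]]]]]]].
suff SX' : sym_rel U H phi' q w2 w1 w1' (hel u v w).
  exists w2, w1, w1', z2, z1, z1'; split; [exact: SX'| |exact: Ed|exact: E1].
  by rewrite -(sym_rel_eq E); exact: SY.
have [Hw Hw' /gm_inj[Ev Ew Eu _ _]] := (sym_relP nb ad _ _ _ _ Oq).1 SX.
have Hcw : Hc H q w1.
  by apply/(Hc_cu nb ad _ Oq); have [] := H_coord nb ad Oq Hw.
apply/(sym_relP nb ad' _ _ _ _ Oq); split; [exact: Hw|exact: Hw'|].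
apply: hel_congr.
- apply: (mulfI (chr_neq0 nb ad ad' Oq)); apply: etrans Eu _.
  exact: (ch_cu nb ad ad' w2 Oq).
- have Au : (chA phi phi' q)^T \in unitmx by rewrite unitmx_tr; exact: (chA_unit nb ad ad' Oq).
  apply: (can_inj (mulKmx Au)); apply: etrans Ev _.
  apply: etrans (congr1 (fun B : 'M[R[i]]_(1, s) => B^T) (ch_cf nb ad ad' Oq Hcw)) _.
  exact: trmx_mul.
- apply: (cancel_w (chr_neq0 nb ad ad' Oq) (chA_inv nb ad ad' Oq) (levi_change nb ad ad' Oq)).
  apply: etrans Ew _.
  apply: etrans (congr1 (fun B : 'M[R[i]]_(1, s) => levi phi q *m B^T)
    (ch_cfb nb ad ad' Oq Hw')) _.
  apply: (congr1 (mulmx (levi phi q))); exact: trmx_mul.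
Qed.

End Transport.

(** * Derivatives along curves *)

Definition cplxv (R : realType) (m : nat) (v : rvec R m) : cvec R m :=
  map_mx (fun x => x%:C%C) v.

Definition cderiv (R : realType) (f : R -> R[i]) (d : R[i]) : Prop :=
  is_derive (0 : R) 1 (fun t => complex.Re (f t)) (complex.Re d) /\
  is_derive (0 : R) 1 (fun t => complex.Im (f t)) (complex.Im d).

Section Derivatives.
Variable R : realType.
Implicit Types (f g : R -> R[i]).

Lemma is_derive_ext (f g : R -> R) (d d' : R) : (forall t, f t = g t) -> d = d' ->
  is_derive (0 : R) 1 f d -> is_derive (0 : R) 1 g d'.
Proof. by move=> /funext -> ->. Qed.

Lemma cderivD f g d e : cderiv f d -> cderiv g e -> cderiv (fun t => f t + g t) (d + e).
Proof.
move=> [f1 f2] [g1 g2]; split.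
  apply: is_derive_ext (is_deriveD f1 g1) => [t|]; last by rewrite cReD.
  by rewrite cReD.
apply: is_derive_ext (is_deriveD f2 g2) => [t|]; last by rewrite cImD.
by rewrite cImD.
Qed.

Lemma cderivM f g d e : cderiv f d -> cderiv g e ->
  cderiv (fun t => f t * g t) (d * g 0 + f 0 * e).
Proof.
move=> [f1 f2] [g1 g2]; split.
  apply: is_derive_ext (is_deriveB (is_deriveM f1 g1) (is_deriveM f2 g2)) => [t|].
    by rewrite cReM.
  by rewrite cReD !cReM /GRing.scale /=; ring.
apply: is_derive_ext (is_deriveD (is_deriveM f1 g2) (is_deriveM f2 g1)) => [t|].
  by rewrite cImM.
by rewrite cImD !cImM /GRing.scale /=; ring.
Qed.

Lemma cderiv_cst (a : R[i]) : cderiv (fun=> a) 0.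
Proof. by split; exact: is_derive_cst. Qed.

Lemma cderiv_sum (I : Type) (r : seq I) (P : pred I) (f : I -> R -> R[i]) (d : I -> R[i]) :
  (forall k, cderiv (f k) (d k)) ->
  cderiv (fun t => \sum_(k <- r | P k) f k t) (\sum_(k <- r | P k) d k).
Proof.
move=> df; elim: r => [|k r IH].
  by under eq_fun do rewrite big_nil; rewrite big_nil; exact: cderiv_cst.
under eq_fun do rewrite big_cons; rewrite big_cons; case: (P k) => //.
exact: cderivD.
Qed.

Lemma mderive_comb (a b : nat) (I : finType) (c : I -> R -> R[i]) (c' : I -> R[i])
    (Y : I -> R -> 'M[R[i]]_(a, b)) (Y' : I -> 'M[R[i]]_(a, b)) :
  (forall k, cderiv (c k) (c' k)) -> (forall k, is_mderive (Y k) (Y' k)) ->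
  is_mderive (fun t => \sum_k c k t *: Y k t) (\sum_k (c' k *: Y k 0 + c k 0 *: Y' k)).
Proof.
move=> dc dY i j; suff : cderiv (fun t => (\sum_k c k t *: Y k t) i j)
  ((\sum_k (c' k *: Y k 0 + c k 0 *: Y' k)) i j) by [].
under eq_fun do rewrite summxE; rewrite summxE; apply: cderiv_sum => k.
under eq_fun do rewrite mxE; rewrite mxE [X in X + _]mxE [X in _ + X]mxE.
by apply: cderivM; [exact: dc|exact: dY].
Qed.

Lemma cderiv_chain (m : nat) (F : rvec R m -> R[i]) (g : R -> rvec R m) (p v : rvec R m) :
  Cdiff F p -> g 0 = p -> (forall j, is_derive (0 : R) 1 (fun t => g t 0 j) (v 0 j)) ->
  cderiv (fun t => F (g t)) (cder (cplxv v) F p).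
Proof.
move=> [F1 F2] g0 dg; rewrite -g0 in F1 F2; split.
  apply: is_derive_ext (chain_curve F1 dg) => //; rewrite g0 cderE.
  rewrite (big_morph (@complex.Re R) (@cReD R) (erefl : complex.Re 0 = 0)).
  by apply: eq_bigr => j _; rewrite cReM mxE /= mul0r subr0.
apply: is_derive_ext (chain_curve F2 dg) => //; rewrite g0 cderE.
rewrite (big_morph (@complex.Im R) (@cImD R) (erefl : complex.Im 0 = 0)).
by apply: eq_bigr => j _; rewrite cImM mxE /= mul0r addr0.
Qed.

End Derivatives.

Section HeisenbergBasis.
Variables (R : realType) (s : nat).

Definition hidx := ('I_1 + ('I_s + 'I_s))%type.

(** Basis elements of the Heisenberg algebra, by which the transport of any element is
   reduced to finitely many curves. *)
Definition hbas (k : hidx) : gmat R s :=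
  match k with
  | inl _ => hel 1 0 0
  | inr (inl k) => hel 0 (delta_mx k 0) 0
  | inr (inr k) => hel 0 0 (delta_mx k 0)
  end.

Definition hcoef (u : R[i]) (v w : 'cV[R[i]]_s) (k : hidx) : R[i] :=
  match k with
  | inl _ => u
  | inr (inl k) => v k 0
  | inr (inr k) => w k 0
  end.

Lemma hel_mid_linear : linear (fun v : 'cV[R[i]]_s => hel 0 v 0).
Proof. by move=> c v w; rewrite hel_linear mulr0 !scaler0 !addr0. Qed.

Lemma hel_low_linear : linear (fun w : 'cV[R[i]]_s => hel 0 0 w).
Proof. by move=> c v w; rewrite hel_linear mulr0 !scaler0 !addr0. Qed.

Lemma col_delta (v : 'cV[R[i]]_s) : \sum_k v k 0 *: delta_mx k 0 = v.
Proof.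
by rewrite {2}[v]matrix_sum_delta; apply: eq_bigr => k _; rewrite big_ord1.
Qed.

Lemma hel_basis u v w : \sum_k hcoef u v w k *: hbas k = hel u v w.
Proof.
rewrite big_sumType big_ord1 big_sumType /=.
rewrite -(linear_comb (fun k => v k 0) (fun k => delta_mx k 0) hel_mid_linear).
rewrite -(linear_comb (fun k => w k 0) (fun k => delta_mx k 0) hel_low_linear).
rewrite !col_delta -[hel 0 v 0]scale1r hel_linear hel_linear.
by rewrite !mulr0 !mulr1 !addr0 !scaler0 !add0r scale1r.
Qed.

End HeisenbergBasis.

(** * The derivative of a modified section *)

Lemma inverse_derivative (F : fieldType) (k : nat) (a b A B : 'M[F]_k) :
  a *m B + A *m b = 0 -> A = 1%:M -> B = 1%:M -> b = - a.
Proof. by move=> E A1 B1; move: E; rewrite A1 B1 mulmx1 mul1mx addrC => /eqP; rewrite addr_eq0 => /eqP. Qed.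

Lemma gen_u (F : numFieldType) (c u : F) : - (2 * - (c / 2) * u) = c * u.
Proof. by field. Qed.

Lemma gen_v (F : numFieldType) (k : nat) (c : F) (a : 'M[F]_k) (v : 'cV[F]_k) :
  (a^T - (c / 2)%:M) *m v - - (c / 2) *: v = a^T *m v.
Proof. by rewrite mulmxBl mul_scalar_mx scaleNr opprK subrK. Qed.

Lemma gen_w (F : numFieldType) (k : nat) (c : F) (a : 'M[F]_k) (w : 'cV[F]_k) :
  - ((a^T - (c / 2)%:M)^T *m w) - - (c / 2) *: w = c *: w - a *m w.
Proof.
rewrite linearB /= trmxK tr_scalar_mx mulmxBl mul_scalar_mx scaleNr opprK opprB.
by rewrite addrAC -scalerDl -splitr.
Qed.

Section ConstantFactor.
Variables (R : realType) (m k l : nat).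
Implicit Types (f : rvec R m -> R[i]) (F : rvec R m -> 'M[R[i]]_(k, k)) (B : 'M[R[i]]_(k, l)).

Lemma cder_mulc v f a (p : rvec R m) : Cdiff f p ->
  cder v (fun y => f y * a) p = cder v f p * a.
Proof. by move=> df; rewrite cderM ?cder_cst ?mulr0 ?addr0 //; exact: Cdiff_cst. Qed.

Lemma cder_mx_mulc v F B (p : rvec R m) : mdf F p ->
  cder_mx v (fun y => F y *m B) p = cder_mx v F p *m B.
Proof. by move=> dF; rewrite cder_mxM ?cder_mx_cst ?mulmx0 ?addr0 //; exact: mdf_cst. Qed.

Lemma cder_mx_trmulc v F B (p : rvec R m) : mdf F p ->
  cder_mx v (fun y => (F y)^T *m B) p = (cder_mx v F p)^T *m B.
Proof.
by move=> dF; rewrite -cder_mx_tr; exact: (cder_mx_mulc v B (mdf_tr dF)).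
Qed.

Lemma cder_mx_Zmulc v f F B (p : rvec R m) a : Cdiff f p -> mdf F p ->
  f p = 1 -> F p = 1%:M -> cder_mx v F p = - a ->
  cder_mx v (fun y => f y *: (F y *m B)) p = cder v f p *: B - a *m B.
Proof.
move=> df dF f1 F1 Fa; have dFB := mdf_mul dF (mdf_cst B p).
by rewrite (cder_mxZ v df dFB) (cder_mx_mulc v B dF) f1 F1 Fa mul1mx scale1r mulNmx.
Qed.

End ConstantFactor.

Section IotaChange.
Variables (R : realType) (m m' s r : nat).
Variables (U : set (rvec R m)) (H : rvec R m -> set (cvec R m)) (O : set (rvec R m)).
Hypothesis nb : CR_nbhd s r U H O.
Variables (p : rvec R m) (W : set (rvec R m)) (prj : rvec R m -> rvec R m').
Hypothesis Op : O p.
Hypothesis kp : forall v, cdiff prj p v = 0 -> Kc U H p v.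
Variables phi phi' : frame R m s r.
Hypotheses (ad : adapted U H O phi) (ad' : adapted U H O phi').
Hypothesis same : same_iso U H p phi phi'.

Lemma ch_p : [/\ chA phi phi' p = 1%:M, chA phi' phi p = 1%:M & chr phi phi' p = 1].
Proof.
have [A1 r1] := same_iso_ch nb Op ad ad' same; split; [exact: A1| |exact: r1].
by have := chA_inv nb ad ad' Op; rewrite A1 mul1mx.
Qed.

Lemma cder_chA_inv v : cder_mx v (chA phi' phi) p = - cder_mx v (chA phi phi') p.
Proof.
have [A1 B1 _] := ch_p.
have dA := mdf_chA nb ad ad' Op; have dB := mdf_chA nb ad' ad Op.
have E := cder_mxM v dA dB; apply: inverse_derivative A1 B1.
apply: etrans (esym E) _; apply: (etrans _ (cder_mx_cst v 1%:M p)); apply: cder_mx_near.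
by apply: near_open (nb_open nb) Op _ => y Oy; exact: (chA_inv nb ad ad' Oy).
Qed.

Section Coefficients.
Variables (u0 : R[i]) (v0 w0 : 'cV[R[i]]_s).

(** The coefficients of the element that has, with respect to [phi], the same tangent
   vectors as [hel u0 v0 w0] with respect to [phi']. *)
Definition gen_coef (k : hidx s) (y : rvec R m) : R[i] :=
  hcoef (chr phi phi' y * u0) ((chA phi phi' y)^T *m v0)
        (chr phi phi' y *: (chA phi' phi y *m w0)) k.

Definition gen_dcoef (v : cvec R m) : hidx s -> R[i] :=
  hcoef (cder v (chr phi phi') p * u0) ((cder_mx v (chA phi phi') p)^T *m v0)
        (cder v (chr phi phi') p *: w0 - cder_mx v (chA phi phi') p *m w0).

Lemma gen_coef_diff k : Cdiff (gen_coef k) p.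
Proof.
have dr := Cdiff_chr nb ad ad' Op; have dA := mdf_chA nb ad ad' Op.
have dB := mdf_chA nb ad' ad Op.
case: k => [k|[k|k]].
- exact: CdiffM dr (Cdiff_cst _ _).
- exact: (mdf_mul (mdf_tr dA) (mdf_cst v0 p)).
- exact: (mdfZ dr (mdf_mul dB (mdf_cst w0 p))).
Qed.

Lemma gen_coef_cder v k : cder v (gen_coef k) p = gen_dcoef v k.
Proof.
have [A1 B1 r1] := ch_p.
have dr := Cdiff_chr nb ad ad' Op; have dA := mdf_chA nb ad ad' Op.
have dB := mdf_chA nb ad' ad Op.
case: k => [k|[k|k]].
- exact: cder_mulc dr.
- have E := cder_mx_trmulc v v0 dA.
  exact: etrans (esym (cder_mxij v _ p k 0)) (congr1 (fun M : 'cV[R[i]]_s => M k 0) E).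
- have E := cder_mx_Zmulc w0 dr dB r1 B1 (cder_chA_inv v).
  exact: etrans (esym (cder_mxij v _ p k 0)) (congr1 (fun M : 'cV[R[i]]_s => M k 0) E).
Qed.

Lemma gen_dcoef_br v :
  \sum_k gen_dcoef v k *: hbas R k = br (cgen phi phi' p v) (hel u0 v0 w0).
Proof.
apply: etrans (hel_basis _ _ _) _; apply: etrans _ (esym (br_cel_hel _ _ _ _ _)).
by apply: hel_congr; [rewrite gen_u|rewrite gen_v|rewrite gen_w].
Qed.

Lemma gen_coef_p : \sum_k gen_coef k p *: hbas R k = hel u0 v0 w0.
Proof.
have [A1 B1 r1] := ch_p; apply: etrans (hel_basis _ _ _) _.
by rewrite A1 B1 r1 mul1r trmx1 !mul1mx scale1r.
Qed.

End Coefficients.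

Lemma cspD (X Y : gmat R s) : csp X -> csp Y -> csp (X + Y).
Proof.
move=> [c [L [S [T [ES ET ->]]]]] [c' [L' [S' [T' [ES' ET' ->]]]]].
exists (1 * c + c'), (1 *: L + L'), (1 *: S + S'), (1 *: T + T'); split.
- by rewrite scale1r linearD /= ES ES'.
- by rewrite scale1r linearD /= ET ET'.
- by rewrite -[cel c L S T]scale1r; exact: cel_linear.
Qed.

Lemma csp00_csp (X : gmat R s) : csp00 X -> csp X.
Proof. by move=> [c [L ->]]; exists c, L, 0, 0; rewrite trmx0. Qed.

(** With respect to [phi], the transported element is the one with the coefficients
   [gen_coef] along the curve. By linearity its transport is the combination of those
   of basis elements, and the product rule gives the derivative for [phi] plus that of
   the coefficients, which is the bracket with [cgen]. *)
Lemma iota_real_change (v : rvec R m) (D : gmat R s) :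
  iota_real U H W prj phi p v D ->
  iota_real U H W prj phi' p v (D + cgen phi phi' p (cplxv v)).
Proof.
move=> [cD iD]; split; first by apply: cspD => //; exact/csp00_csp/cgen00.
move=> eps gam eps0 sg g0 lg dg X [u0 [v0 [w0 ->]]].
have dgam j : is_derive (0 : R) 1 (fun t => gam t 0 j) (v 0 j).
  rewrite -dg derive1E; apply: derivableP.
  by apply: (sg 0%N j 0); rewrite normr0.
have hb (k : hidx s) : gminus (hbas R k).
  by case: k => [k|[k|k]]; exact: (ex_intro _ _ (ex_intro _ _ (ex_intro _ _ erefl))).
have /choice[Y HY] k : exists Y, (\forall t \near (0 : R), transport U H prj phi p (gam t)
    (hbas R k) (Y t)) /\ is_mderive Y (br D (hbas R k)).
  exact: (iD eps gam eps0 sg g0 lg dg (hbas R k) (hb k)).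
have Y0 k : Y k 0 = hbas R k.
  have [/nbhs_singleton T0 _] := HY k; rewrite g0 in T0.
  exact: esym (transport_refl nb Op kp ad T0).
exists (fun t => \sum_k gen_coef u0 v0 w0 k (gam t) *: Y k t); split.
  have cg : {for 0, continuous gam}.
    have dd : derivable gam (0 : R) 1.
      by apply/derivable_mxP => i j; rewrite ord1; apply: (@ex_derive _ _ _ _ _ _ _ (dgam j)).
    exact/differentiable_continuous/derivable1_diffP.
  have nO : \forall t \near (0 : R), O (gam t).
    apply: cg; rewrite g0; apply: open_nbhs_nbhs; split=> //; exact: nb_open nb.
  have nT : \forall t \near (0 : R), forall k, transport U H prj phi p (gam t) (hbas R k) (Y k t).
    have TT (k : hidx s) : \forall t \near (0 : R),
      transport U H prj phi p (gam t) (hbas R k) (Y k t) by have [HY1 _] := HY k; exact: HY1.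
    exact: (@filter_forall _ (hidx s : finType) _ _ _ TT).
  apply: filterS2 nO nT => t Ot Tt.
  apply: (transport_change nb ad ad' (frame_iso_eq nb Op ad ad' same) Ot).
  rewrite -hel_basis; exact: (transport_comb nb Op ad _ Ot Tt).
have dc k : cderiv (fun t => gen_coef u0 v0 w0 k (gam t)) (gen_dcoef u0 v0 w0 (cplxv v) k).
  rewrite -gen_coef_cder; apply: cderiv_chain g0 dgam; exact: gen_coef_diff.
have dY k : is_mderive (Y k) (br D (hbas R k)) by have [] := HY k.
have E1 : \sum_k (gen_dcoef u0 v0 w0 (cplxv v) k *: Y k 0
      + gen_coef u0 v0 w0 k (gam 0) *: br D (hbas R k)) =
    br (D + cgen phi phi' p (cplxv v)) (hel u0 v0 w0).
  rewrite g0; under eq_bigr => k _ do rewrite Y0.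
  rewrite big_split /= gen_dcoef_br.
  rewrite -(linear_comb (fun k => gen_coef u0 v0 w0 k p) (fun k => hbas R k) (br_linear D)).
  rewrite gen_coef_p addrC -[D in RHS]scale1r br_linearl scale1r.
  by [].
rewrite -E1; exact: (mderive_comb dc dY).
Qed.

End IotaChange.

(** * The involution of csp *)

Section HermitianInvolution.
Variables (F : fieldType) (cj : {rmorphism F -> F}) (k : nat) (G : 'M[F]_k) (th : F).
Hypotheses (cjK : involutive cj) (Gu : G \in unitmx) (th0 : th != 0).
Local Notation bar := (map_mx cj).
Hypothesis GH : G = th *: (bar G)^T.
Implicit Types L S T : 'M[F]_k.

(** The action on [csp] of degree 0 of the conjugation v -> G bar(v), and the
   identification of the symmetric matrices of degree 2 with those of degree -2 that it
   induces. *)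
Definition invL L : 'M[F]_k := - bar (invmx G *m L^T *m G).
Definition p2n S : 'M[F]_k := G *m bar S *m bar G.

Lemma barK (a b : nat) (A : 'M[F]_(a, b)) : bar (bar A) = A.
Proof. by apply/matrixP => i j; rewrite !mxE cjK. Qed.

Lemma barGu : bar G \in unitmx.
Proof. by rewrite map_unitmx. Qed.

(** By the Hermitian symmetry of [G] up to the factor [th]. *)
Lemma invLT L : (invL L)^T *m G = - (G *m bar L).
Proof.
have GT : (bar G)^T = th^-1 *: G by rewrite {2}GH scalerA mulVf // scale1r.
rewrite /invL linearN mulNmx /=; congr (- _).
have GiT : (bar (invmx G))^T *m G = th *: 1%:M.
  have Gtu : (bar G)^T \in unitmx by rewrite unitmx_tr barGu.
  apply: (can_inj (mulKmx Gtu)).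
  by rewrite map_invmx trmx_inv mulmxA mulmxV // mul1mx -scalemxAr mulmx1 -GH.
rewrite !map_mxM !trmx_mul -map_trmx trmxK GT -scalemxAl -scalemxAl.
rewrite -[G *m _ *m G]mulmxA -[_ *m _ *m G]mulmxA GiT -!scalemxAr mulmx1.
by rewrite scalerA mulVf // scale1r.
Qed.

Lemma invL_mul L : bar G *m invL L = - (bar L^T *m bar G).
Proof.
rewrite /invL mulmxN; congr (- _); rewrite -[LHS]map_mxM -[RHS]map_mxM; congr (map_mx cj _).
by rewrite !mulmxA mulmxV // mul1mx.
Qed.

(** Conjugation is compatible with the brackets of degree 0 elements with those of
   degree 2 and -2. *)
Lemma p2n_action L S :
  p2n (L *m S + S *m L^T) = - ((invL L)^T *m p2n S) - p2n S *m invL L.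
Proof.
rewrite /p2n map_mxD mulmxDr mulmxDl !map_mxM !mulmxA invLT !mulNmx opprK.
by rewrite -[_ *m bar G *m invL L]mulmxA invL_mul mulmxN opprK !mulmxA.
Qed.

Lemma inv_act_u (c u : F) : - (2 * cj c * (th * cj u)) = th * cj (- (2 * c * u)).
Proof. by rewrite rmorphN !rmorphM rmorph_nat mulrN; congr (- _); rewrite mulrCA. Qed.

Lemma bar_scale (c : F) (a b : nat) (A : 'M[F]_(a, b)) : bar (c *: A) = cj c *: bar A.
Proof. by apply/matrixP => i j; rewrite !mxE rmorphM. Qed.

Lemma inv_act_v (c : F) L (b : 'cV[F]_k) :
  invL L *m bar (invmx G *m b) - cj c *: bar (invmx G *m b) =
  bar (invmx G *m (- (L^T *m b) - c *: b)).
Proof.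
rewrite mulmxBr mulmxN -scalemxAr map_mxB map_mxN bar_scale /invL mulNmx; congr (- _ - _).
by rewrite -map_mxM; congr (map_mx cj _); rewrite !mulmxA mulmxK.
Qed.

Lemma inv_act_w (c : F) L (a : 'cV[F]_k) :
  - ((invL L)^T *m (G *m bar a)) - cj c *: (G *m bar a) = G *m bar (L *m a - c *: a).
Proof.
rewrite map_mxB bar_scale mulmxBr -scalemxAr; congr (_ - _).
by rewrite mulmxA invLT mulNmx opprK map_mxM mulmxA.
Qed.

Lemma invLK L : invL (invL L) = L.
Proof.
apply: (can_inj (mulKmx barGu)); rewrite invL_mul -map_trmx.
have := congr1 (fun A => bar A) (invLT L).
rewrite map_mxM map_mxN map_mxM barK map_trmx => ->.
by rewrite opprK.
Qed.

Lemma p2n_inj : injective p2n.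
Proof.
move=> S T /(can_inj (mulmxK barGu))/(can_inj (mulKmx Gu)) E.
by rewrite -[S]barK E barK.
Qed.

Lemma p2n_conj_linear c S T : p2n (c *: S + T) = cj c *: p2n S + p2n T.
Proof.
rewrite /p2n map_mxD mulmxDr mulmxDl; congr (_ + _).
have -> : bar (c *: S) = cj c *: bar S by apply/matrixP => i j; rewrite !mxE rmorphM.
by rewrite -scalemxAr -scalemxAl.
Qed.

Variables (n : nat) (P N : 'I_n -> 'M[F]_k).
Hypothesis PN : forall a, N a = p2n (P a).

Lemma p2n_span S : in_span N (p2n S) <-> in_span P S.
Proof.
have comb c : p2n (\sum_a c a *: P a) = \sum_a cj (c a) *: N a.
  elim/big_rec2: _ => [|a X Y _ <-]; first by rewrite /p2n map_mx0 mulmx0 mul0mx.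
  by rewrite p2n_conj_linear PN.
split=> [[c E]|[c ->]]; last by rewrite comb; exists (fun a => cj (c a)).
exists (fun a => cj (c a)); apply: p2n_inj; rewrite comb E.
by apply: eq_bigr => a _; rewrite cjK.
Qed.

Lemma p2n_surj T : exists S, T = p2n S.
Proof.
exists (bar (invmx G *m T *m invmx (bar G))); rewrite /p2n barK.
by rewrite !mulmxA mulmxV // mul1mx mulmxKV // barGu.
Qed.

(** Conjugation exchanges the two spans and the two brackets. *)
Lemma invL_stable L :
  (forall S, in_span P S -> in_span P (L *m S + S *m L^T)) ->
  (forall T, in_span N T -> in_span N (- (L^T *m T) - T *m L)) ->
  (forall S, in_span P S -> in_span P (invL L *m S + S *m (invL L)^T)) /\
  (forall T, in_span N T -> in_span N (- ((invL L)^T *m T) - T *m invL L)).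
Proof.
move=> HP HN; split=> [S SP|T].
  by apply/p2n_span; rewrite p2n_action invLK; apply: HN; exact/p2n_span.
have [S ->] := p2n_surj T; move=> /p2n_span SP.
by rewrite -p2n_action; apply/p2n_span; exact: HP.
Qed.

End HermitianInvolution.

Section Involution.
Variables (R : realType) (m s r : nat).
Variables (U : set (rvec R m)) (H : rvec R m -> set (cvec R m)) (O : set (rvec R m)).
Hypothesis nb : CR_nbhd s r U H O.
Variables (p : rvec R m) (phi : frame R m s r).
Hypotheses (Op : O p) (ad : adapted U H O phi).
Implicit Types (u : R[i]) (a b : 'cV[R[i]]_s) (X Y D C : gmat R s).
Local Notation G := (levi phi p).
Local Notation th := (twist phi p).

Lemma th_neq0 : th != 0.
Proof.
apply/eqP => t0; have /eqP := twist_unit nb ad Op.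
by rewrite t0 mul0r eq_sym oner_eq0.
Qed.

Let Gu : G \in unitmx := levi_unit nb ad Op.

Lemma cf_conj (w : cvec R m) : conjset (H p) w -> conjm w *m cf phi p = conjm (w *m cfb phi p).
Proof.
move=> Hw; have [_ _ _ {1}->] := Hb_coord nb ad Op Hw.
have [Ff _] := dual_fe nb ad Op; have [Ef _] := emat_coords nb ad ad Op.
rewrite conjmD (conjmM _ (conjm (fmat phi p))) (conjmM _ (conjm (emat phi p))) !conjmK.
by rewrite mulmxDl -!mulmxA Ff Ef !mulmx0 mulmx1 addr0.
Qed.

Lemma cfb_conj (w : cvec R m) : H p w -> conjm w *m cfb phi p = conjm (w *m cf phi p).
Proof.
move=> Hw; have Hb : conjset (H p) (conjm w) by rewrite /conjset /= conjmK.
by have := cf_conj Hb; rewrite conjmK => ->; rewrite conjmK.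
Qed.

Definition hconj u a b : gmat R s :=
  hel (th * conjc u) (conjm (invmx G *m b)) (G *m conjm a).

(** Conjugation of tangent vectors exchanges degrees (-1,1) and (-1,-1); in the latter
   the coordinates differ by the Levi matrix, and in degree -2 by the phase [twist]. *)
Lemma conj_relP X Y : conj_rel U H phi p X Y <->
  exists u a b, X = hel u a b /\ Y = hconj u a b.
Proof.
split.
  move=> [w2 [w1 [w1' [SX SY]]]].
  have [Hw Hw' ->] := (sym_relP nb ad _ _ _ _ Op).1 SX.
  have [_ _ ->] := (sym_relP nb ad _ _ _ _ Op).1 SY.
  exists ((w2 *m cu phi p) 0 0), (w1 *m cf phi p)^T, (G *m (w1' *m cfb phi p)^T).
  split; [by []|apply: hel_congr].
  - exact: (conj_cu nb ad w2 Op).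
  - by rewrite (mulKmx Gu) conjm_tr; apply: (congr1 (fun B : 'M[R[i]]_(1, s) => B^T)); exact: cf_conj.
  - rewrite conjm_tr; apply: (congr1 (fun B : 'M[R[i]]_(1, s) => G *m B^T)); exact: cfb_conj.
move=> [u [a [b [-> ->]]]].
have Ha : H p (a^T *m fmat phi p).
  have := (memH ad (row_mx a^T 0 *m hmat phi p) Op).2 (submxMl _ _).
  by rewrite /hmat mul_row_col mul0mx addr0.
have Hb : H p (conjm (invmx G *m b)^T *m fmat phi p).
  have := (memH ad (row_mx (conjm (invmx G *m b)^T) 0 *m hmat phi p) Op).2 (submxMl _ _).
  by rewrite /hmat mul_row_col mul0mx addr0.
have Hb' : conjset (H p) (conjm (conjm (invmx G *m b)^T *m fmat phi p)).
  by rewrite /conjset /= conjmK.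
have Ha' : conjset (H p) (conjm (a^T *m fmat phi p)) by rewrite /conjset /= conjmK.
have [Ff _] := dual_fe nb ad Op.
exists (u *: fg phi p), (a^T *m fmat phi p), (conjm (conjm (invmx G *m b)^T *m fmat phi p)).
have [_ _ [_ gu]] := dual_rels nb ad Op.
have Eu : (u *: fg phi p *m cu phi p) 0 0 = u.
  by rewrite -scalemxAl gu [LHS]mxE mxE eqxx mulr1n mulr1.
have Ea : a^T *m fmat phi p *m cf phi p = a^T by rewrite -mulmxA Ff mulmx1.
have Eb : conjm (invmx G *m b)^T *m fmat phi p *m cf phi p = conjm (invmx G *m b)^T.
  by rewrite -mulmxA Ff mulmx1.
split; apply/(sym_relP nb ad _ _ _ _ Op).
  split; [exact: Ha|exact: Hb'|apply: hel_congr].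
  - exact: esym Eu.
  - by rewrite Ea trmxK.
  - by rewrite (cfb_conj Hb) Eb conjmK trmxK (mulKVmx Gu).
rewrite conjmK; split; [exact: Hb|exact: Ha'|apply: hel_congr].
- by rewrite (conj_cu nb ad _ Op) Eu.
- by rewrite Eb conjm_tr trmxK.
- by rewrite (cfb_conj Ha) Ea conjm_tr trmxK.
Qed.

Lemma conj_der00 c L : conj_der U H phi p (cel c L 0 0)
  (cel (conjc c) (invL (@conjc R) G L) 0 0).
Proof.
split.
  exact: csp00_csp (ex_intro _ _ (ex_intro _ _ erefl)).
move=> X Y /conj_relP[u [a [b [-> ->]]]]; apply/conj_relP.
exists (- (2 * c * u)), (L *m a - c *: a), (- (L^T *m b) - c *: b).
split; first exact: br_cel_hel.
apply: etrans (br_cel_hel _ _ _ _ _) _; apply: hel_congr.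
- exact: (inv_act_u (@conjc R)).
- exact: (inv_act_v (@conjc R) Gu).
- exact: (inv_act_w (cj := @conjc R) Gu th_neq0 (levi_hermitian nb ad Op)).
Qed.

Lemma conj_derD D D' C C' : conj_der U H phi p D D' -> conj_der U H phi p C C' ->
  conj_der U H phi p (D + C) (D' + C').
Proof.
move=> [cD hD] [cC hC]; split; first exact: cspD.
move=> X Y XY; have /conj_relP[u [a [b [E1 E2]]]] := hD _ _ XY.
have /conj_relP[u' [a' [b' [E1' E2']]]] := hC _ _ XY.
apply/conj_relP; exists (1 * u + u'), (1 *: a + a'), (1 *: b + b').
rewrite -[D]scale1r -[D']scale1r !br_linearl E1 E2 E1' E2'.
split; first exact: hel_linear.
apply: etrans (hel_linear _ _ _ _ _ _ _) _; apply: hel_congr.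
- by rewrite !mul1r rmorphD mulrDr.
- by rewrite !scale1r mulmxDr conjmD.
- by rewrite !scale1r conjmD mulmxDr.
Qed.

Lemma gposP X : gpos U H phi p X <->
  exists S, in_span (fun a : 'I_r => spos phi a p) S /\ X = cel 0 0 S 0.
Proof.
have E c : lincomb c (fun a : 'I_r => Spos U H phi a p) =
    cel 0 0 (\sum_(a < r) c a *: spos phi a p) 0.
  apply: etrans _ (esym (linear_comb c (fun a : 'I_r => spos phi a p) (@cel_pos_linear R s))).
  by apply: eq_bigr => a _; rewrite (Spos_spos nb ad a Op).
split=> [[c ->]|[S [[c ->] ->]]]; last by exists c; rewrite E.
by rewrite E; eexists; split; [exists c|].
Qed.

Lemma gnegP X : gneg U H phi p X <->
  exists S, in_span (fun a : 'I_r => sneg phi a p) S /\ X = cel 0 0 0 S.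
Proof.
have E c : lincomb c (fun a : 'I_r => Sneg U H phi a p) =
    cel 0 0 0 (\sum_(a < r) c a *: sneg phi a p).
  apply: etrans _ (esym (linear_comb c (fun a : 'I_r => sneg phi a p) (@cel_neg_linear R s))).
  by apply: eq_bigr => a _; rewrite (Sneg_sneg nb ad a Op).
split=> [[c ->]|[S [[c ->] ->]]]; last by exists c; rewrite E.
by rewrite E; eexists; split; [exists c|].
Qed.

Lemma g00P c L : g00 U H phi p (cel c L 0 0) <->
  (forall S, in_span (fun a : 'I_r => spos phi a p) S ->
     in_span (fun a : 'I_r => spos phi a p) (L *m S + S *m L^T)) /\
  (forall T, in_span (fun a : 'I_r => sneg phi a p) T ->
     in_span (fun a : 'I_r => sneg phi a p) (- (L^T *m T) - T *m L)).
Proof.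
split=> [[_ HP HN]|[HP HN]]; split.
- move=> S SS; have /gposP[S' [SS' E]] := HP _ ((gposP _).2 (ex_intro _ S (conj SS erefl))).
  by move: E; rewrite br_pos => /gm_inj[_ _ _ _ [-> _]].
- move=> T TT; have /gnegP[T' [TT' E]] := HN _ ((gnegP _).2 (ex_intro _ T (conj TT erefl))).
  by move: E; rewrite br_neg => /gm_inj[_ _ _ _ [_ ->]].
- exact: ex_intro _ _ (ex_intro _ _ erefl).
- move=> Y /gposP[S [SS ->]]; apply/gposP; rewrite br_pos.
  exact: ex_intro _ _ (conj (HP _ SS) erefl).
- move=> Y /gnegP[T [TT ->]]; apply/gnegP; rewrite br_neg.
  exact: ex_intro _ _ (conj (HN _ TT) erefl).
Qed.

Lemma g00_conj c L : g00 U H phi p (cel c L 0 0) ->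
  g00 U H phi p (cel (conjc c) (invL (@conjc R) G L) 0 0).
Proof.
move=> /g00P[HP HN]; apply/g00P.
have PN (a : 'I_r) : sneg phi a p = p2n (@conjc R) G (spos phi a p).
  rewrite /sneg /p2n -mulmxA; apply: (congr1 (mulmx G)).
  by rewrite -(spos_levi nb Op ad a); exact: conjmM.
exact: (invL_stable (@conjcK R) Gu th_neq0 (levi_hermitian nb ad Op) PN HP HN).
Qed.

(** Complex conjugation exchanges g_{0,2} and g_{0,-2}, so that the involution preserves
   the normalizer of both. *)
Lemma g00_conj_der C : g00 U H phi p C ->
  exists2 C', conj_der U H phi p C C' & g00 U H phi p C'.
Proof.
move=> gC; have [[c [L E]] _ _] := gC; rewrite E in gC *.
by eexists; [exact: conj_der00|exact: g00_conj].
Qed.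

End Involution.

Opaque cgen.

(** * Normalized sections *)

Section Comparison.
Variables (R : realType) (m s r : nat).
Variables (U : set (rvec R m)) (H : rvec R m -> set (cvec R m)).
Implicit Types (phi : frame R m s r) (p : rvec R m) (X Y B C : gmat R s).

Lemma brBl B C X : br (B - C) X = br B X - br C X.
Proof. by rewrite -[B - C]addrC -scaleN1r br_linearl scaleN1r addrC. Qed.

Lemma br_comb (C : gmat R s) (c : 'I_r -> R[i]) (S : 'I_r -> gmat R s) :
  br C (lincomb c S) = lincomb c (fun a => br C (S a)).
Proof. exact: (linear_comb c S (br_linear C)). Qed.

Lemma gspan_comb (S T : 'I_r -> gmat R s) c :
  (forall b, gspan S (T b)) -> gspan S (lincomb c T).
Proof.
move=> ST; rewrite /lincomb; elim/big_ind: _ => [|A B SA SB|b _].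
- by exists (fun=> 0); rewrite /lincomb big1 // => b _; rewrite scale0r.
- exact: in_spanD SA SB.
- exact: in_spanZ (ST b).
Qed.

Lemma gspanD (S : 'I_r -> gmat R s) X Y : gspan S X -> gspan S Y -> gspan S (X + Y).
Proof. exact: in_spanD. Qed.

Lemma gspanN (S : 'I_r -> gmat R s) X : gspan S X -> gspan S (- X).
Proof. exact: in_spanN. Qed.

Lemma gspan0 (S : 'I_r -> gmat R s) : gspan S 0.
Proof. by exists (fun=> 0); rewrite /lincomb big1 // => b _; rewrite scale0r. Qed.

Lemma mcoset_eq (S : 'I_r -> gmat R s) X Y :
  mcoset X (gspan S) = mcoset Y (gspan S) -> gspan S (X - Y).
Proof.
move=> E; have : mcoset X (gspan S) X by rewrite /mcoset /= subrr; exact: gspan0.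
by rewrite E.
Qed.

Lemma csp00N C : csp00 C -> csp00 (- C).
Proof.
move=> [c [L ->]]; exists (- 1 * c + 0), (- 1 *: L + 0).
have E0 : cel 0 0 0 0 = 0 :> gmat R s.
  by rewrite cposE row_mx0 !block_mx0.
by have := cel_linear (-1) c L 0 0 0 0 0 0; rewrite !scaler0 !addr0 E0 addr0 scaleN1r.
Qed.

Lemma csp00D B C : csp00 B -> csp00 C -> csp00 (B + C).
Proof.
move=> [c [L ->]] [c' [L' ->]]; exists (1 * c + c'), (1 *: L + L').
by have := cel_linear 1 c L 0 0 c' L' 0 0; rewrite !scaler0 !addr0 !scale1r.
Qed.

Lemma g00_basis phi p C : csp00 C ->
  (forall b, gpos U H phi p (br C (Spos U H phi b p))) ->
  (forall b, gneg U H phi p (br C (Sneg U H phi b p))) -> g00 U H phi p C.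
Proof.
move=> cC HP HN; split; [exact: cC| |] => Y [c ->]; rewrite br_comb; exact: gspan_comb.
Qed.

Lemma g00D phi p B C : g00 U H phi p B -> g00 U H phi p C -> g00 U H phi p (B + C).
Proof.
move=> [cB PB NB] [cC PC NC]; split; first exact: csp00D.
- move=> Y PY; rewrite -[B]scale1r br_linearl scale1r.
  exact: gspanD (PB _ PY) (PC _ PY).
- move=> Y NY; rewrite -[B]scale1r br_linearl scale1r.
  exact: gspanD (NB _ NY) (NC _ NY).
Qed.

Lemma g00N phi p B : g00 U H phi p B -> g00 U H phi p (- B).
Proof.
have E Y : br (- B) Y = - br B Y by rewrite /br mulNmx mulmxN opprB opprK addrC.
move=> [cB PB NB]; split; first exact: csp00N.
- by move=> Y PY; rewrite E; exact: gspanN (PB _ PY).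
- by move=> Y NY; rewrite E; exact: gspanN (NB _ NY).
Qed.

(** The element with only [c] nonzero commutes with all of [csp]. *)
Lemma g00_center phi p c O : CR_nbhd s r U H O -> O p -> adapted U H O phi ->
  g00 U H phi p (cel c 0 0 0).
Proof.
move=> nb Op ad; apply: g00_basis; first exact: ex_intro _ _ (ex_intro _ _ erefl).
  move=> b; rewrite (Spos_spos nb ad b Op) br_pos trmx0 mul0mx mulmx0 addr0.
  rewrite (_ : cel 0 0 0 0 = 0); first exact: gspan0.
  by rewrite cposE row_mx0 !block_mx0.
move=> b; rewrite (Sneg_sneg nb ad b Op) br_neg trmx0 mul0mx mulmx0 oppr0 addr0.
rewrite (_ : cel 0 0 0 0 = 0); first exact: gspan0.
by rewrite cposE row_mx0 !block_mx0.
Qed.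

(** Subtracting the equations for [B] and [C] leaves the brackets with their difference,
   which thus preserve g_{0,2} and g_{0,-2}. *)
Lemma solution_unique phi p (D E : 'I_r -> gmat R s) B C : csp00 B -> csp00 C ->
  (forall b, mcoset (D b - br B (Sneg U H phi b p)) (gneg U H phi p) =
             mcoset (D b - br C (Sneg U H phi b p)) (gneg U H phi p)) ->
  (forall b, mcoset (E b - br B (Spos U H phi b p)) (gpos U H phi p) =
             mcoset (E b - br C (Spos U H phi b p)) (gpos U H phi p)) ->
  g00 U H phi p (B - C).
Proof.
move=> cB cC HN HP; have sub (X Y Z : gmat R s) : Y - Z = - (X - Y - (X - Z)).
  by rewrite !opprB [X - Z]addrC -addrA [X + (Y - X)]addrCA subrr addr0 addrC.
apply: g00_basis; first exact: csp00D cB (csp00N cC).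
  by move=> b; rewrite brBl (sub (E b)); apply: gspanN; exact: mcoset_eq (HP b).
by move=> b; rewrite brBl (sub (D b)); apply: gspanN; exact: mcoset_eq (HN b).
Qed.

Lemma Oof_self K (S : 'I_r -> rvec R m -> gmat R s) p v b : K v ->
  Oof K S p v (S b p) (cder_mx v (S b) p).
Proof.
move=> Kv; split=> //; exists (fun a => (a == b)%:R).
have E T : lincomb (fun a => (a == b)%:R) T = T b by exact: comb_delta.
by rewrite !E subrr; split=> //; exact: gspan0.
Qed.

End Comparison.

Section Extensions.
Variables (R : realType) (m m' s r : nat).
Variables (U : set (rvec R m)) (H : rvec R m -> set (cvec R m)) (O : set (rvec R m)).
Hypothesis nb : CR_nbhd s r U H O.
Variables (p : rvec R m) (W : set (rvec R m)) (prj : rvec R m -> rvec R m').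
Hypothesis Op : O p.
Hypothesis kp : forall v, cdiff prj p v = 0 -> Kc U H p v.
Variables phi phi' : frame R m s r.
Hypotheses (ad : adapted U H O phi) (ad' : adapted U H O phi').
Hypothesis same : same_iso U H p phi phi'.

(** [cgen] is complex linear in the direction, like the extension of iota from real
   vectors. *)
Lemma iota_sec_change v D : iota_sec U H W prj phi p v D ->
  iota_sec U H W prj phi' p v (D + cgen phi phi' p v).
Proof.
move=> [D1 [D2 [i1 i2 ->]]].
exists (D1 + cgen phi phi' p (cplxv (re_vec v))), (D2 + cgen phi phi' p (cplxv (im_vec v))).
split.
- exact (iota_real_change nb Op kp ad ad' same i1).
- exact (iota_real_change nb Op kp ad ad' same i2).
have Ev : v = 'i%C *: cplxv (im_vec v) + cplxv (re_vec v).
  apply/rowP => j; rewrite [RHS]mxE [X in X + _]mxE !mxE.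
  by apply: complex_eq; rewrite ?cReD ?cImD ?cReM ?cImM /=; ring.
rewrite {1}Ev cgen_linear scalerDr addrACA.
have swap (V : zmodType) (x a y b : V) : x + a + (y + b) = x + b + (y + a).
  by rewrite addrACA [a + b]addrC addrACA.
exact: swap.
Qed.

Let A1 : chA phi phi' p = 1%:M := (same_iso_ch nb Op ad ad' same).1.
Let r1 : chr phi phi' p = 1 := (same_iso_ch nb Op ad ad' same).2.

Lemma gpos_eq : gpos U H phi' p = gpos U H phi p.
Proof. exact: (gpos_change nb Op ad ad' A1 r1). Qed.

Lemma gneg_eq : gneg U H phi' p = gneg U H phi p.
Proof. exact: (gneg_change nb Op ad ad' A1 r1). Qed.

Lemma g00_eq : g00 U H phi' p = g00 U H phi p.
Proof. by rewrite /g00 gpos_eq gneg_eq. Qed.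

Lemma ON_eq (N : normalization R m s) : ON N U H phi' p = ON N U H phi p.
Proof.
by rewrite /ON gpos_eq gneg_eq (Oclass_eq (frame_iso_eq nb Op ad ad' same)).
Qed.

(** By [Opos_change] and [Oneg_change] the maps O of the two sections differ by the
   brackets with [cgen], which therefore lie in g_{0,2} and g_{0,-2}. *)
Lemma cgen_g00 v : Kb U H 2 p v -> Oneg U H phi p = Oneg U H phi' p ->
  Opos U H phi p = Opos U H phi' p -> g00 U H phi p (cgen phi phi' p v).
Proof.
move=> Kv EN EP; have sub (X Y : gmat R s) : X - (X - Y) = Y by rewrite opprB addrC subrK.
apply: g00_basis; first exact: cgen00.
  move=> b; have := Oof_self (Spos U H phi) p b Kv; rewrite -/(Opos U H phi p) EP.
  rewrite (Opos_change nb Op ad ad' A1 r1 b Kv) => X; rewrite /mcoset /= sub in X.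
  exact: X.
move=> b; have := Oof_self (Sneg U H phi) p b Kv; rewrite -/(Oneg U H phi p) EN.
rewrite (Oneg_change nb Op ad ad' A1 r1 b Kv) => X; rewrite /mcoset /= sub in X.
exact: X.
Qed.

(** The change of section adds [cgen v] to the image of [v] and the involution of [cgen
   v'] to that of the conjugate of [v']. Both summands are in [g00] and are absorbed in
   its contribution. *)
Lemma mod_symbol_sub : Oneg U H phi p = Oneg U H phi' p ->
  Opos U H phi p = Opos U H phi' p ->
  mod_symbol U H W prj phi p `<=` mod_symbol U H W prj phi' p.
Proof.
move=> EN EP X [X0 [v [v' [D [D' [E' [Z [hX0 [Kv iD] [Kv' iD'] cE [gZ ->]]]]]]]]].
have gC := cgen_g00 Kv EN EP; have gC' := cgen_g00 Kv' EN EP.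
have [F cF gF] := g00_conj_der nb Op ad gC'.
exists X0, v, v', (D + cgen phi phi' p v), (D' + cgen phi phi' p v'), (E' + F).
exists (Z - cgen phi phi' p v - F); split.
- exact: hX0.
- by split; [exact: Kv|exact: iota_sec_change].
- by split; [exact: Kv'|exact: iota_sec_change].
- have CD := conj_derD nb Op ad cE cF.
  rewrite (conj_der_eq (frame_iso_eq nb Op ad ad' same)) in CD; exact: CD.
- split; first by rewrite g00_eq; apply: g00D (g00N gF); exact: g00D gZ (g00N gC).
  apply: (congr1 (+%R X0)); have sum (V : zmodType) (d c e f z : V) :
      d + e + z = d + c + (e + f) + (z - c - f).
    by rewrite [d + c + _]addrACA -[RHS]addrA -(addrA z) -opprD [c + f + _]addrC subrK.
  exact: sum.
Qed.

End Extensions.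

Lemma cel_center (R : realType) (s : nat) (c : R[i]) (L : 'M[R[i]]_s) :
  cel c L 0 0 - cel 0 L 0 0 = cel c 0 0 0.
Proof.
rewrite addrC -scaleN1r; apply: etrans (cel_linear _ _ _ _ _ _ _ _ _) _.
by rewrite mulr0 add0r scaleN1r addNr !scaler0 !addr0.
Qed.

Lemma cel_splitL (R : realType) (s : nat) (L L' S : 'M[R[i]]_s) :
  cel 0 (L + L') S 0 = cel 0 L S 0 + cel 0 L' 0 0.
Proof.
rewrite -[cel 0 L S 0]scale1r; apply: etrans _ (esym (cel_linear _ _ _ _ _ _ _ _ _)).
by rewrite mulr0 !scale1r !addr0.
Qed.

Section ChartNeighbourhood.
Variables (R : realType) (n s m' : nat).
Variables (U : set (rvec R n.*2)) (H : rvec R n.*2 -> set (cvec R n.*2)).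
Hypotheses (cr : local_CR n U H) (sn : (s <= n)%N).

(** The kernel of the differential of the quotient map is [Kc], whence the involutivity
   of the latter. *)
Lemma CR_nbhd_chart (O W : set (rvec R n.*2)) (prj : rvec R n.*2 -> rvec R m') t :
  open O -> O `<=` U -> O `<=` W ->
  (forall x, U x -> has_rank (Kb U H 3 x) t) ->
  smooth_map W prj ->
  (forall x, W x -> forall v, cdiff prj x v = 0 <-> Kc U H x v) ->
  CR_nbhd s (n - s) U H O.
Proof.
move=> oO OU OW K3 sp ker; split=> //.
- by rewrite subnKC // addnn addn1.
- move=> V X Y oV VO; apply: (cr_involutive cr) => //; exact: subset_trans VO OU.
- move=> x v Ox Hv Hbv; have := cr_tot_real cr (OU _ Ox).
  by move=> /seteqP[/(_ v (conj Hv Hbv)) + _].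
- move=> V X Y oV VO sX sY q Vq; apply/(ker q (OW _ (VO _ Vq))).
  have VW : V `<=` W by exact: subset_trans VO OW.
  apply: (@lie_kernel _ _ _ V prj X Y q oV _ sX.1 sY.1 _ _ Vq).
  + by move=> j; exact: smoothS VW (sp j).
  + by move=> y Vy; apply/(ker y (VW _ Vy)); exact: sX.2.
  + by move=> y Vy; apply/(ker y (VW _ Vy)); exact: sY.2.
- by exists t => x /OU; exact: K3.
Qed.

End ChartNeighbourhood.

Theorem theorem2p24 (R : realType) (n s k : nat) (M : topologicalType)
    (A : atlas R n.*2 M) (Hs : idx A -> rvec R n.*2 -> set (cvec R n.*2))
    (hCR : CR_hypersurface Hs)
    (hk : uniformly_nondegenerate k Hs) (hs : Levi_rank s Hs)
    (i : idx A) (x : M) (hx : dom i x)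
    (W : set (rvec R n.*2)) (prj : rvec R n.*2 -> rvec R s.*2)
    (N : normalization R n.*2 s)
    (O : set (rvec R n.*2)) (phi : frame R n.*2 s (n - s))
    (Hm : 'M[R[i]]_s) (h : R) (X Om : 'I_(n - s) -> 'M[R[i]]_s) :
  let U := img i in
  let H := Hs i in
  let p := crd i x in
  local_quotient U H p W prj ->
  @normalization_condition R n.*2 s (n - s) N U H ->
  subnbhd U p O -> adapted U H O phi ->
  is_hermitian_pair U H phi p (Hm, h) ->
  (forall a, is_Xi U H phi p a (X a)) ->
  given_by U H W prj phi p (fun a => fe phi a p) Hm h X Om ->
  let eqs (B : 'I_(n - s) -> gmat R s) :=
    forall a b,
      mcoset (cder_mx (fe phi a p) (Sneg U H phi b) p
                - br (B a) (Sneg U H phi b p)) (gneg U H phi p)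
        = (ON N U H phi p).1 (fe phi a p) (Sneg U H phi b p) /\
      mcoset (cder_mx (fe phi a p) (Spos U H phi b) p
                - br (B a) (Spos U H phi b p)) (gpos U H phi p)
        = (ON N U H phi p).2 (fe phi a p) (Spos U H phi b p) in
  exists B : 'I_(n - s) -> gmat R s,
    [/\ (forall a, csp00 (B a)) /\ eqs B,
        forall B' : 'I_(n - s) -> gmat R s,
          (forall a, csp00 (B' a)) -> eqs B' ->
          forall a, g00 U H phi p (B' a - B a),
        exists phi', extension U H phi p phi' /\ normalized N U H phi' p,
        forall phi', extension U H phi p phi' -> normalized N U H phi' p ->
          given_by U H W prj phi' p (fun a => fe phi a p) Hm h X
                   (fun a => Om a + Lpart (B a)) &
        forall phi' phi'', extension U H phi p phi' -> normalized N U H phi' p ->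
          extension U H phi p phi'' -> normalized N U H phi'' p ->
          mod_symbol U H W prj phi' p = mod_symbol U H W prj phi'' p].
Proof.
move=> U H p lq nc nbO ad hHm hXi gb eqs.
have [oO OU Op] := nbO; have [oW WU Wp] := lq_nbhd lq.
have cr : local_CR n U H := cr_local hCR i.
have [sn _] := hs; have [_ [rk [hrk _ _]]] := hk.
pose O1 := O `&` W.
have oO1 : open O1 by exact: openI.
have O1p : O1 p by [].
have O1O : O1 `<=` O by move=> y [].
have O1W : O1 `<=` W by move=> y [].
have nb : CR_nbhd s (n - s) U H O1.
  apply: (CR_nbhd_chart cr sn oO1 (subset_trans O1O OU) O1W _ (lq_smooth lq) (lq_ker lq)).
  by move=> y Uy; exact: (hrk i 3%N y isT Uy).
have kp v : cdiff prj p v = 0 -> Kc U H p v by move=> /(lq_ker lq Wp v).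
have ad1 := adaptedS O1O ad.
have ext phi' : extension U H phi p phi' -> exists V2, [/\ CR_nbhd s (n - s) U H V2, V2 p,
    V2 `<=` O1 & adapted U H V2 phi'].
  move=> [ [V [oV VU Vp] ad'] _]; exists (O1 `&` V); split.
  - apply: CR_nbhdS nb; [by move=> y []|exact: openI].
  - by [].
  - by move=> y [].
  - by apply: adaptedS ad' => y [].
have Ke a : Kb U H 2 p (fe phi a p) by have [_] := ad_e ad a; apply.
have sol phi' : extension U H phi p phi' -> (Oneg U H phi' p, Opos U H phi' p) = ON N U H phi p ->
    eqs (fun a => cgen phi phi' p (fe phi a p)).
  move=> ex EO a b; have [V2 [nb2 V2p V21 ad2']] := ext _ ex.
  have ad2 := adaptedS V21 ad1; have [_ same] := ex.
  have [A1 r1] := same_iso_ch nb2 V2p ad2 ad2' same; rewrite -EO; split.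
    exact: esym (Oneg_change nb2 V2p ad2 ad2' A1 r1 b (Ke a)).
  exact: esym (Opos_change nb2 V2p ad2 ad2' A1 r1 b (Ke a)).
have uniq B B' : (forall a, csp00 (B a)) -> eqs B -> (forall a, csp00 (B' a)) -> eqs B' ->
    forall a, g00 U H phi p (B' a - B a).
  move=> cB eB cB' eB' a.
  apply: (solution_unique (D := fun b => cder_mx (fe phi a p) (Sneg U H phi b) p)
    (E := fun b => cder_mx (fe phi a p) (Spos U H phi b) p) (cB' a) (cB a)) => b.
    by have [E1 _] := eB' a b; have [E2 _] := eB a b; exact: etrans E1 (esym E2).
  by have [_ E1] := eB' a b; have [_ E2] := eB a b; exact: etrans E1 (esym E2).
have normE phi' : extension U H phi p phi' -> ON N U H phi' p = ON N U H phi p.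
  move=> ex; have [V2 [nb2 V2p V21 ad2']] := ext _ ex.
  exact: (ON_eq nb2 V2p (adaptedS V21 ad1) ad2' ex.2).
have [[phi0 ex0 EO0] _] := nc p O phi nbO ad.
pose B a := cgen phi phi0 p (fe phi a p).
have eB : eqs B by apply: sol ex0 _; exact: esym EO0.
have cB a : csp00 (B a) by exact: cgen00.
exists B; split.
- by split; [exact: cB|exact: eB].
- by move=> B' cB' eB'; exact: uniq.
- by exists phi0; split; [exact: ex0|rewrite /normalized (normE _ ex0)].
- move=> phi' ex nm a; have EO : (Oneg U H phi' p, Opos U H phi' p) = ON N U H phi p.
    by rewrite -(normE _ ex); exact: nm.
  have [V2 [nb2 V2p V21 ad2']] := ext _ ex.
  have ad2 := adaptedS V21 ad1; have [_ same] := ex.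
  have [D iD gD] := gb a; exists (D + cgen phi phi' p (fe phi a p)).
    exact: (iota_sec_change nb2 V2p kp ad2 ad2' same iD).
  rewrite (g00_eq nb2 V2p ad2 ad2' same).
  have gC := uniq _ _ cB eB (fun a => cgen00 _ _ _ _) (sol _ ex EO) a.
  have [c [L EB]] := cB a.
  have gc : g00 U H phi p (B a - cel 0 (Lpart (B a)) 0 0).
    rewrite EB Lpart_cel cel_center; exact: (g00_center c nb O1p ad1).
  rewrite cel_splitL; have sum (V : zmodType) (d e w y z : V) :
      d + e - (w + y) = (d - w) + ((e - z) + (z - y)).
    by rewrite opprD addrACA (addrA (e - z)) subrK.
  by rewrite (sum _ _ _ _ _ (B a)); apply: g00D gD (g00D gC gc).
- move=> phi' phi'' ex' nm' ex'' nm''.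
  have EO : (Oneg U H phi' p, Opos U H phi' p) = (Oneg U H phi'' p, Opos U H phi'' p).
    have N1 : (Oneg U H phi' p, Opos U H phi' p) = ON N U H phi' p := nm'.
    have N2 : (Oneg U H phi'' p, Opos U H phi'' p) = ON N U H phi'' p := nm''.
    exact: etrans (etrans N1 (normE _ ex')) (esym (etrans N2 (normE _ ex''))).
  have [V2 [nb2 V2p V21 ad2']] := ext _ ex'.
  have [V3 [nb3 V3p V31 ad3'']] := ext _ ex''.
  pose V4 := V2 `&` V3.
  have V42 : V4 `<=` V2 by move=> y [].
  have nb4 := CR_nbhdS V42 (openI (nb_open nb2) (nb_open nb3)) nb2.
  have V4p : V4 p := conj V2p V3p.
  have V43 : V4 `<=` V3 by move=> y [].
  have ad4' := adaptedS V42 ad2'.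
  have ad4'' := adaptedS V43 ad3''.
  have ad4 := adaptedS (subset_trans V42 V21) ad1.
  have E1 := frame_iso_eq nb4 V4p ad4 ad4' ex'.2.
  have same : same_iso U H p phi' phi'' by have := ex''.2; rewrite /same_iso E1.
  have same' : same_iso U H p phi'' phi' by have [tau [t1 t2]] := same; exact: ex_intro _ tau (conj t2 t1).
  have EN := congr1 fst EO; have EP := congr1 snd EO; apply/seteqP; split.
    exact: (mod_symbol_sub nb4 V4p kp ad4' ad4'' same EN EP).
  exact: (mod_symbol_sub nb4 V4p kp ad4'' ad4' same' (esym EN) (esym EP)).
Qed.
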